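(* Let $\mathcal{M}=(M_k)_{k\ge0}$ be a regular sequence and $m_k=M_k/k!$. Let $U\subset\mathbb{R}^m$, $\Omega\subset\mathbb{C}^m$, $\Sigma$, $Z$ and $X=(X_1,\dots,X_m)$ be as described in the context (so $\Sigma\cap\Omega=Z(U)$ is a maximally real graph through the origin and $X_kZ_j=\delta_{jk}$). Let $f\in\mathcal{C}^{\mathcal{M}}(U,X)$, regarded also as a function on $\Sigma\cap\Omega$ through the diffeomorphism $Z:U\to\Sigma\cap\Omega$, and let $\kappa\ge1$ be an integer. Then there exist a neighbourhood $\mathcal{O}\subset\mathbb{C}^m$ of the origin, a function $F\in\mathcal{C}^\kappa(\mathcal{O})$ and a constant $C>0$ such that $$F|_{\mathcal{O}\cap\Sigma}=f|_{\mathcal{O}\cap\Sigma},$$ $$|\bar\partial_zF(z)|\le C^{k+1}m_k\,\mathrm{dist}(z,\Sigma)^k,\qquad k\in\mathbb{Z}_+,\ z\in\mathcal{O}.$$ When $\mathcal{M}$ has moderate growth, the extension $F$ can be taken $\mathcal{C}^\infty$-smooth.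
   Context: $\mathbb{Z}_+=\{0,1,2,\dots\}$. A sequence $\mathcal{M}=(M_k)_{k=0}^\infty$ of non-negative numbers is regular if, with $m_k=M_k/k!$: (a) $m_0=m_1=1$; (b) $m_k^2\le m_{k-1}m_{k+1}$ for $k\ge1$; (c) $\sup_{k\ge1}(m_{k+1}/m_k)^{1/k}<\infty$; (d) $\lim_{k\to\infty} m_k^{1/k}=\infty$. It has moderate growth if in addition $\sup_k\big(M_k/\min_{0\le n\le k}M_nM_{k-n}\big)^{1/(k+1)}<\infty$. A $\mathcal{C}^\infty$-smooth submanifold $\Sigma\subset\mathbb{C}^m$ (of real dimension $m$) is maximally real if $\mathrm{d}(z_1|_\Sigma),\dots,\mathrm{d}(z_m|_\Sigma)$ are $\mathbb{C}$-linearly independent at each point of $\Sigma$. Standing normalization (local, near $0\in\Sigma$): $\Omega\subset\mathbb{C}^m$ is an open neighbourhood of the origin, $U\subset\mathbb{R}^m$ is an open neighbourhood of the origin, $\varphi:U\to\mathbb{R}^m$ is $\mathcal{C}^\infty$ with $\varphi(0)=0$, $\mathrm{d}\varphi(0)=0$, $|\varphi(x)-\varphi(x')|\le C_\varphi|x-x'|$ on $U$ with $C_\varphi<1$, and $\Sigma\cap\Omega=\{x+iy\in\Omega: y=\varphi(x)\}=Z(U)$, where $Z(x)=x+i\varphi(x)$. The matrix $Z_x=[\delta_{j\ell}+i\,\partial\varphi_j/\partial x_\ell]$ is invertible in $U$. Let ${}^t[a_{k\ell}]$ be the inverse of $Z_x$ and, in the coordinates $x\in U$ of $\Sigma\cap\Omega$,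 let $X_k=\sum_{\ell=1}^m a_{k\ell}\,\partial/\partial x_\ell$, $1\le k\le m$; these are pairwise commuting $\mathcal{C}^\infty$ complex vector fields characterized by $X_kZ_j=\delta_{jk}$ (i.e. dual to $\mathrm{d}(z_j|_\Sigma)$). $\mathcal{C}^{\mathcal{M}}(U,X)$ is the space of $f\in\mathcal{C}^\infty(U)$ such that for every compact $K\subset U$ there is $C>0$ with $\sup_K|X^\alpha f|\le C^{|\alpha|+1}M_{|\alpha|}$ for all $\alpha\in\mathbb{Z}_+^m$, where $X^\alpha=X_1^{\alpha_1}\circ\cdots\circ X_m^{\alpha_m}$. $\bar\partial_zF=(\partial F/\partial\bar z_1,\dots,\partial F/\partial\bar z_m)$. *)

(* Defs.v *)
From HB Require Import structures.
From mathcomp Require Import all_boot all_order all_algebra.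
From mathcomp Require Import complex.
From mathcomp Require Import all_classical all_reals all_analysis.

Set Implicit Arguments.
Unset Strict Implicit.
Unset Printing Implicit Defensive.

Import Order.TTheory GRing.Theory Num.Theory.
Import numFieldNormedType.Exports.

Local Open Scope classical_set_scope.
Local Open Scope ring_scope.
Local Open Scope complex_scope.

(* C^m is kept as the real vector space R^m * R^m, the pair (x, y) standing for
   x + iy, so that real derivatives, the topology and the real submanifolds of
   C^m are those of the library; scalar complex values live in R[i]. *)
Notation Cspace R m := ('rV[R]_m * 'rV[R]_m)%type.

Definition ccoord (R : realType) (m : nat) (z : Cspace R m) (j : 'I_m) : R[i] :=
  z.1 0 j +i* z.2 0 j.

(* The norm that the library puts on 'rV[R]_m and on products is a sup norm
   (same topology); the estimates below use the Euclidean ones. *)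
Definition enorm (R : realType) (m : nat) (x : 'rV[R]_m) : R :=
  Num.sqrt (\sum_(i < m) x 0 i ^+ 2).

Definition cnorm (R : realType) (m : nat) (w : 'I_m -> R[i]) : R :=
  Num.sqrt (\sum_(i < m) ComplexField.Normc.normc (w i) ^+ 2).

Definition dist_to (R : realType) (m : nat) (z : Cspace R m)
    (S : set (Cspace R m)) : R :=
  inf [set cnorm (ccoord (z - w)) | w in S].

(* For D open and V, W finite dimensional this is the usual C^k on D: f' is of
   class C^k as a map into the linear maps V -> W iff all its evaluations
   x |-> f'(x) v = 'D_v f x are. *)
Fixpoint Ck (R : realType) (V W : normedModType R) (k : nat) (D : set V)
    (f : V -> W) : Prop :=
  match k with
  | 0%N => forall x, D x -> {for x, continuous f}
  | k'.+1 => (forall x, D x -> differentiable f x) /\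
             (forall v : V, Ck k' D (fun x => 'D_v f x))
  end.

Definition Cinfty (R : realType) (V W : normedModType R) (D : set V)
    (f : V -> W) : Prop :=
  forall k, Ck k D f.

Section ComplexValued.
Variables (R : realType) (V : normedModType R).

Definition re_part (f : V -> R[i]) : V -> R := fun x => complex.Re (f x).
Definition im_part (f : V -> R[i]) : V -> R := fun x => complex.Im (f x).

Definition cCk (k : nat) (D : set V) (f : V -> R[i]) : Prop :=
  Ck k D (re_part f) /\ Ck k D (im_part f).

Definition cCinfty (D : set V) (f : V -> R[i]) : Prop :=
  forall k, cCk k D f.

Definition cderive (v : V) (f : V -> R[i]) (x : V) : R[i] :=
  'D_v (re_part f) x +i* 'D_v (im_part f) x.

End ComplexValued.

Definition dbar (R : realType) (m : nat) (F : Cspace R m -> R[i])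
    (z : Cspace R m) (j : 'I_m) : R[i] :=
  2^-1 * (cderive (delta_mx 0 j, 0) F z + 'i%C * cderive (0, delta_mx 0 j) F z).

Section Sequences.
Variable R : realType.
Implicit Type M : nat -> R.

Definition mseq M (k : nat) : R := M k / (k`!)%:R.

Definition regular_sequence M : Prop :=
  [/\ forall k, 0 <= M k,
      mseq M 0%N = 1 /\ mseq M 1%N = 1,
      forall k, (1 <= k)%N -> mseq M k ^+ 2 <= mseq M k.-1 * mseq M k.+1,
      has_ubound [set (mseq M k.+1 / mseq M k) `^ (k%:R^-1)
                 | k in [set k : nat | (1 <= k)%N]]
    & (fun k : nat => mseq M k `^ (k%:R^-1)) @ \oo --> +oo].

(* The default value M 0 * M k of the minimum is its term of index 0. *)
Definition moderate_growth M : Prop :=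
  has_ubound [set (M k / \big[Num.min/M 0%N * M k]_(n < k.+1) (M n * M (k - n)%N))
                    `^ (k.+1%:R^-1) | k in [set: nat]].

End Sequences.

Section MaximallyReal.
Variables (R : realType) (m : nat).
Implicit Types (Sigma : set (Cspace R m)) (V : set 'rV[R]_m)
  (W : set (Cspace R m)) (psi : 'rV[R]_m -> Cspace R m).

(* A regular parametrization: a smooth immersion of V that is a homeomorphism
   onto the relatively open part of Sigma lying in W. *)
Definition parametrization Sigma W V psi : Prop :=
  [/\ open V /\ open W,
      Cinfty V psi,
      psi @` V = Sigma `&` W,
      forall t, V t -> injective ('d psi t)
    & exists2 chi : Cspace R m -> 'rV[R]_m,
        {within Sigma `&` W, continuous chi} &
        forall t, V t -> chi (psi t) = t].

Definition submanifold Sigma : Prop :=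
  forall p, Sigma p -> exists W V psi, parametrization Sigma W V psi /\ W p.

(* The tangent space of Sigma at psi t is the range of 'd psi t, and dz_j maps a
   tangent vector w to ccoord w j. *)
Definition maximally_real Sigma : Prop :=
  submanifold Sigma /\
  forall W V psi, parametrization Sigma W V psi ->
  forall t, V t -> forall c : 'I_m -> R[i],
    (forall v : 'rV[R]_m, \sum_(j < m) c j * ccoord ('d psi t v) j = 0) ->
    forall j, c j = 0.

End MaximallyReal.

Section DualFields.
Variables (R : realType) (m : nat) (phi : 'rV[R]_m -> 'rV[R]_m).

Definition Zmap (x : 'rV[R]_m) : Cspace R m := (x, phi x).

Definition Zjac (x : 'rV[R]_m) : 'M[R[i]]_m :=
  \matrix_(j, l) ((j == l)%:R
    + 'i%C * ('D_(delta_mx 0 l) (fun y => phi y 0 j) x)%:C).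

(* Under the standing Lipschitz bound the inverse is a genuine one on U and the
   fields below are dual to the dz_j: see Zjac_unit and Xfield_dual. *)
Definition Xcoef (x : 'rV[R]_m) : 'M[R[i]]_m := (invmx (Zjac x))^T.

Definition Xfield (k : 'I_m) (f : 'rV[R]_m -> R[i]) : 'rV[R]_m -> R[i] :=
  fun x => \sum_(l < m) Xcoef x k l * cderive (delta_mx 0 l) f x.

Definition mlen (alpha : 'I_m -> nat) : nat := (\sum_(k < m) alpha k)%N.

(* enum 'I_m is increasing, so the factor of index 0 is applied last. *)
Definition Xpow (alpha : 'I_m -> nat) (f : 'rV[R]_m -> R[i]) :
    'rV[R]_m -> R[i] :=
  foldr (fun k g => iter (alpha k) (Xfield k) g) f (enum 'I_m).

Definition CM (M : nat -> R) (U : set 'rV[R]_m) (f : 'rV[R]_m -> R[i]) : Prop :=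
  cCinfty U f /\
  forall K : set 'rV[R]_m, compact K -> K `<=` U ->
    exists2 C : R, 0 < C &
      forall (alpha : 'I_m -> nat) x, K x ->
        ComplexField.Normc.normc (Xpow alpha f x)
          <= C ^+ (mlen alpha).+1 * M (mlen alpha).

Lemma Xfield_dual (k j : 'I_m) (x : 'rV[R]_m) :
  differentiable phi x -> Zjac x \in unitmx ->
  Xfield k (fun y => ccoord (Zmap y) j) x = (j == k)%:R.
Proof.
move=> dphi Zu.
have dcoord n (i : 'I_n) (y v : 'rV[R]_n) :
    'D_v (fun y : 'rV[R]_n => y 0 i) y = v 0 i.
  have df := @differentiable_coord R 1 n y 0 i.
  rewrite deriveE//.
  pose g := fun N : 'rV[R]_n => N 0 i.
  have lg : linear g by move=> a u w; rewrite /g !mxE.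
  pose G := HB.pack g (GRing.isLinear.Build _ _ _ _ g lg) : {linear 'rV[R]_n -> R}.
  by rewrite (_ : (fun _ => _) = G)// diff_lin//; exact: coord_continuous.
rewrite /Xfield.
under eq_bigr => l _.
  rewrite /cderive /re_part /im_part /ccoord /= dcoord mxE.
  over.
transitivity ((Zjac x *m invmx (Zjac x)) j k); last by rewrite mulmxV// mxE.
rewrite mxE; apply: eq_bigr => l _; rewrite mulrC; congr (_ * _).
rewrite !mxE eqxx /=.
by case: (j == l); rewrite /real_complex_def /=; simpc.
Qed.

Lemma Zjac_unit (U : set 'rV[R]_m) (C : R) (x : 'rV[R]_m) :
  open U -> U x -> differentiable phi x -> C < 1 ->
  (forall y y', U y -> U y' -> enorm (phi y - phi y') <= C * enorm (y - y')) ->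
  Zjac x \in unitmx.
Proof.
move=> oU Ux dphi C1 lip.
have enormZ a (v : 'rV[R]_m) : enorm (a *: v) = `|a| * enorm v.
  rewrite /enorm -sqrtr_sqr -sqrtrM ?sqr_ge0// mulr_sumr; congr Num.sqrt.
  by apply: eq_bigr => i _; rewrite mxE exprMn.
have sq_cont (i : 'I_m) : continuous (fun y : 'rV[R]_m => y 0 i ^+ 2).
  move=> y; apply: (@continuous_comp _ _ _ (fun y : 'rV[R]_m => y 0 i)
    (fun t : R => t ^+ 2)); first exact: coord_continuous.
  exact: exprn_continuous.
have sum_cont (r : seq 'I_m) :
    continuous (fun y : 'rV[R]_m => \sum_(i <- r) y 0 i ^+ 2).
  elim: r => [|i r IHr].
    rewrite (_ : (fun _ => _) = cst 0); first by move=> y; exact: cst_continuous.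
    by apply/funext => y; rewrite big_nil.
  rewrite (_ : (fun _ => _) = (fun y : 'rV[R]_m => y 0 i ^+ 2)
      \+ (fun y : 'rV[R]_m => \sum_(i <- r) y 0 i ^+ 2)); last first.
    by apply/funext => y; rewrite big_cons.
  by move=> y; exact: (continuousD (sq_cont i y) (IHr y)).
have enorm_cont : continuous (@enorm R m).
  move=> v; apply: continuous_comp; last exact: sqrt_continuous.
  exact: sum_cont.
have dphi_le v : enorm ('d phi x v) <= C * enorm v.
  have cv := @diff_derivable _ _ _ phi x v dphi.
  rewrite -deriveE//.
  have ce := @cvg_comp _ _ _
    (fun h : R => h^-1 *: ((phi \o shift x) (h *: v) - phi x)) (@enorm R m) _ _ _ cv (enorm_cont _).
  have {}ce : (fun h : R => enorm (h^-1 *: ((phi \o shift x) (h *: v) - phi x))) h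
      @[h --> (0 : R)^'] --> enorm ('D_v phi x) by exact: ce.
  apply: (cvgr_to_le ce).
  have Unear : \forall h \near (0 : R)^', U (h *: v + x).
    apply: nbhs_dnbhs.
    have ch : {for (0 : R), continuous (fun h : R => h *: v + x)}.
      apply: (@continuousD _ _ _ (fun h : R => h *: v) (cst x)).
        exact: scalel_continuous.
      exact: cst_continuous.
    apply: ch; rewrite scale0r add0r; exact: open_nbhs_nbhs.
  near=> h.
  have h0 : h != 0 by near: h; exact: nbhs_dnbhs_neq.
  have Uh : U (h *: v + x) by near: h.
  rewrite enormZ /= normfV ler_pdivrMl ?normr_gt0//.
  apply: le_trans (lip _ _ Uh Ux) _.
  by rewrite addrK enormZ mulrCA.
have dphiE v j : ('d phi x v) 0 j =
    \sum_(l < m) 'D_(delta_mx 0 l) (fun y => phi y 0 j) x * v 0 l.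
  rewrite {1}[v]row_sum_delta linear_sum summxE; apply: eq_bigr => l _.
  rewrite linearZ mxE mulrC; congr (_ * _).
  by rewrite -deriveE// derive_mx ?mxE//; exact: diff_derivable.
rewrite -unitmx_tr -row_free_unit -kermx_eq0; apply/rowV0P => w /sub_kermxP w0.
pose u : 'rV[R]_m := \row_i complex.Re (w 0 i).
pose v : 'rV[R]_m := \row_i complex.Im (w 0 i).
have H j : u 0 j = ('d phi x v) 0 j /\ v 0 j = - ('d phi x u) 0 j.
  move/matrixP : w0 => /(_ 0 j); rewrite !mxE => w0.
  have sumE (a : 'I_m -> R) : \sum_(l < m) a l * (j == l)%:R = a j.
    rewrite (bigD1 j)//= eqxx mulr1 big1 ?addr0// => l.
    by rewrite eq_sym => /negbTE ->; rewrite mulr0.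
  pose d l := 'D_(delta_mx 0 l) (fun y => phi y 0 j) x.
  have wE l : w 0 l * (Zjac x)^T l j =
      (u 0 l * (j == l)%:R - d l * v 0 l) +i* (v 0 l * (j == l)%:R + d l * u 0 l).
    rewrite !mxE; case: (w 0 l) => a b; rewrite -/(d l) /= /real_complex_def.
    by case: (j == l); simpc; rewrite !(mulrC _ (d l)) ?[_ + b]addrC ?mul1r ?mulr1.
  rewrite !dphiE; split.
    have := congr1 (@complex.Re R) w0; rewrite raddf_sum/=.
    under eq_bigr => l _ do rewrite wE /=.
    by rewrite big_split /= sumE sumrN => /eqP; rewrite subr_eq0 => /eqP <-; rewrite mxE.
  have := congr1 (@complex.Im R) w0; rewrite raddf_sum/=.
  under eq_bigr => l _ do rewrite wE /=.
  by rewrite big_split /= sumE => /eqP; rewrite addr_eq0 => /eqP <-; rewrite mxE.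
have Hu : u = 'd phi x v by apply/rowP => j; case: (H j).
have Hv : v = - 1 *: 'd phi x u.
  by apply/rowP => j; case: (H j) => _ ->; rewrite mxE mulN1r.
have enorm_ge0 y : 0 <= @enorm R m y by exact: sqrtr_ge0.
have enorm0 (y : 'rV[R]_m) : enorm y = 0 -> y = 0.
  move/eqP; rewrite sqrtr_eq0 => y0; apply/rowP => i; rewrite mxE.
  have s0 : \sum_(i < m) y 0 i ^+ 2 = 0.
    by apply/eqP; rewrite eq_le y0 sumr_ge0// => k _; rewrite sqr_ge0.
  apply/eqP; rewrite -sqrf_eq0; apply/eqP.
  by apply: (psumr_eq0P _ s0) => // k _; rewrite sqr_ge0.
have eu : enorm u <= C * enorm v by rewrite {1}Hu.
have ev : enorm v <= C * enorm u by rewrite {1}Hv enormZ normrN1 mul1r.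
have s0 : enorm u + enorm v <= 0.
  rewrite -(pmulr_rle0 _ (_ : 0 < 1 - C)) ?subr_gt0//.
  by rewrite mulrBl mul1r subr_le0 mulrDr addrC lerD.
have := enorm_ge0 u; have := enorm_ge0 v => v_ge0 u_ge0.
have u0 : u = 0 by apply: enorm0; apply: le_anti; rewrite u_ge0 andbT; apply: le_trans s0; rewrite lerDl.
have v0 : v = 0 by apply: enorm0; apply: le_anti; rewrite v_ge0 andbT; apply: le_trans s0; rewrite lerDr.
apply/rowP => i; move/rowP : u0 => /(_ i); move/rowP : v0 => /(_ i).
by rewrite !mxE; case: (w 0 i) => a b /= -> ->.
Unshelve. all: by end_near. Qed.

End DualFields.

(* When O is contained in Omega, where Sigma is Zmap phi @` U, the first clause
   reads F = f on all of Sigma `&` O, f being transported by Zmap phi. *)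
Definition extends_with_estimate (R : realType) (m : nat) (M : nat -> R)
    (phi : 'rV[R]_m -> 'rV[R]_m) (U : set 'rV[R]_m)
    (Sigma O : set (Cspace R m)) (f : 'rV[R]_m -> R[i])
    (F : Cspace R m -> R[i]) (C : R) : Prop :=
  (forall x, U x -> O (Zmap phi x) -> F (Zmap phi x) = f x) /\
  (forall (k : nat) z, O z ->
     cnorm (dbar F z) <= C ^+ k.+1 * mseq M k * dist_to z Sigma ^+ k).

(* Main.v *)
(* Write [x + iy] in the coordinates [x] and [t = y - phi x], so that
   [z - Z x = i t], and let [P_n = \sum_(|alpha| = n) X^alpha f (x) (i t)^alpha / alpha!]
   be the terms of the formal Taylor expansion of [f] at [Z x].  As the [X_k]
   commute, [dbar P_n = H_n - H_(n-1)], where [H_n] is made of derivatives of [f]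
   of order [n + 1] and is homogeneous of degree [n] in [t].  The extension is
   [F = \sum_n chi (|t|^2 / r_n^2) P_n] with a bump function [chi] and
   [r_n = m_n / (A m_(n+1))].

   Summing by parts, at a given [t] only the [n] with [r_(n+1) / 2 <= |t| <= r_n]
   contribute to [dbar F]; for these, log-convexity of [m] makes [m_n |t|^n]
   minimal among the [m_k |t|^k] up to factors [c^n], which a large [A] absorbs,
   and up to [(2A)^k].  The same choice of [r_n] makes the series converge in
   [C^kappa] once [A] is large with respect to [kappa]; under moderate growth
   the quotients [m_(n+1) / m_n] grow at most polynomially and one [A] works
   for all orders of differentiation. *)
Require Import Defs.
From HB Require Import structures.
From mathcomp Require Import all_boot all_order all_algebra.
From mathcomp Require Import complex.
From mathcomp Require Import all_classical all_reals all_analysis.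
From mathcomp Require Import ring lra zify.

Set Implicit Arguments.
Unset Strict Implicit.
Unset Printing Implicit Defensive.

Import Order.TTheory GRing.Theory Num.Theory.
Import numFieldNormedType.Exports.

Local Open Scope classical_set_scope.
Local Open Scope ring_scope.
Local Open Scope complex_scope.

(** * Differentiability and the classes C^k *)

(** The radius [r_n] is dictated by log-convexity: the quotients [m_(j+1) |t| / m_j] are
    nondecreasing in [j], and once [|t| <= r_n] they are at most [1 / A] for all [j <= n], so the
    terms still switched on decay geometrically. The price is that each derivative of a cutoff costs
    [1 / r_n = A m_(n+1) / m_n], a quotient that regularity bounds only by [B^n]. Hence [k]
    derivatives cost a factor [B^(nk)], which is why [A], and [F] with it, depends on [kappa] in
    general.

    Two features shape the estimates. The [x]-derivatives of [X^alpha f] are not among the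
    quantities bounded by hypothesis; since [dg = \sum_k (X_k g) dZ_k], each one is a combination,
    with smooth coefficients, of [X]-words one letter longer. So everything is estimated for words,
    and commutation brings words back to multi-indices. Moreover bounds are kept in the form [a r^j]
    for derivatives of order [j], a form stable under products and composition, so that the
    dependence on [n] and [r_n] stays explicit down to the convergence of the series. *)

Lemma differentiable_intro (R : realType) (V W : normedModType R) (f : V -> W)
    (x : V) (df : {linear V -> W}) :
  continuous df ->
  (forall e : R, 0 < e ->
     \forall h \near (0 : V), `|f (h + x) - f x - df h| <= e * `|h|) ->
  differentiable f x /\ 'd f x = df :> (V -> W).
Proof.
move=> dfc H.
have E : f \o shift x = cst (f x) + df +o_ 0 id.
  apply/eqaddoP => e e0; near=> h.
  rewrite /= opprD addrA; near: h; exact: H.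
have U := diff_unique dfc E; split=> //.
by apply/diff_locallyP; rewrite U.
Unshelve. all: by end_near. Qed.

Lemma differentiable_littleo (R : realType) (V W : normedModType R)
    (f : V -> W) (x : V) :
  differentiable f x ->
  forall e : R, 0 < e ->
     \forall h \near (0 : V), `|f (h + x) - f x - 'd f x h| <= e * `|h|.
Proof.
move=> /diff_locally /eqaddoP H e e0; near=> h.
rewrite -addrA -opprD.
near: h; exact: H.
Unshelve. all: by end_near. Qed.

Lemma near_eq_differentiable (R : realType) (V W : normedModType R)
    (f g : V -> W) (x : V) :
  (\forall y \near x, f y = g y) -> differentiable f x -> differentiable g x.
Proof.
move=> fg df.
have [] // := @differentiable_intro _ _ _ g x ('d f x).
  exact: diff_continuous.
move=> e e0.
have fg0 : \forall h \near (0 : V), f (h + x) = g (h + x).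
  by move: fg; rewrite (near_shift 0) /= subr0.
have fgx : f x = g x by exact: nbhs_singleton fg.
near=> h.
rewrite -fgx -(near fg0 h) //; near: h; exact: differentiable_littleo.
Unshelve. all: by end_near. Qed.

Section CkCalculus.
Variables (R : realType) (V : normedModType R).
Implicit Types (D : set V).

Lemma open_near_eq (T : Type) D (f g : V -> T) x : open D -> D x ->
  (forall y, D y -> f y = g y) -> \forall y \near x, f y = g y.
Proof.
move=> oD Dx fg; near=> y; apply: fg; near: y.
exact: open_nbhs_nbhs.
Unshelve. all: by end_near. Qed.

(** Derivatives at a point see only nearby values, whence [open D]. [Ck] speaks of ['D_v f] as a
    function on all of [V], while formulas for it are known on [D] only; the rules for sums,
    products and inverses pass through this lemma. *)
Lemma Ck_ext (W : normedModType R) k D (f g : V -> W) : open D ->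
  (forall x, D x -> f x = g x) -> Ck k D f -> Ck k D g.
Proof.
move=> oD; elim: k f g => [|k IH] f g fg /=.
  move=> cf x Dx; have nfg := open_near_eq oD Dx fg.
  rewrite /prop_for /continuous_at -(fg _ Dx).
  apply: cvg_trans (cf x Dx).
  exact: near_eq_cvg.
move=> [df dkf]; split.
  move=> x Dx; apply: near_eq_differentiable (df x Dx).
  exact: open_near_eq fg.
move=> v; apply: IH (dkf v) => x Dx; apply: near_eq_derive.
exact: open_near_eq fg.
Unshelve. all: by end_near. Qed.

Lemma Ck_sub (W : normedModType R) k D D' (f : V -> W) : D' `<=` D ->
  Ck k D f -> Ck k D' f.
Proof.
move=> DD; elim: k f => [|k IH] f /=; first by move=> cf x /DD; exact: cf.
move=> [df dkf]; split; first by move=> x /DD; exact: df.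
by move=> v; exact: IH.
Qed.

Lemma Ck_continuous (W : normedModType R) k D (f : V -> W) x : D x ->
  Ck k D f -> {for x, continuous f}.
Proof.
move=> Dx; case: k => [|k] /=; first exact.
by move=> [df _]; apply: differentiable_continuous; exact: df.
Qed.

Lemma CkW (W : normedModType R) k D (f : V -> W) : Ck k.+1 D f -> Ck k D f.
Proof.
elim: k f => [|k IH] f; first by move=> fk x Dx; exact: Ck_continuous fk.
move=> [df dkf]; split=> // v; exact: IH.
Qed.

Lemma Ck_cst (W : normedModType R) k D (c : W) : Ck k D (fun _ : V => c).
Proof.
elim: k c => [|k IH] c /=; first by move=> x _; exact: cst_continuous.
split=> [x _|v]; first exact: differentiable_cst.
have -> : 'D_v (fun _ : V => c) = (fun _ => 0); last exact: IH.
by apply/funext => x; rewrite -[LHS]/('D_v (cst c) x) derive_cst.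
Qed.

Lemma Ck_add (W : normedModType R) k D (f g : V -> W) : open D ->
  Ck k D f -> Ck k D g -> Ck k D (fun x => f x + g x).
Proof.
move=> oD; elim: k f g => [|k IH] f g /=.
  by move=> cf cg x Dx; apply: continuousD; [exact: cf|exact: cg].
move=> [df dkf] [dg dkg]; split=> [x Dx|v].
  exact: (differentiableD (df x Dx) (dg x Dx)).
apply: (Ck_ext oD _ (IH _ _ (dkf v) (dkg v))) => x Dx.
by rewrite -deriveD//; apply: diff_derivable; [exact: df|exact: dg].
Qed.

Lemma Ck_mul k D (f g : V -> R) : open D ->
  Ck k D f -> Ck k D g -> Ck k D (fun x => f x * g x).
Proof.
move=> oD; elim: k f g => [|k IH] f g.
  by move=> cf cg x Dx; apply: continuousM; [exact: cf|exact: cg].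
move=> fk gk; have [df dkf] := fk; have [dg dkg] := gk; split=> [x Dx|v].
  exact: (differentiableM (df x Dx) (dg x Dx)).
apply: (Ck_ext oD _ (Ck_add oD (IH _ _ (CkW fk) (dkg v))
                               (IH _ _ (CkW gk) (dkf v)))) => x Dx.
by rewrite -[RHS]/('D_v (f * g) x) deriveM//; apply: diff_derivable;
  [exact: df|exact: dg].
Qed.

Lemma Ck_scale k D (c : R) (f : V -> R) : open D ->
  Ck k D f -> Ck k D (fun x => c * f x).
Proof. by move=> oD; apply: Ck_mul => //; exact: Ck_cst. Qed.

Lemma Ck_opp k D (f : V -> R) : open D ->
  Ck k D f -> Ck k D (fun x => - f x).
Proof.
move=> oD /(Ck_scale (-1) oD); apply: Ck_ext => // x _; exact: mulN1r.
Qed.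

Lemma Ck_sum k D (I : Type) (r : seq I) (f : I -> V -> R) : open D ->
  (forall i, Ck k D (f i)) -> Ck k D (fun x => \sum_(i <- r) f i x).
Proof.
move=> oD fk; elim: r => [|i r IH].
  by apply: (Ck_ext oD _ (Ck_cst k D 0)) => x _; rewrite big_nil.
by apply: (Ck_ext oD _ (Ck_add oD (fk i) IH)) => x _; rewrite big_cons.
Qed.

Lemma Ck_inv k D (f : V -> R) : open D -> (forall x, D x -> f x != 0) ->
  Ck k D f -> Ck k D (fun x => (f x)^-1).
Proof.
move=> oD f0; elim: k => [|k IH].
  by move=> cf x Dx; apply: continuousV; [exact: f0|exact: cf].
move=> fk; have [df dkf] := fk; split=> [x Dx|v].
  exact: (differentiableV (df x Dx) (f0 x Dx)).
have iv := IH (CkW fk).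
have := Ck_mul oD (Ck_mul oD iv iv) (Ck_opp oD (dkf v)).
apply: Ck_ext => // x Dx.
rewrite deriveV ?f0//; last by apply: diff_derivable; exact: df.
by rewrite mulrN scaleNr [_ *: _]/(_ * _) expr2 invfM.
Qed.

End CkCalculus.

Section DirectionLinear.
Variables (R : realType) (V W : normedModType R).
Implicit Types (f : V -> W) (u v x : V).

Lemma derive_scale_dir f x c v : differentiable f x ->
  'D_(c *: v) f x = c *: 'D_v f x.
Proof. by move=> df; rewrite !deriveE// [LHS]linearZ. Qed.

Lemma derive_add_dir f x u v : differentiable f x ->
  'D_(u + v) f x = 'D_u f x + 'D_v f x.
Proof. by move=> df; rewrite !deriveE// [LHS]linearD. Qed.

Lemma derive_sum_dir f x (I : Type) (r : seq I) (u : I -> V) :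
  differentiable f x ->
  'D_(\sum_(i <- r) u i) f x = \sum_(i <- r) 'D_(u i) f x.
Proof.
move=> df; elim: r => [|i r IH]; first by rewrite !big_nil derive0.
by rewrite !big_cons derive_add_dir// IH.
Qed.

End DirectionLinear.

Section CkLinear.
Variables (R : realType) (V W W' : normedModType R).

Lemma derive_linear (L : {linear W -> W'}) (f : V -> W) x v :
  continuous L -> differentiable f x ->
  differentiable (L \o f) x /\ 'D_v (L \o f) x = L ('D_v f x).
Proof.
move=> cL df; have dL : differentiable L (f x) by exact: linear_differentiable.
have dLf : differentiable (L \o f) x by exact: differentiable_comp.
by split=> //; rewrite !deriveE// diff_comp//= diff_lin.
Qed.

Lemma derive_comp_linear (L : {linear V -> W}) (f : W -> W') x v :
  continuous L -> differentiable f (L x) ->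
  differentiable (f \o L) x /\ 'D_v (f \o L) x = 'D_(L v) f (L x).
Proof.
move=> cL df; have dL : differentiable L x by exact: linear_differentiable.
have dLf : differentiable (f \o L) x by exact: differentiable_comp.
by split=> //; rewrite !deriveE// diff_comp//= diff_lin.
Qed.

Lemma Ck_linear k (D : set V) (L : {linear W -> W'}) (f : V -> W) : open D ->
  continuous L -> Ck k D f -> Ck k D (L \o f).
Proof.
move=> oD cL; elim: k f => [|k IH] f.
  by move=> cf x Dx; apply: continuous_comp; [exact: cf|exact: cL].
move=> [df dkf]; split=> [x Dx|v].
  exact: (derive_linear 0 cL (df x Dx)).1.
apply: (Ck_ext oD _ (IH _ (dkf v))) => x Dx.
by rewrite (derive_linear v cL (df x Dx)).2.
Qed.

Lemma Ck_comp_linear k (D : set W) (L : {linear V -> W}) (f : W -> W') :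
  open D -> continuous L -> Ck k D f -> Ck k (L @^-1` D) (f \o L).
Proof.
move=> oD cL; have oLD : open (L @^-1` D) by exact: open_comp.
elim: k f => [|k IH] f.
  by move=> cf x Dx; apply: continuous_comp; [exact: cL|exact: cf].
move=> [df dkf]; split=> [x Dx|v].
  exact: (derive_comp_linear 0 cL (df (L x) Dx)).1.
apply: (Ck_ext oLD _ (IH _ (dkf (L v)))) => x Dx.
by rewrite (derive_comp_linear v cL (df (L x) Dx)).2.
Qed.

End CkLinear.

(** * Quantitative bounds on derivatives *)

Section Bounds.
Variables (R : realType) (V : normedModType R).
Implicit Types (D : set V) (f g : V -> R) (a b r s : R).

(* All derivatives of order [j <= k] in directions of norm at most [1] are
   bounded by [a * r ^+ j] on [D]. *)
Fixpoint Ckbound k D f a r : Prop :=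
  match k with
  | 0%N => forall x, D x -> {for x, continuous f} /\ `|f x| <= a
  | k'.+1 => (forall x, D x -> differentiable f x /\ `|f x| <= a) /\
             (forall v, `|v| <= 1 -> Ckbound k' D (fun x => 'D_v f x) (a * r) r)
  end.

Lemma Ckbound_ge k D f a r x : Ckbound k D f a r -> D x -> `|f x| <= a.
Proof. by case: k => [|k] /= => [H /H[]|[H _] /H[]]. Qed.

Lemma Ckbound_continuous k D f a r x : Ckbound k D f a r -> D x ->
  {for x, continuous f}.
Proof.
case: k => [|k] /= => [H /H[]//|[H _] /H[df _]].
exact: differentiable_continuous.
Qed.

Lemma Ckbound_ext k D f g a r : open D -> (forall x, D x -> f x = g x) ->
  Ckbound k D f a r -> Ckbound k D g a r.
Proof.
move=> oD; elim: k f g a => [|k IH] f g a fg /=.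
  move=> cf x Dx; have [cfx fa] := cf x Dx; rewrite -fg//; split=> //.
  rewrite /prop_for /continuous_at -(fg _ Dx).
  by apply: cvg_trans cfx; apply: near_eq_cvg; exact: open_near_eq fg.
move=> [df dkf]; split.
  move=> x Dx; have [dfx fa] := df x Dx; rewrite -fg//; split=> //.
  by apply: near_eq_differentiable dfx; exact: open_near_eq fg.
move=> v v1; apply: IH (dkf v v1) => x Dx; apply: near_eq_derive.
exact: open_near_eq fg.
Qed.

Lemma Ckbound_le k D f a r b s : 0 <= r -> 0 <= b -> a <= b -> r <= s ->
  Ckbound k D f a r -> Ckbound k D f b s.
Proof.
move=> r0; elim: k f a b => [|k IH] f a b b0 ab rs /=.
  by move=> cf x Dx; have [cfx fa] := cf x Dx; split=> //; exact: le_trans ab.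
move=> [df dkf]; split=> [x Dx|v v1].
  by have [dfx fa] := df x Dx; split=> //; exact: le_trans ab.
apply: IH (dkf v v1) => //; first by rewrite mulr_ge0// (le_trans r0).
apply: (@le_trans _ _ (b * r)); first exact: ler_wpM2r.
exact: ler_wpM2l.
Qed.

Lemma Ckbound_sub k D D' f a r : D' `<=` D -> Ckbound k D f a r ->
  Ckbound k D' f a r.
Proof.
move=> DD; elim: k f a => [|k IH] f a /=; first by move=> H x /DD; exact: H.
move=> [df dkf]; split=> [x /DD|v v1]; first exact: df.
by apply: IH; exact: dkf.
Qed.

Lemma Ckbound_union k D D' f a r : Ckbound k D f a r -> Ckbound k D' f a r ->
  Ckbound k (D `|` D') f a r.
Proof.
elim: k f a => [|k IH] f a /=; first by move=> H H' x [/H|/H'].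
move=> [df dkf] [df' dkf']; split=> [x [/df|/df']//|v v1].
by apply: IH; [exact: dkf|exact: dkf'].
Qed.

Lemma CkboundW k D f a r : Ckbound k.+1 D f a r -> Ckbound k D f a r.
Proof.
elim: k f a => [|k IH] f a [df dkf].
  move=> x Dx; have [dfx fa] := df x Dx; split=> //.
  exact: differentiable_continuous.
by split=> // v v1; apply: IH; exact: dkf.
Qed.

Lemma Ckbound_cst k D c a r : 0 <= r -> `|c| <= a ->
  Ckbound k D (fun _ => c) a r.
Proof.
move=> r0; elim: k c a => [|k IH] c a ca /=.
  by move=> x _; split=> //; exact: cst_continuous.
split=> [x _|v _]; first by split=> //; exact: differentiable_cst.
have -> : 'D_v (fun _ : V => c) = (fun _ => 0).
  by apply/funext => x; rewrite -[LHS]/('D_v (cst c) x) derive_cst.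
by apply: IH; rewrite normr0 mulr_ge0// (le_trans _ ca).
Qed.

Lemma Ckbound_add k D f g a b r : open D ->
  Ckbound k D f a r -> Ckbound k D g b r ->
  Ckbound k D (fun x => f x + g x) (a + b) r.
Proof.
move=> oD; elim: k f g a b => [|k IH] f g a b.
  move=> cf cg x Dx; have [cfx fa] := cf x Dx; have [cgx ga] := cg x Dx.
  by split; [exact: continuousD|exact: (le_trans (ler_normD _ _) (lerD fa ga))].
move=> [df dkf] [dg dkg]; split=> [x Dx|v v1].
  have [dfx fa] := df x Dx; have [dgx ga] := dg x Dx; split.
    exact: (differentiableD dfx dgx).
  exact: (le_trans (ler_normD _ _) (lerD fa ga)).
rewrite mulrDl; apply: (Ckbound_ext oD _ (IH _ _ _ _ (dkf v v1) (dkg v v1))).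
move=> x Dx; rewrite -deriveD//; apply: diff_derivable.
  by have [] := df x Dx.
by have [] := dg x Dx.
Qed.

Lemma Ckbound_sum k D (I : Type) (l : seq I) (f : I -> V -> R) (a : I -> R) r :
  open D -> 0 <= r -> (forall i, Ckbound k D (f i) (a i) r) ->
  Ckbound k D (fun x => \sum_(i <- l) f i x) (\sum_(i <- l) a i) r.
Proof.
move=> oD r0 fk; elim: l => [|i l IH].
  rewrite big_nil; apply: (@Ckbound_ext _ _ (fun _ => 0)) => //.
    by move=> x _; rewrite big_nil.
  by apply: Ckbound_cst => //; rewrite normr0.
rewrite big_cons; apply: (Ckbound_ext oD _ (Ckbound_add oD (fk i) IH)).
by move=> x _; rewrite big_cons.
Qed.

(** By Leibniz, [\sum_i 'C(j, i) r^i s^(j-i) = (r + s)^j]: amplitudes multiply and rates add. This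
    stability is the reason for the geometric shape of [Ckbound]. *)
Lemma Ckbound_mul k D f g a b r s : open D -> 0 <= r -> 0 <= s -> 0 <= a ->
  0 <= b -> Ckbound k D f a r -> Ckbound k D g b s ->
  Ckbound k D (fun x => f x * g x) (a * b) (r + s).
Proof.
move=> oD r0 s0; elim: k f g a b => [|k IH] f g a b a0 b0.
  move=> cf cg x Dx; have [cfx fa] := cf x Dx; have [cgx ga] := cg x Dx.
  by split; [exact: continuousM|rewrite normrM ler_pM].
move=> fk gk; have [df dkf] := fk; have [dg dkg] := gk; split=> [x Dx|v v1].
  have [dfx fa] := df x Dx; have [dgx ga] := dg x Dx; split.
    exact: (differentiableM dfx dgx).
  by rewrite normrM ler_pM.
have H1 := IH _ _ _ _ (mulr_ge0 a0 r0) b0 (dkf v v1) (CkboundW gk).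
have H2 := IH _ _ _ _ a0 (mulr_ge0 b0 s0) (CkboundW fk) (dkg v v1).
have -> : a * b * (r + s) = a * r * b + a * (b * s) by ring.
apply: (Ckbound_ext oD _ (Ckbound_add oD H1 H2)) => x Dx.
rewrite -[RHS]/('D_v (f * g) x) deriveM.
- by rewrite addrC; congr (_ + _); rewrite [_ *: _]mulrC.
- by apply: diff_derivable; have [] := df x Dx.
- by apply: diff_derivable; have [] := dg x Dx.
Qed.

End Bounds.

(** * Symmetry of second derivatives *)

Lemma dist_le_halves (R : realFieldType) (a b c e : R) :
  `|a - c| < e / 2 -> `|b - c| < e / 2 -> `|a - b| <= e.
Proof.
by rewrite !ltr_norml ler_norml => /andP[? ?] /andP[? ?]; apply/andP; split; lra.
Qed.

Section Lines.
Variables (R : realType) (V : normedModType R).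
Implicit Types (f : V -> R) (D : set V) (x v w : V) (s : R).

Lemma is_derive_line f x v s : derivable f (x + s *: v) v ->
  is_derive s 1 (fun p : R => f (x + p *: v)) ('D_v f (x + s *: v)).
Proof.
move=> df.
have E : (fun h : R => h^-1 *: (((fun p : R => f (x + p *: v)) \o shift s) (h *: 1)
            - f (x + s *: v))) =
         (fun h : R => h^-1 *: ((f \o shift (x + s *: v)) (h *: v) - f (x + s *: v))).
  apply/funext => h /=; congr (_ *: (f _ - _)).
  by rewrite [h *: 1]mulr1 scalerDl addrCA.
by split; rewrite /derivable /derive E.
Qed.

Lemma MVT_line f x v (s : R) : 0 < s ->
  (forall p : R, 0 <= p <= s -> differentiable f (x + p *: v)) ->
  exists2 c, 0 <= c <= s & f (x + s *: v) - f x = s * 'D_v f (x + c *: v).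
Proof.
move=> s0 df.
have dl p : 0 <= p <= s -> is_derive p 1 (fun p : R => f (x + p *: v))
    ('D_v f (x + p *: v)).
  by move=> /df dfp; apply: is_derive_line; exact: diff_derivable.
have [||c] := @MVT_segment R (fun p : R => f (x + p *: v))
  (fun p => 'D_v f (x + p *: v)) 0 s (ltW s0).
- by move=> p; rewrite in_itv /= => /andP[p0 ps]; apply: dl; rewrite !ltW.
- apply: derivable_within_continuous => p; rewrite in_itv /= => ps.
  by have [] := dl _ ps.
- rewrite in_itv /= scale0r addr0 subr0 => cs ->.
  by exists c => //; rewrite mulrC.
Qed.

Lemma differentiable_shift (W : normedModType R) (f : V -> W) y c :
  differentiable f (y + c) ->
  differentiable (fun y => f (y + c)) y /\
  'd (fun y => f (y + c)) y = 'd f (y + c) :> (V -> W).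
Proof.
move=> df; apply: differentiable_intro; first exact: diff_continuous.
move=> e e0; near=> h; rewrite -(addrA h); near: h.
exact: differentiable_littleo.
Unshelve. all: by end_near. Qed.

(** The mean value theorem is applied to [y |-> f (y + s w) - f y] along [v], then to ['D_v f] along
    [w]. The left-hand side is symmetric in [v] and [w], which is the whole point. *)
Lemma second_difference f x v w s : 0 < s ->
  (forall p q : R, 0 <= p <= s -> 0 <= q <= s ->
     differentiable f (x + p *: v + q *: w) /\
     differentiable ('D_v f) (x + p *: v + q *: w)) ->
  exists p q, [/\ 0 <= p <= s, 0 <= q <= s &
    f (x + s *: v + s *: w) - f (x + s *: v) - (f (x + s *: w) - f x)
      = s * (s * 'D_w ('D_v f) (x + p *: v + q *: w))].
Proof.
move=> s0 df.
have ss : 0 <= s <= s by rewrite lexx ltW.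
have s00 : 0 <= (0 : R) <= s by rewrite lexx ltW.
pose g y := f (y + s *: w) - f y.
have dsh y : differentiable f (y + s *: w) ->
    differentiable (fun y => f (y + s *: w)) y /\
    'D_v (fun y => f (y + s *: w)) y = 'D_v f (y + s *: w).
  move=> dfy.
  have [d e] := @differentiable_shift _ f y (s *: w) dfy.
  by split=> //; rewrite !deriveE// e.
have dg p : 0 <= p <= s -> differentiable g (x + p *: v) /\
    'D_v g (x + p *: v) = 'D_v f (x + p *: v + s *: w) - 'D_v f (x + p *: v).
  move=> ps; have [d1 _] := df p s ps ss.
  have [d2 _] := df p 0 ps s00; rewrite scale0r addr0 in d2.
  have [d3 e3] := dsh _ d1; split; first exact: (differentiableB d3 d2).
  have e := deriveB (@diff_derivable _ _ _ _ _ v d3) (@diff_derivable _ _ _ _ _ v d2).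
  by rewrite -e3 -e.
have [p ps E] := MVT_line s0 (fun p ps => (dg p ps).1).
have [q qs E'] := @MVT_line ('D_v f) (x + p *: v) w s s0
  (fun q qs => (df p q ps qs).2).
exists p, q; split=> //.
by rewrite -E' -(dg p ps).2 -E.
Qed.

(** The symmetric second difference equals [s^2] times either mixed derivative, each at some point
    of a small parallelogram at [x]; continuity of both mixed derivatives at [x] then identifies
    their values there. *)
Lemma derive_comm D f x v w : open D -> D x -> Ck 2 D f ->
  'D_v ('D_w f) x = 'D_w ('D_v f) x.
Proof.
move=> oD Dx [df ddf].
have [dvf cvf] := ddf v; have [dwf cwf] := ddf w.
have c1 : {for x, continuous ('D_v ('D_w f))} := cwf v x Dx.
have c2 : {for x, continuous ('D_w ('D_v f))} := cvf w x Dx.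
apply/eqP; rewrite -subr_eq0 -normr_le0; apply/ler_addgt0Pl => e e0.
rewrite addr0.
have e20 : 0 < e / 2 by rewrite divr_gt0.
move/cvgrPdist_lt : c1 => /(_ _ e20) c1.
move/cvgrPdist_lt : c2 => /(_ _ e20) c2.
have nD : \forall y \near x, D y by exact: open_nbhs_nbhs.
have [r /= r0 Hr] := (nbhs_ballP _ _).1 (filterI nD (filterI c1 c2)).
(* Small enough for the parallelogram of sides [s v] and [s w] to stay in the ball; the [1] covers
   [v = w = 0]. *)
pose s := r / (`|v| + `|w| + 1).
have vw0 : 0 < `|v| + `|w| + 1 by rewrite ltr_wpDl// addr_ge0.
have s0 : 0 < s by rewrite divr_gt0.
have Hs p q : 0 <= p <= s -> 0 <= q <= s -> ball x r (x + p *: v + q *: w).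
  move=> /andP[p0 ps] /andP[q0 qs]; rewrite -ball_normE /ball_ /=.
  rewrite -addrA opprD addNKr normrN.
  apply: (le_lt_trans (ler_normD _ _)); rewrite !normrZ !ger0_norm//.
  apply: (@le_lt_trans _ _ (s * (`|v| + `|w|))).
    by rewrite mulrDr lerD// ler_wpM2r.
  by rewrite /s mulrAC ltr_pdivrMr// ltr_pM2l// ltrDl.
have [p [q [ps qs E]]] := @second_difference f x v w s s0
  (fun p q ps qs => let: conj Dy _ := Hr _ (Hs p q ps qs) in
    conj (df _ Dy) (dvf _ Dy)).
have Hs' p' q' : 0 <= p' <= s -> 0 <= q' <= s -> ball x r (x + p' *: w + q' *: v).
  by move=> ? ?; rewrite addrAC; exact: Hs.
have [p' [q' [ps' qs' E']]] := @second_difference f x w v s s0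
  (fun p q ps qs => let: conj Dy _ := Hr _ (Hs' p q ps qs) in
    conj (df _ Dy) (dwf _ Dy)).
have {E E'} EE : 'D_w ('D_v f) (x + p *: v + q *: w) =
     'D_v ('D_w f) (x + p' *: w + q' *: v).
  have EE : f (x + s *: v + s *: w) - f (x + s *: v) - (f (x + s *: w) - f x) =
      f (x + s *: w + s *: v) - f (x + s *: w) - (f (x + s *: v) - f x).
    by rewrite [x + s *: w + _]addrAC !opprB -!addrA; congr (_ + _); rewrite addrCA
      [RHS]addrCA; congr (_ + _); rewrite addrC.
  have := etrans (esym E) (etrans EE E').
  by move/(mulfI (lt0r_neq0 s0))/(mulfI (lt0r_neq0 s0)).
have [_ [_ H1]] := Hr _ (Hs _ _ ps qs).
have [_ [H2 _]] := Hr _ (Hs' _ _ ps' qs').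
rewrite -EE in H2.
exact: (dist_le_halves H2 H1).
Qed.

End Lines.

(** * Term-by-term differentiation of series *)

Section DominatedSeries.
Variable R : realType.
Implicit Types u b : nat -> R.

Lemma dominated_series_cvg u b : (forall n, `|u n| <= b n) ->
  cvgn (series b) -> cvgn (series u).
Proof.
move=> ub cb; apply: normed_cvg.
apply: (series_le_cvg _ _ _ cb) => n; rewrite /=; [by []| |exact: ub].
exact: le_trans (normr_ge0 _) (ub n).
Qed.

Lemma dominated_series_tail u b N : (forall n, `|u n| <= b n) ->
  cvgn (series b) ->
  `|limn (series u) - series u N| <= limn (series b) - series b N.
Proof.
move=> ub cb; have cu := dominated_series_cvg ub cb.
rewrite -subr_le0.
have cN : (fun n => `|series u n - series u N| - (series b n - series b N)) @ \oo
    --> `|limn (series u) - series u N| - (limn (series b) - series b N).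
  apply: cvgB; first by apply: cvg_norm; apply: cvgB => //; exact: cvg_cst.
  by apply: cvgB => //; exact: cvg_cst.
apply: (cvgr_to_le cN); near=> n.
have Nn : (N <= n)%N by near: n; exists N.
rewrite subr_le0 !sub_series_geq//.
apply: (le_trans (ler_norm_sum _ _ _)); exact: ler_sum.
Unshelve. all: by end_near. Qed.

Lemma series_tail_small b (e : R) : cvgn (series b) -> 0 < e ->
  exists N, limn (series b) - series b N < e.
Proof.
move=> cb e0; have [N _ H] := (@cvgrPdist_lt _ _ _ _ _ _ _).1 cb e e0.
by exists N; apply: le_lt_trans (ler_norm _) (H N (leqnn N)).
Qed.

End DominatedSeries.

Section SeriesOfFunctions.
Variables (R : realType) (V : normedModType R) (D : set V).
Implicit Types (u : nat -> V -> R) (b : nat -> R).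

(** [limn] is a default value where the series diverges, so the lemmas on [fsum] carry a convergent
    dominating series. *)
Definition fsum u : V -> R := fun z => limn (series (u ^~ z)).

Lemma fsum_continuous u b x : open D -> D x ->
  (forall n y, D y -> `|u n y| <= b n) -> cvgn (series b) ->
  (forall n, {for x, continuous (u n)}) -> {for x, continuous (fsum u)}.
Proof.
move=> oD Dx ub cb cu; apply/cvgrPdist_le => e e0.
have e4 : 0 < e / 4 by rewrite divr_gt0.
have [N HN] := series_tail_small cb e4.
have cN : {for x, continuous (fun y => series (u ^~ y) N)}.
  rewrite /series /=; elim: N {HN} => [|N IH].
    rewrite (_ : (fun _ => _) = cst 0); first exact: cst_continuous.
    by apply/funext => y; rewrite big_geq.
  rewrite (_ : (fun _ => _) = (fun y => \sum_(0 <= k < N) u k y + u N y)).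
    by apply: continuousD.
  by apply/funext => y; rewrite big_nat_recr.
move/cvgrPdist_le : cN => /(_ _ e4) cN.
have nD : \forall y \near x, D y by exact: open_nbhs_nbhs.
near=> y.
have Dy : D y by near: y.
have Hy : `|series (u ^~ x) N - series (u ^~ y) N| <= e / 4 by near: y.
have Tx := dominated_series_tail N (fun n => ub n x Dx) cb.
have Ty := dominated_series_tail N (fun n => ub n y Dy) cb.
move: Tx Ty Hy HN; rewrite -/(fsum u x) -/(fsum u y).
move: (fsum u x) (fsum u y) (series (u ^~ x) N) (series (u ^~ y) N)
  (limn (series b) - series b N) => p q r s t.
rewrite !ler_norml => /andP[? ?] /andP[? ?] /andP[? ?] ?; apply/andP; split; lra.
Unshelve. all: by end_near. Qed.

Lemma derive_le_norm (f : V -> R) (c : R) x v : differentiable f x ->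
  (forall v, `|v| <= 1 -> `|'D_v f x| <= c) -> `|'D_v f x| <= c * `|v|.
Proof.
move=> df H; have [->|v0] := eqVneq v 0.
  by rewrite derive0 !normr0 mulr0.
have nv0 : 0 < `|v| by rewrite normr_gt0.
have := H (`|v|^-1 *: v); rewrite normrZ normfV normr_id mulVf ?gt_eqF//.
rewrite derive_scale_dir// => /(_ (lexx _)).
by rewrite normrZ normfV normr_id ler_pdivrMl// mulrC.
Qed.

Lemma lipschitz_of_derive (f : V -> R) (c : R) x h :
  (forall p : R, 0 <= p <= 1 -> differentiable f (x + p *: h)) ->
  (forall (p : R) v, 0 <= p <= 1 -> `|v| <= 1 -> `|'D_v f (x + p *: h)| <= c) ->
  `|f (x + h) - f x| <= c * `|h|.
Proof.
move=> df dc; have [p p01] := @MVT_line R V f x h 1 ltr01 df.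
rewrite scale1r mul1r => ->; apply: derive_le_norm; first exact: df.
by move=> v v1; apply: dc.
Qed.

(** The candidate differential is the sum of the differentials. In the remainder at [h], finitely
    many terms are each [o(h)], and the tail is at most [2 |h|] times a tail of [b], uniformly in
    [h]. *)
Lemma fsum_differentiable u b x : open D -> D x ->
  (forall n y, D y -> `|u n y| <= b n) ->
  (forall n y, D y -> differentiable (u n) y) ->
  (forall n y v, D y -> `|v| <= 1 -> `|'D_v (u n) y| <= b n) ->
  cvgn (series b) ->
  differentiable (fsum u) x /\
  forall v, 'D_v (fsum u) x = fsum (fun n => 'D_v (u n)) x.
Proof.
move=> oD Dx ub du dub cb.
have dubv n v : `|'D_v (u n) x| <= b n * `|v|.
  by apply: derive_le_norm; [exact: du|move=> w; exact: dub].
have bcE c : (fun n => b n * c) = c *: b by apply/funext => n; exact: mulrC.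
have cbv c : cvgn (series (fun n => b n * c)).
  by rewrite bcE; exact: is_cvg_seriesZ.
have sbv c : limn (series (fun n => b n * c)) = limn (series b) * c.
  by rewrite bcE lim_seriesZ// mulrC.
have cdu v : cvgn (series (fun n => 'D_v (u n) x)).
  exact: dominated_series_cvg (fun n => dubv n v) (cbv _).
pose L v := fsum (fun n => 'D_v (u n)) x.
have linL : linear L.
  move=> c v w; rewrite /L /fsum.
  have -> : (fun n => 'D_(c *: v + w) (u n) x) =
      c *: (fun n => 'D_v (u n) x) + (fun n => 'D_w (u n) x).
    apply/funext => n; rewrite derive_add_dir; last exact: du.
    by rewrite derive_scale_dir//; exact: du.
  rewrite lim_seriesD//; last exact: is_cvg_seriesZ.
  by rewrite lim_seriesZ.
pose dL : {linear V -> R} := HB.pack L (GRing.isLinear.Build _ _ _ _ L linL).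
have Lb v : `|L v| <= limn (series b) * `|v|.
  have := dominated_series_tail 0 (fun n => dubv n v) (cbv `|v|).
  have s0 (g : nat -> R) : series g 0%N = 0 by rewrite /series /= big_geq.
  by rewrite !s0 !subr0 sbv.
have cL : continuous dL.
  apply: bounded_linear_continuous; apply/linear_boundedP.
  exists (limn (series b)); split; first exact: num_real.
  by move=> r /ltW br v; apply: (le_trans (Lb v)); exact: ler_wpM2r.
have [] := @differentiable_intro _ _ _ (fsum u) x dL cL.
  move=> e e0; have e4 : 0 < e / 4 by rewrite divr_gt0.
  have [N HN] := series_tail_small cb e4.
  pose w h n := u n (h + x) - u n x - 'D_h (u n) x.
  have fin : forall d : R, 0 < d -> \forall h \near (0 : V),
      `|series (w h) N| <= d * `|h|.
    elim: (N) => [|k IH] d d0.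
      near=> h; rewrite /series /= big_geq// normr0.
      by rewrite mulr_ge0// ltW.
    have d2 : 0 < d / 2 by rewrite divr_gt0.
    have dk := @differentiable_littleo _ _ _ (u k) x (du k x Dx) _ d2.
    near=> h; rewrite seriesSr [d]splitr mulrDl.
    apply: (le_trans (ler_normD _ _)); apply: lerD.
      by near: h; exact: IH.
    by rewrite /w deriveE//; [near: h|exact: du].
  (* The mean value inequality needs the whole segment from [x] to [x + h] inside [D]. *)
  have Dnear : \forall h \near (0 : V), forall p : R, 0 <= p <= 1 ->
      D (x + p *: h).
    have /nbhs_ballP[r /= r0 Hr] : nbhs x D by exact: open_nbhs_nbhs.
    near=> h => p /andP[p0 p1]; apply: Hr; rewrite -ball_normE /ball_ /=.
    rewrite opprD addNKr normrN normrZ ger0_norm//.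
    apply: (@le_lt_trans _ _ `|h|); first by rewrite ler_piMl.
    by near: h; apply: nbhs0_lt.
  have e2 : 0 < e / 2 by rewrite divr_gt0.
  have finN := fin _ e2.
  near=> h.
  have Dh : forall p : R, 0 <= p <= 1 -> D (x + p *: h) by near: h.
  have D1 : D (h + x) by rewrite addrC -[h]scale1r; apply: Dh; rewrite ler01 lexx.
  (* One [|h|] comes from the increment of [u n], the other from its derivative at [x]. *)
  have wb n : `|w h n| <= b n * (2 * `|h|).
    rewrite mulr_natl mulrnAr mulr2n.
    apply: (le_trans (ler_normB _ _)); apply: lerD; last exact: dubv.
    rewrite [h + x]addrC; apply: lipschitz_of_derive.
      by move=> p p01; apply: du; exact: Dh.
    by move=> p v p01 v1; apply: dub => //; exact: Dh.
  have := dominated_series_tail N wb (cbv _).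
  have cu y : D y -> cvgn (series (u ^~ y)).
    by move=> Dy; exact: dominated_series_cvg (fun n => ub n y Dy) cb.
  have -> : limn (series (w h)) = fsum u (h + x) - fsum u x - dL h.
    have -> : w h = (u ^~ (h + x)) - (u ^~ x) - (fun n => 'D_h (u n) x) by [].
    rewrite lim_seriesB//; first by rewrite lim_seriesB//; exact: cu.
    by apply: is_cvg_seriesB; exact: cu.
  have -> : series (fun n => b n * (2 * `|h|)) N = series b N * (2 * `|h|).
    by rewrite /series /= big_distrl.
  rewrite sbv -mulrBl => T.
  have : `|series (w h) N| <= e / 2 * `|h| by near: h.
  have h0 := normr_ge0 h.
  have : (limn (series b) - series b N) * (2 * `|h|) <= e / 2 * `|h|.
    rewrite mulrA; apply: ler_wpM2r => //; move: HN; lra.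
  move: T; move: (series (w h) N) (fsum u (h + x) - fsum u x - dL h) => p q.
  move: (_ * (2 * _)) => c.
  rewrite !ler_norml => /andP[? ?] ? /andP[? ?]; apply/andP; split; lra.
by move=> d E; split=> // v; rewrite deriveE// E.
Unshelve. all: by end_near. Qed.

Implicit Types (a r : nat -> R).

Lemma fsum_derive k u a r x : open D -> D x -> (forall n, 1 <= r n) ->
  (forall n, 0 <= a n) -> (forall n, Ckbound k.+1 D (u n) (a n) (r n)) ->
  cvgn (series (fun n => a n * r n)) ->
  differentiable (fsum u) x /\
  forall v, 'D_v (fsum u) x = fsum (fun n => 'D_v (u n)) x.
Proof.
move=> oD Dx r1 a0 uk car.
apply: (fsum_differentiable oD Dx _ _ _ car) => n y; last first.
- by move=> v Dy v1; exact: (Ckbound_ge ((uk n).2 v v1)).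
- by move=> Dy; have [] := (uk n).1 y Dy.
- move=> Dy; apply: (le_trans (Ckbound_ge (uk n) Dy)).
  by rewrite ler_peMr.
Qed.

(** Differentiating once turns [a n] into [a n * r n] and lowers [k] by one, leaving the dominating
    series unchanged. Because [1 <= r n], that series also dominates all lower orders. *)
Lemma fsum_Ck k u a r : open D -> (forall n, 1 <= r n) -> (forall n, 0 <= a n) ->
  (forall n, Ckbound k D (u n) (a n) (r n)) ->
  cvgn (series (fun n => a n * r n ^+ k)) -> Ck k D (fsum u).
Proof.
move=> oD r1; elim: k u a => [|k IH] u a a0 uk.
  rewrite (_ : (fun n => _) = a); last by apply/funext => n; rewrite mulr1.
  move=> ca x Dx; apply: (fsum_continuous oD Dx _ ca) => n.
    by move=> y Dy; exact: (Ckbound_ge (uk n)).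
  exact: (Ckbound_continuous (uk n)).
move=> cak.
have r0 n : 0 <= r n by exact: le_trans (r1 n).
have car : cvgn (series (fun n => a n * r n)).
  apply: (series_le_cvg _ _ _ cak) => n; rewrite /= ?mulr_ge0 ?exprn_ge0//.
  apply: ler_wpM2l => //; exact: ler_eXnr.
have dF x Dx := @fsum_derive k u a r x oD Dx r1 a0 uk car.
have IHv v : `|v| <= 1 -> Ck k D (fsum (fun n => 'D_v (u n))).
  move=> v1; apply: (IH _ (fun n => a n * r n)) => [n|n|].
  - by rewrite mulr_ge0.
  - exact: (uk n).2.
  - rewrite (_ : (fun n => _) = (fun n => a n * r n ^+ k.+1))//.
    by apply/funext => n; rewrite exprS mulrA.
split=> [x Dx|v]; first exact: (dF x Dx).1.
(* [Ckbound] only controls directions of norm at most 1; the others are rescaled, which excludes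
   [v = 0]. *)
have [->|v0] := eqVneq v 0.
  rewrite (_ : 'D_0 _ = fun _ => 0); first exact: Ck_cst.
  by apply/funext => x; rewrite derive0.
have nv0 : `|v| != 0 by rewrite normr_eq0.
have nv1 : `| `|v|^-1 *: v | <= 1 by rewrite normrZ normfV normr_id mulVf.
apply: (Ck_ext oD _ (Ck_scale `|v| oD (IHv _ nv1))) => x Dx.
have [dFx e] := dF x Dx.
rewrite -e derive_scale_dir//.
by rewrite [_ *: _]/(_ * _) mulrA mulfV// mul1r.
Qed.

End SeriesOfFunctions.

(** * Bounds for compositions, and bounds from compactness *)

Section BoundsComposition.
Variables (R : realType) (V : normedModType R).

Lemma derive_comp_real (chi : R -> R) (g : V -> R) x v :
  differentiable chi (g x) -> differentiable g x ->
  differentiable (chi \o g) x /\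
  'D_v (chi \o g) x = 'D_1 chi (g x) * 'D_v g x.
Proof.
move=> dc dg; have d : differentiable (chi \o g) x by exact: differentiable_comp.
split=> //; rewrite !deriveE// diff_comp//= -[X in 'd chi _ X = _]mulr1.
by rewrite [LHS]linearZ mulrC.
Qed.

(** The derivative is [('D_1 chi \o g) * 'D_v g]: the induction hypothesis gives rate [k (s + r b)]
    for the first factor, to which the second adds [s], while the amplitude gains [r b]. The rate is
    linear in [s] and [b]; when both are of size [1 / radius], so is the result. *)
Lemma Ckbound_comp k (D : set V) (E : set R) (chi : R -> R) (g : V -> R)
    (K r b s : R) : open D -> 0 <= K -> 0 <= r -> 0 <= b -> 0 <= s ->
  (forall x, D x -> E (g x)) -> (forall x, D x -> differentiable g x) ->
  (forall v, `|v| <= 1 -> Ckbound k D (fun x => 'D_v g x) b s) ->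
  Ckbound k E chi K r -> Ckbound k D (chi \o g) K (k%:R * (s + r * b)).
Proof.
move=> oD + r0 b0 s0 DE dg; elim: k chi K => [|k IH] chi K K0 dvg.
  move=> ck x Dx; have [cx Kx] := ck _ (DE x Dx); split=> //.
  by apply: continuous_comp cx; apply: differentiable_continuous; exact: dg.
move=> [dchi dkchi]; split=> [x Dx|v v1].
  have [dcx Kx] := dchi _ (DE x Dx); split=> //.
  by apply: (derive_comp_real 0 dcx _).1; exact: dg.
have n1 : `|1 : R| <= 1 by rewrite normr1.
have rb0 : 0 <= r * b by rewrite mulr_ge0.
have H := IH _ _ (mulr_ge0 K0 r0) (fun v v1 => CkboundW (dvg v v1)) (dkchi 1 n1).
have kk0 : 0 <= k%:R * (s + r * b) by rewrite mulr_ge0// addr_ge0.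
have M := Ckbound_mul oD kk0 s0 (mulr_ge0 K0 r0) b0 H (CkboundW (dvg v v1)).
apply: (@Ckbound_ext _ _ _ _ (fun x => ('D_1 chi \o g) x * 'D_v g x)) => //.
  move=> x Dx; have [dcx Kx] := dchi _ (DE x Dx).
  by rewrite (derive_comp_real v dcx (dg x Dx)).2.
apply: (Ckbound_le _ _ _ _ M).
- by rewrite addr_ge0.
- by rewrite !mulr_ge0// addr_ge0.
- rewrite -mulrA; apply: ler_wpM2l => //.
  apply: (@le_trans _ _ (1 * (s + r * b))); first by rewrite mul1r lerDr.
  by apply: ler_wpM2r; [rewrite addr_ge0|rewrite ler1n].
- by rewrite -[in leRHS]natr1 mulrDl mul1r lerD2l lerDl.
Qed.

(** Compactness bounds each of the finitely many derivatives along a frame [e]; bounded coordinates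
    [c] extend this to all directions of norm at most 1, and a large rate puts the bounds into
    geometric form. *)
Lemma Ck_Ckbound (I : finType) (e : I -> V) (c : I -> V -> R) k
    (K O D : set V) (f : V -> R) :
  (forall v, v = \sum_i c i v *: e i) -> (forall i v, `|c i v| <= `|v|) ->
  compact K -> K `<=` O -> open O -> open D -> D `<=` K -> Ck k O f ->
  exists a r, [/\ 0 <= a, 0 <= r & Ckbound k D f a r].
Proof.
move=> ce c1 cK KO oO oD DK.
have bd (g : V -> R) : (forall x, O x -> {for x, continuous g}) ->
    exists2 a : R, 0 <= a & forall x, K x -> `|g x| <= a.
  move=> cg.
  have cgK : {within K, continuous g}.
    by apply: continuous_in_subspaceT => x /set_mem Kx; apply: cg; exact: KO.
  have [M [_ HM]] := compact_bounded (continuous_compact cgK cK).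
  exists (Num.max 0 (M + 1)); first by rewrite le_max lexx.
  move=> x Kx; rewrite le_max; apply/orP; right.
  by apply: HM; [rewrite ltrDl|exists x].
elim: k f => [|k IH] f fk.
  have [a a0 Ha] := bd f fk; exists a, 0; split=> // x Dx.
  by split; [apply: fk; apply: KO; exact: DK|apply: Ha; exact: DK].
have [df dkf] := fk.
have [a0 a00 Ha0] := bd f (fun x Ox => differentiable_continuous (df x Ox)).
have /choice[ar Har] i : exists p : R * R,
    [/\ 0 <= p.1, 0 <= p.2 & Ckbound k D ('D_(e i) f) p.1 p.2].
  by have [a [r H]] := IH _ (dkf (e i)); exists (a, r).
pose r0 := \sum_i (ar i).2; pose s0 := \sum_i (ar i).1.
have r00 : 0 <= r0 by apply: sumr_ge0 => i _; have [] := Har i.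
have s00 : 0 <= s0 by apply: sumr_ge0 => i _; have [] := Har i.
(* An amplitude of at least 1 ensures that amplitude times rate exceeds [s0], the bound on first
   derivatives. *)
exists (Num.max 1 a0), (r0 + s0).
have m0 : 0 <= Num.max 1 a0 by rewrite le_max ler01.
split=> //; first by rewrite addr_ge0.
split=> [x Dx|v v1].
  split; first by apply: df; apply: KO; exact: DK.
  by rewrite le_max (Ha0 x (DK x Dx)) orbT.
apply: (@Ckbound_ext _ _ _ _ (fun x => \sum_i c i v * 'D_(e i) f x)) => //.
  move=> x Dx; have dfx : differentiable f x by apply: df; apply: KO; exact: DK.
  rewrite [v in RHS]ce derive_sum_dir//; apply: eq_bigr => i _.
  by rewrite derive_scale_dir.
apply: (@Ckbound_le _ _ _ _ _ s0 r0) => //.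
- by rewrite mulr_ge0// addr_ge0.
- apply: (@le_trans _ _ (1 * (r0 + s0))); first by rewrite mul1r lerDr.
  by apply: ler_wpM2r; rewrite ?addr_ge0// le_max lexx.
- by rewrite lerDl.
apply: Ckbound_sum => // i; have [ai0 ri0 Hi] := Har i.
have ci1 : `|c i v| <= 1 by exact: le_trans (c1 i v) v1.
have := Ckbound_mul oD (lexx 0) ri0 ler01 ai0 (Ckbound_cst k D (lexx 0) ci1) Hi.
rewrite mul1r add0r; apply: Ckbound_le => //.
by rewrite /r0 (bigD1 i)//= lerDl sumr_ge0// => j _; have [] := Har j.
Qed.

End BoundsComposition.

(** * A smooth cutoff function *)

Section Cutoff.
Variable R : realType.
Implicit Types (p : {poly R}) (x u : R).

Lemma Ck_comp (V : normedModType R) k (D : set V) (E : set R) (chi : R -> R)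
    (g : V -> R) : open D -> (forall x : V, D x -> E (g x)) ->
  Ck k E chi -> Ck k D g -> Ck k D (chi \o g).
Proof.
move=> oD DE; elim: k chi => [|k IH] chi.
  move=> cc cg x Dx; apply: continuous_comp; first exact: cg.
  exact: cc (DE x Dx).
move=> [dc dkc] gk; have [dg dkg] := gk; split=> [x Dx|v].
  apply: (derive_comp_real 0 (dc _ (DE x Dx)) (dg x Dx)).1.
apply: (Ck_ext oD _ (Ck_mul oD (IH _ (dkc 1) (CkW gk)) (dkg v))) => x Dx.
by rewrite (derive_comp_real v (dc _ (DE x Dx)) (dg x Dx)).2.
Qed.

Lemma Ck_id (V : normedModType R) k (E : set V) : Ck k E (fun x : V => x).
Proof.
case: k => [|k]; first by move=> x _; exact: cvg_id.
split=> [x _|v]; first exact: ex_diff.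
have -> : 'D_v (fun x : V => x) = (fun _ => v).
  by apply/funext => x; exact: derive_id.
exact: Ck_cst.
Qed.

(* This family is stable under differentiation. *)
Definition flat p x : R := if 0 < x then p.[x^-1] * expR (- x^-1) else 0.

Lemma expn_le_expR n u : 0 <= u -> u ^+ n <= n`!%:R * expR u.
Proof.
move=> u0; have f0 : 0 < (n`!%:R : R) by rewrite ltr0n fact_gt0.
rewrite mulrC -ler_pdivrMr//; case: n f0 => [|n] f0.
  by rewrite expr0 fact0 divr1 -expR0 ler_expR.
by apply: le_trans (expR_ge1Dxn n u0); rewrite lerDr.
Qed.

Lemma horner_le_expR p : exists2 C : R, 0 <= C &
  forall u, 0 <= u -> `|p.[u]| <= C * expR u.
Proof.
exists (\sum_(i < size p) `|p`_i| * i`!%:R).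
  by apply: sumr_ge0 => i _; rewrite mulr_ge0.
move=> u u0; rewrite horner_coef mulr_suml.
apply: (le_trans (ler_norm_sum _ _ _)); apply: ler_sum => i _.
rewrite normrM [`|u ^+ i|]ger0_norm ?exprn_ge0// -mulrA.
by apply: ler_wpM2l => //; exact: expn_le_expR.
Qed.

(** The exponential absorbs the polynomial ['X^2 * p] at [x^-1]. Quadratic vanishing is what makes
    [flat p] differentiable at [0], with zero derivative. *)
Lemma flat_le_sqr p : exists2 C : R, 0 <= C & forall x, `|flat p x| <= C * x ^+ 2.
Proof.
have [C C0 HC] := horner_le_expR ('X^2 * p).
exists C => // x; rewrite /flat; case: ltP => x0; last first.
  by rewrite normr0 mulr_ge0// sqr_ge0.
have xi : 0 < x^-1 by rewrite invr_gt0.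
have := HC _ (ltW xi).
rewrite hornerM hornerXn normrM ger0_norm; last by rewrite exprn_ge0// ltW.
move=> H; rewrite normrM [X in _ * X]ger0_norm ?expR_ge0//.
rewrite expRN ler_pdivrMr ?expR_gt0//; move: H.
rewrite exprVn ler_pdivrMl ?exprn_gt0//; by rewrite mulrCA mulrA.
Qed.

(** For [x > 0] this is the product rule, since [p.[x^-1]] and [expR (- x^-1)] have derivatives
    [- x^-2 p'(x^-1)] and [x^-2 expR (- x^-1)]. The derivative is again of the form [flat], so
    smoothness follows by induction. *)
Lemma flat_derive p x : differentiable (flat p) x /\
  'D_1 (flat p) x = flat ('X^2 * (p - p^`())) x.
Proof.
have [x0|x0|->] := ltgtP x 0.
- have nx : \forall y \near x, (cst 0 : R -> R) y = flat p y.
    near=> y; rewrite /flat ltNge ltW//; near: y; exact: lt_nbhsl.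
  split; first exact: (near_eq_differentiable nx).
  by rewrite -(near_eq_derive _ nx) derive_cst /flat ltNge ltW.
- pose h := fun y : R => p.[y^-1] * expR (- y^-1).
  have nx : \forall y \near x, h y = flat p y.
    near=> y; rewrite /flat ifT//; near: y; exact: lt_nbhsr.
  have xn0 : x != 0 by rewrite gt_eqF.
  have dV : is_derive x 1 (fun y : R => y^-1) (- x ^- 2).
    apply: is_derive_eq (is_deriveV xn0 (is_derive_id x 1)) _.
    by rewrite [_ *: _]mulr1.
  have dp : is_derive x 1 (fun y : R => p.[y^-1]) (- x ^- 2 * p^`().[x^-1]).
    apply: is_derive_eq
      (@is_derive1_comp _ (horner p) _ x _ _ (is_derive_poly p x^-1) dV) _.
    by rewrite mulrC.
  have de : is_derive x 1 (fun y : R => expR (- y^-1)) (x ^- 2 * expR (- x^-1)).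
    apply: is_derive_eq
      (@is_derive1_comp _ expR _ x _ _ (is_derive_expR _) (is_deriveN dV)) _.
    by rewrite opprK mulrC.
  have dh : is_derive x 1 h (('X^2 * (p - p^`())).[x^-1] * expR (- x^-1)).
    apply: is_derive_eq (is_deriveM dp de) _.
    rewrite hornerM hornerXn hornerD hornerN exprVn.
    rewrite /GRing.scale /=.
    move: (x ^- 2) (expR _) (p.[_]) (p^`().[_]) => a b c d; ring.
  have [dd de'] := near_eq_is_derive nx dh.
  split; first exact/derivable1_diffP.
  by rewrite de' /flat x0.
- have [C C0 HC] := flat_le_sqr p.
  have f0 : flat p 0 = 0 by rewrite /flat ltxx.
  have C1 : 0 < C + 1 by rewrite ltr_wpDl.
  have hs (e : R) : 0 < e -> \forall h \near (0 : R), `|h| <= e.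
    by move=> e0; apply: nbhs0_le.
  have [|d e] := @differentiable_intro R R R (flat p) 0 \0 (@cst_continuous _ _ 0).
    move=> e e0; near=> h; rewrite addr0 f0 /= !subr0.
    apply: (le_trans (HC h)).
    rewrite -[h ^+ 2]ger0_norm ?sqr_ge0// normrX expr2 mulrA ler_wpM2r//.
    apply: (@le_trans _ _ ((C + 1) * `|h|)); first by rewrite ler_wpM2r// lerDl.
    by rewrite mulrC -ler_pdivlMr//; near: h; apply: hs; rewrite divr_gt0.
  by split=> //; rewrite deriveE// e /flat ltxx.
Unshelve. all: by end_near. Qed.

Lemma flat_Ck k (E : set R) p : Ck k E (flat p).
Proof.
have : forall p, Ck k setT (flat p); last first.
  by move=> /(_ p); apply: Ck_sub => x.
elim: k {p} => [|k IH] p.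
  by move=> x _; apply: differentiable_continuous; exact: (flat_derive p x).1.
split=> [x _|v]; first exact: (flat_derive p x).1.
apply: (Ck_ext openT _ (Ck_scale v openT (IH ('X^2 * (p - p^`()))))) => x _.
have [d <-] := flat_derive p x.
have := @derive_scale_dir R R R _ x v 1 d.
by rewrite /GRing.scale /= mulr1.
Qed.

(** The argument will be [|t|^2 / r^2]: the thresholds [1/4] and [1] then correspond to
    [|t| = r / 2] and [|t| = r]. The two bumps of the denominator never vanish together. *)
Definition cutoff x : R :=
  flat 1 (1 - x) / (flat 1 (1 - x) + flat 1 (x - 4^-1)).

Lemma flat1_ge0 x : 0 <= flat 1 x.
Proof. by rewrite /flat; case: ltP => // _; rewrite hornerC mul1r expR_ge0. Qed.

Lemma flat1_gt0 x : 0 < x -> 0 < flat 1 x.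
Proof. by rewrite /flat => ->; rewrite hornerC mul1r expR_gt0. Qed.

Lemma flat1_le0 x : x <= 0 -> flat 1 x = 0.
Proof. by rewrite /flat leNgt => /negbTE ->. Qed.

Lemma cutoff_denom_gt0 x : 0 < flat 1 (1 - x) + flat 1 (x - 4^-1).
Proof.
have [x1|x1] := ltP x 1.
  by rewrite ltr_wpDr ?flat1_ge0// flat1_gt0// subr_gt0.
rewrite ltr_wpDl ?flat1_ge0// flat1_gt0//; lra.
Qed.

Lemma cutoff_Ck k (E : set R) : Ck k E cutoff.
Proof.
suff : Ck k setT cutoff by apply: Ck_sub => x.
have c1 : Ck k setT (fun x : R => 1 - x).
  by apply: Ck_add openT (Ck_cst _ _ _) (Ck_opp openT (Ck_id _ _)).
have c2 : Ck k setT (fun x : R => x - 4^-1).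
  exact: Ck_add openT (Ck_id _ _) (Ck_cst _ _ _).
have f1 := Ck_comp openT (fun x _ => I) (flat_Ck k setT 1) c1.
have f2 := Ck_comp openT (fun x _ => I) (flat_Ck k setT 1) c2.
apply: Ck_mul openT f1 (Ck_inv openT _ (Ck_add openT f1 f2)) => x _.
by rewrite gt_eqF// cutoff_denom_gt0.
Qed.

Lemma cutoff_eq1 x : x <= 4^-1 -> cutoff x = 1.
Proof.
move=> x4; have d := cutoff_denom_gt0 x; move: d.
rewrite /cutoff [flat 1 (x - _)]flat1_le0 ?subr_le0// addr0 => d.
by rewrite divff// gt_eqF.
Qed.

Lemma cutoff_eq0 x : 1 <= x -> cutoff x = 0.
Proof. by move=> x1; rewrite /cutoff flat1_le0 ?subr_le0// mul0r. Qed.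

Lemma cutoff_ge0 x : 0 <= cutoff x.
Proof. by rewrite divr_ge0 ?flat1_ge0// ltW// cutoff_denom_gt0. Qed.

Lemma cutoff_le1 x : cutoff x <= 1.
Proof.
by rewrite ler_pdivrMr ?cutoff_denom_gt0// mul1r lerDl flat1_ge0.
Qed.

(** The interval is open and contains [[0, 4)], the range of [|t|^2 / r^2] where [|t| < 2 r]. *)
Lemma cutoff_Ckbound k : exists K r : R,
  [/\ 0 <= K, 0 <= r & @Ckbound R R k [set x | -1 < x < 5] cutoff K r].
Proof.
apply: (@Ck_Ckbound R R unit (fun _ => 1) (fun _ v => v) k
  [set x | -1 <= x <= 5] setT).
- by move=> v; rewrite big_const card_unit /= addr0 [RHS]mulr1.
- by [].
- by have := @segment_compact R (-1) 5; rewrite set_itvcc.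
- by [].
- exact: openT.
- by have := @itv_open _ R (-1) 5; rewrite set_itvoo.
- by move=> x /=  => /andP[? ?]; rewrite !ltW.
- exact: cutoff_Ck.
Qed.

End Cutoff.

(** * Complex-valued functions *)

Section ComplexCalculus.
Variables (R : realType) (V : normedModType R).
Implicit Types (D : set V) (f g : V -> R[i]) (x v : V).

Definition cdiff f x : Prop :=
  differentiable (re_part f) x /\ differentiable (im_part f) x.

Lemma ReM (a b : R[i]) :
  complex.Re (a * b) = complex.Re a * complex.Re b - complex.Im a * complex.Im b.
Proof. by case: a => ? ?; case: b. Qed.

Lemma ImM (a b : R[i]) :
  complex.Im (a * b) = complex.Re a * complex.Im b + complex.Im a * complex.Re b.
Proof. by case: a => ? ?; case: b. Qed.

Lemma re_partM f g : re_part (fun x => f x * g x) =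
  fun x => re_part f x * re_part g x + - (im_part f x * im_part g x).
Proof. by apply/funext => x; rewrite /re_part ReM. Qed.

Lemma im_partM f g : im_part (fun x => f x * g x) =
  fun x => re_part f x * im_part g x + im_part f x * re_part g x.
Proof. by apply/funext => x; rewrite /im_part ImM. Qed.

Lemma re_partD f g : re_part (fun x => f x + g x) =
  fun x => re_part f x + re_part g x.
Proof. by apply/funext => x; rewrite /re_part; case: (f x); case: (g x). Qed.

Lemma im_partD f g : im_part (fun x => f x + g x) =
  fun x => im_part f x + im_part g x.
Proof. by apply/funext => x; rewrite /im_part; case: (f x); case: (g x). Qed.

Lemma complex_eq (a b : R[i]) : complex.Re a = complex.Re b ->
  complex.Im a = complex.Im b -> a = b.
Proof. by case: a => ? ?; case: b => ? ? /= -> ->. Qed.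

Lemma cdiffD f g x : cdiff f x -> cdiff g x -> cdiff (fun x => f x + g x) x.
Proof.
move=> [f1 f2] [g1 g2]; split; rewrite ?re_partD ?im_partD.
  exact: (differentiableD f1 g1).
exact: (differentiableD f2 g2).
Qed.

Lemma cderiveD f g x v : cdiff f x -> cdiff g x ->
  cderive v (fun x => f x + g x) x = cderive v f x + cderive v g x.
Proof.
move=> [f1 f2] [g1 g2]; apply: complex_eq; rewrite /cderive /=.
  rewrite re_partD.
  exact: (deriveD (@diff_derivable _ _ _ _ x v f1) (@diff_derivable _ _ _ _ x v g1)).
rewrite im_partD.
exact: (deriveD (@diff_derivable _ _ _ _ x v f2) (@diff_derivable _ _ _ _ x v g2)).
Qed.

Lemma cdiffM f g x : cdiff f x -> cdiff g x -> cdiff (fun x => f x * g x) x.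
Proof.
move=> [f1 f2] [g1 g2]; split; rewrite ?re_partM ?im_partM.
  exact: (differentiableB (differentiableM f1 g1) (differentiableM f2 g2)).
exact: (differentiableD (differentiableM f1 g2) (differentiableM f2 g1)).
Qed.

Lemma cderiveM f g x v : cdiff f x -> cdiff g x ->
  cderive v (fun x => f x * g x) x = cderive v f x * g x + f x * cderive v g x.
Proof.
move=> [f1 f2] [g1 g2].
have der (h : V -> R) : differentiable h x -> derivable h x v.
  by move=> ?; exact: diff_derivable.
have dM (h k : V -> R) : differentiable h x -> differentiable k x ->
   'D_v (fun y => h y * k y) x = h x * 'D_v k x + k x * 'D_v h x.
  by move=> dh dk; exact: (deriveM (der _ dh) (der _ dk)).
apply: complex_eq; rewrite /cderive /=.
  rewrite re_partM.
  have := deriveB (der _ (differentiableM f1 g1)) (der _ (differentiableM f2 g2)).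
  move=> /= E; rewrite -[LHS]/('D_v (re_part f * re_part g - im_part f * im_part g) x) E.
  rewrite (dM _ _ f1 g1) (dM _ _ f2 g2) /re_part /im_part.
  case: (f x) => a b; case: (g x) => c d /=; ring.
rewrite im_partM.
have := deriveD (der _ (differentiableM f1 g2)) (der _ (differentiableM f2 g1)).
move=> /= E; rewrite -[LHS]/('D_v (re_part f * im_part g + im_part f * re_part g) x) E.
rewrite (dM _ _ f1 g2) (dM _ _ f2 g1) /re_part /im_part.
case: (f x) => a b; case: (g x) => c d /=; ring.
Qed.

Lemma cdiff_cst c x : cdiff (fun _ => c) x.
Proof. by split; exact: differentiable_cst. Qed.

Lemma cderive_cst c x v : cderive v (fun _ : V => c) x = 0.
Proof.
apply: complex_eq => /=.
  by rewrite -[LHS]/('D_v (cst (complex.Re c)) x) derive_cst.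
by rewrite -[LHS]/('D_v (cst (complex.Im c)) x) derive_cst.
Qed.

Lemma near_cderive f g x v : (\forall y \near x, f y = g y) ->
  cderive v f x = cderive v g x.
Proof.
by move=> fg; rewrite /cderive; congr Complex; apply: near_eq_derive;
  apply: filterS fg => y; rewrite /re_part /im_part => ->.
Qed.

Lemma near_cdiff f g x : (\forall y \near x, f y = g y) ->
  cdiff f x -> cdiff g x.
Proof.
by move=> fg [f1 f2]; split; [apply: near_eq_differentiable f1|
  apply: near_eq_differentiable f2]; apply: filterS fg => y;
  rewrite /re_part /im_part => ->.
Qed.

Lemma cdiff_sum (I : Type) (r : seq I) (f : I -> V -> R[i]) x :
  (forall i, cdiff (f i) x) ->
  cdiff (fun y => \sum_(i <- r) f i y) x.
Proof.
move=> df; elim: r => [|i r IH].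
  apply: near_cdiff (cdiff_cst 0 x); near=> y; by rewrite big_nil.
apply: near_cdiff (cdiffD (df i) IH); near=> y; by rewrite big_cons.
Unshelve. all: by end_near. Qed.

Lemma cderive_sum (I : Type) (r : seq I) (f : I -> V -> R[i]) x v :
  (forall i, cdiff (f i) x) ->
  cderive v (fun y => \sum_(i <- r) f i y) x = \sum_(i <- r) cderive v (f i) x.
Proof.
move=> df; elim: r => [|i r IH].
  rewrite big_nil -[RHS](cderive_cst 0 x v).
  by apply: near_cderive; near=> y; rewrite big_nil.
rewrite big_cons -IH -cderiveD//; last exact: cdiff_sum.
by apply: near_cderive; near=> y; rewrite big_cons.
Unshelve. all: by end_near. Qed.

Lemma cderive_sum_dir (I : Type) (r : seq I) (f : V -> R[i]) x (c : I -> R)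
    (e : I -> V) : cdiff f x ->
  cderive (\sum_(i <- r) c i *: e i) f x = \sum_(i <- r) (c i)%:C * cderive (e i) f x.
Proof.
move=> [f1 f2]; elim: r => [|i r IH].
  by rewrite !big_nil /cderive !derive0.
rewrite !big_cons -IH /cderive !derive_add_dir// !derive_scale_dir//.
by apply: complex_eq; rewrite /= ?mul0r ?subr0 ?addr0.
Qed.

Lemma cCk_ext k D f g : open D -> (forall x, D x -> f x = g x) ->
  cCk k D f -> cCk k D g.
Proof.
move=> oD fg [f1 f2]; split; [apply: Ck_ext f1|apply: Ck_ext f2] => // x Dx;
  by rewrite /re_part /im_part fg.
Qed.

Lemma cCk_cst k D c : cCk k D (fun _ => c).
Proof. by split; exact: Ck_cst. Qed.

Lemma cCk_add k D f g : open D -> cCk k D f -> cCk k D g ->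
  cCk k D (fun x => f x + g x).
Proof.
move=> oD [f1 f2] [g1 g2]; split; rewrite ?re_partD ?im_partD; exact: Ck_add.
Qed.

Lemma cCk_mul k D f g : open D -> cCk k D f -> cCk k D g ->
  cCk k D (fun x => f x * g x).
Proof.
move=> oD [f1 f2] [g1 g2]; split; rewrite ?re_partM ?im_partM; apply: Ck_add => //.
- exact: Ck_mul.
- by apply: Ck_opp => //; exact: Ck_mul.
- exact: Ck_mul.
- exact: Ck_mul.
Qed.

Lemma cCk_sum k D (I : Type) (r : seq I) (f : I -> V -> R[i]) : open D ->
  (forall i, cCk k D (f i)) -> cCk k D (fun x => \sum_(i <- r) f i x).
Proof.
move=> oD fk; elim: r => [|i r IH].
  by apply: cCk_ext (cCk_cst k D 0) => // x _; rewrite big_nil.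
by apply: cCk_ext (cCk_add oD (fk i) IH) => // x _; rewrite big_cons.
Qed.

Lemma cCk_prod k D (I : Type) (r : seq I) (f : I -> V -> R[i]) : open D ->
  (forall i, cCk k D (f i)) -> cCk k D (fun x => \prod_(i <- r) f i x).
Proof.
move=> oD fk; elim: r => [|i r IH].
  by apply: cCk_ext (cCk_cst k D 1) => // x _; rewrite big_nil.
by apply: cCk_ext (cCk_mul oD (fk i) IH) => // x _; rewrite big_cons.
Qed.

Lemma cCk_inv k D f : open D -> (forall x, D x -> f x != 0) ->
  cCk k D f -> cCk k D (fun x => (f x)^-1).
Proof.
move=> oD f0 [f1 f2].
have n0 x : D x -> re_part f x * re_part f x + im_part f x * im_part f x != 0.
  move=> Dx; apply: contra (f0 x Dx); rewrite /re_part /im_part.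
  case: (f x) => a b /=; rewrite -!expr2 paddr_eq0 ?sqr_ge0// !sqrf_eq0.
  by move=> /andP[/eqP -> /eqP ->].
have ni := Ck_inv oD n0 (Ck_add oD (Ck_mul oD f1 f1) (Ck_mul oD f2 f2)).
split; [apply: (Ck_ext oD _ (Ck_mul oD f1 ni))|
        apply: (Ck_ext oD _ (Ck_opp oD (Ck_mul oD f2 ni)))] => x Dx;
  rewrite /re_part /im_part; case: (f x) => a b /=; by rewrite !expr2.
Qed.

Lemma cCk_cderive k D f v : cCk k.+1 D f -> cCk k D (cderive v f).
Proof. by move=> [[_ f1] [_ f2]]; split; [exact: f1|exact: f2]. Qed.

Lemma cCk_cdiff k D f x : D x -> cCk k.+1 D f -> cdiff f x.
Proof. by move=> Dx [[f1 _] [f2 _]]; split; [exact: f1|exact: f2]. Qed.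

Lemma cderive_comm D f x v w : open D -> D x -> cCk 2 D f ->
  cderive v (cderive w f) x = cderive w (cderive v f) x.
Proof.
move=> oD Dx [f1 f2].
have e1 := @derive_comm R V D (re_part f) x v w oD Dx f1.
have e2 := @derive_comm R V D (im_part f) x v w oD Dx f2.
change ('D_v ('D_w (re_part f)) x +i* 'D_v ('D_w (im_part f)) x =
        'D_w ('D_v (re_part f)) x +i* 'D_w ('D_v (im_part f)) x).
by rewrite e1 e2.
Qed.

Lemma cCk_det k D n (A : V -> 'M[R[i]]_n) : open D ->
  (forall i j, cCk k D (fun x => A x i j)) -> cCk k D (fun x => \det (A x)).
Proof.
move=> oD Ak; apply: cCk_sum => // s; apply: cCk_mul => //; first exact: cCk_cst.
by apply: cCk_prod => // i; exact: Ak.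
Qed.

(** Cramer's rule: entries of the inverse are cofactors over the determinant. [invmx] obeys it on
    unit matrices only. *)
Lemma cCk_invmx k D n (A : V -> 'M[R[i]]_n) i j : open D ->
  (forall x, D x -> A x \in unitmx) ->
  (forall i j, cCk k D (fun x => A x i j)) ->
  cCk k D (fun x => invmx (A x) i j).
Proof.
move=> oD Au Ak.
have Di : cCk k D (fun x => (\det (A x))^-1).
  by apply: cCk_inv => //; exact: cCk_det.
have Ci : cCk k D (fun x => cofactor (A x) j i).
  apply: cCk_mul => //; first exact: cCk_cst.
  apply: cCk_det => // p q; apply: cCk_ext (Ak (lift j p) (lift i q)) => // x _.
  by rewrite !mxE.
apply: (cCk_ext oD _ (cCk_mul oD Di Ci)) => x Dx.
by rewrite /invmx Au// !mxE.
Qed.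

End ComplexCalculus.

(** * The vector fields X_k *)

Section CoordinateFunctions.
Variable R : realType.

Definition coord_fun (n : nat) (i : 'I_n) (v : 'rV[R]_n) : R := v 0 i.

Lemma coord_fun_linear n (i : 'I_n) : linear (@coord_fun n i).
Proof. by move=> a u v; rewrite /coord_fun !mxE. Qed.

HB.instance Definition _ n (i : 'I_n) :=
  GRing.isLinear.Build R 'rV[R]_n R _ (@coord_fun n i) (@coord_fun_linear n i).

Lemma coord_fun_continuous n (i : 'I_n) : continuous (@coord_fun n i).
Proof. exact: coord_continuous. Qed.

Lemma derive_coord n (i : 'I_n) (x v : 'rV[R]_n) :
  differentiable (@coord_fun n i) x /\ 'D_v (@coord_fun n i) x = v 0 i.
Proof.
have d : differentiable (@coord_fun n i) x.
  by apply: linear_differentiable; exact: coord_fun_continuous.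
by split=> //; rewrite deriveE// diff_lin//; exact: coord_fun_continuous.
Qed.

End CoordinateFunctions.

Lemma sub_of_eq_add (V : zmodType) (a b s t : V) :
  a + s = b + t -> a = b -> s - t = 0.
Proof. by move=> + ab; rewrite ab => /addrI ->; rewrite subrr. Qed.

Lemma mulr_rev3 (A : comPzRingType) (a b c : A) : a * b * c = c * b * a.
Proof. by rewrite mulrC (mulrC a) mulrA. Qed.

Lemma trmx_sandwich_eq0 (F : fieldType) n (J B : 'M[F]_n) :
  J \in unitmx -> J^T *m B *m J = 0 -> B = 0.
Proof.
move=> Ju JBJ.
have JB : J^T *m B = 0 by rewrite -(mulmxK Ju (J^T *m B)) JBJ mul0mx.
have JTu : J^T \in unitmx by rewrite unitmx_tr.
by rewrite -(mulKmx JTu B) JB mulmx0.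
Qed.

Section DualFieldCalculus.
Variables (R : realType) (m : nat) (phi : 'rV[R]_m -> 'rV[R]_m).
Variable U : set 'rV[R]_m.
Hypothesis oU : open U.
Hypothesis phiC : Cinfty U phi.
Hypothesis ZjacU : forall x, U x -> Zjac phi x \in unitmx.
Implicit Types (g h : 'rV[R]_m -> R[i]) (x v w : 'rV[R]_m).

Definition Zcoord (k : 'I_m) x : R[i] := ccoord (Zmap phi x) k.

Lemma Zcoord_Cinfty k : cCinfty U (Zcoord k).
Proof.
move=> n; split.
  apply: (Ck_linear oU (@coord_fun_continuous R m k) (f := id)); exact: Ck_id.
exact: (Ck_linear oU (@coord_fun_continuous R m k) (phiC n)).
Qed.

Lemma Zjac_cderive x j l : Zjac phi x j l = cderive (delta_mx 0 l) (Zcoord j) x.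
Proof.
rewrite mxE /cderive; apply: complex_eq => /=.
  transitivity ((j == l)%:R : R).
    by case: (j == l); rewrite /= /real_complex_def /=; simpc.
  rewrite -[RHS]/('D_(delta_mx 0 l) (@coord_fun R m j) x).
  by rewrite (derive_coord j x _).2 mxE eqxx.
by case: (j == l); rewrite /= /real_complex_def /=; simpc.
Qed.

Lemma Zjac_Cinfty j l : cCinfty U (fun x => Zjac phi x j l).
Proof.
move=> k; apply: (cCk_ext oU _ (cCk_cderive (delta_mx 0 l) (Zcoord_Cinfty j k.+1))).
by move=> x _; rewrite Zjac_cderive.
Qed.

Lemma Xcoef_Cinfty k l : cCinfty U (fun x => Xcoef phi x k l).
Proof.
move=> n; apply: cCk_ext
  (cCk_invmx l k oU ZjacU (fun i j => Zjac_Cinfty i j n)) => // x _.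
by rewrite [RHS]mxE.
Qed.

Lemma Xfield_Cinfty k g : cCinfty U g -> cCinfty U (Xfield phi k g).
Proof.
move=> gC n; apply: cCk_sum => // l; apply: cCk_mul => //; first exact: Xcoef_Cinfty.
exact: cCk_cderive.
Qed.

Lemma Xfield_ext k g h x : (forall x, U x -> g x = h x) -> U x ->
  Xfield phi k g x = Xfield phi k h x.
Proof.
move=> gh Ux; apply: eq_bigr => l _; congr (_ * _).
by apply: near_cderive; exact: open_near_eq gh.
Qed.

Lemma cderive_dir g x v : cdiff g x ->
  cderive v g x = \sum_l (v 0 l)%:C * cderive (delta_mx 0 l) g x.
Proof.
by move=> dg; rewrite {1}[v]row_sum_delta cderive_sum_dir.
Qed.

(** This is [dg = \sum_k (X_k g) dZ_k], read off from [invmx J *m J = 1] for the Jacobian [J] of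
    [Z]. *)
Lemma cderive_Xfield g x v : U x -> cdiff g x ->
  cderive v g x = \sum_k cderive v (Zcoord k) x * Xfield phi k g x.
Proof.
move=> Ux dg.
have dZ k : cdiff (Zcoord k) x by exact: cCk_cdiff Ux (Zcoord_Cinfty k 1).
have E l : cderive (delta_mx 0 l) g x =
    \sum_k cderive (delta_mx 0 l) (Zcoord k) x * Xfield phi k g x.
  transitivity (\sum_p (invmx (Zjac phi x) *m Zjac phi x) p l *
      cderive (delta_mx 0 p) g x).
    rewrite mulVmx ?ZjacU// (bigD1 l)//= mxE eqxx mul1r big1 ?addr0// => p.
    by move=> /negbTE pl; rewrite mxE pl mul0r.
  under eq_bigr do rewrite mxE big_distrl.
  rewrite exchange_big; apply: eq_bigr => k _; rewrite /Xfield mulr_sumr.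
  apply: eq_bigr => p _; rewrite -Zjac_cderive mulrCA mulrA.
  by congr (_ * _ * _); rewrite [RHS]mxE.
rewrite cderive_dir//; under eq_bigr do rewrite E mulr_sumr.
rewrite exchange_big; apply: eq_bigr => k _.
rewrite [in RHS]cderive_dir// mulr_suml; apply: eq_bigr => l _.
by rewrite mulrA.
Qed.

(* Symmetry of the second derivatives in [D_v g = \sum_k (D_v Z_k) X_k g] gives
   [J^T B J = 0], [J] the Jacobian of [Z] and [B] the matrix of commutators. *)
Lemma Xfield_comm j k g x : cCinfty U g -> U x ->
  Xfield phi j (Xfield phi k g) x = Xfield phi k (Xfield phi j g) x.
Proof.
move=> gC Ux.
have dZ n : cdiff (Zcoord n) x by exact: cCk_cdiff Ux (Zcoord_Cinfty n 1).
have dX n : cdiff (Xfield phi n g) x.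
  exact: cCk_cdiff Ux (Xfield_Cinfty n gC 1).
have ddZ v n : cdiff (cderive v (Zcoord n)) x.
  by apply: (cCk_cdiff Ux); apply: cCk_cderive; exact: Zcoord_Cinfty 2.
pose J := Zjac phi x.
pose B := \matrix_(p, q) (Xfield phi p (Xfield phi q g) x
                          - Xfield phi q (Xfield phi p g) x) : 'M[R[i]]_m.
have D2 v w : cderive v (cderive w g) x =
    \sum_q cderive v (cderive w (Zcoord q)) x * Xfield phi q g x
    + \sum_q \sum_p cderive v (Zcoord p) x * Xfield phi p (Xfield phi q g) x
        * cderive w (Zcoord q) x.
  transitivity (cderive v
      (fun y => \sum_q cderive w (Zcoord q) y * Xfield phi q g y) x).
    apply: near_cderive; apply: open_near_eq oU Ux _ => y Uy.
    exact: cderive_Xfield Uy (cCk_cdiff Uy (gC 1%N)).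
  rewrite cderive_sum; last by move=> q; exact: cdiffM.
  rewrite -big_split; apply: eq_bigr => q _ /=; rewrite cderiveM//; congr (_ + _).
  by rewrite (cderive_Xfield _ Ux (dX q)) mulr_sumr; apply: eq_bigr => p _;
    rewrite mulrC.
have S v w : \sum_q \sum_p cderive v (Zcoord p) x * B p q * cderive w (Zcoord q) x = 0.
  have c2 := etrans (esym (D2 v w))
    (etrans (cderive_comm v w oU Ux (gC 2)) (D2 w v)).
  have cZ : \sum_q cderive v (cderive w (Zcoord q)) x * Xfield phi q g x =
      \sum_q cderive w (cderive v (Zcoord q)) x * Xfield phi q g x.
    apply: eq_bigr => q _.
    by rewrite (cderive_comm v w oU Ux (Zcoord_Cinfty q 2)).
  have {}c2 := sub_of_eq_add c2 cZ.
  rewrite -[RHS]c2 [X in _ = _ - X]exchange_big -sumrB; apply: eq_bigr => q _.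
  rewrite -sumrB; apply: eq_bigr => p _; rewrite !mxE mulrBr mulrBl.
  rewrite [X in _ = _ - X]mulr_rev3; reflexivity.
have JBJ : J^T *m B *m J = 0.
  apply/matrixP => l n; rewrite !mxE -[RHS](S (delta_mx 0 l) (delta_mx 0 n)).
  apply: eq_bigr => q _; rewrite mxE mulr_suml; apply: eq_bigr => p _.
  by rewrite mxE !Zjac_cderive.
have B0 : B = 0 := trmx_sandwich_eq0 (ZjacU Ux) JBJ.
by apply/eqP; rewrite -subr_eq0; move/matrixP: B0 => /(_ j k); rewrite !mxE => ->.
Qed.

End DualFieldCalculus.

(** * Words in the fields X_k *)

Section Words.
Variables (R : realType) (m : nat) (phi : 'rV[R]_m -> 'rV[R]_m).
Variable U : set 'rV[R]_m.
Hypothesis oU : open U.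
Hypothesis phiC : Cinfty U phi.
Hypothesis ZjacU : forall x, U x -> Zjac phi x \in unitmx.
Implicit Types (g h : 'rV[R]_m -> R[i]) (x : 'rV[R]_m) (w : seq 'I_m).

(** A word records the order of application, so applying one more field is a cons and needs no
    commutation. *)
Definition Xword w g := foldr (Xfield phi) g w.

Lemma Xword_Cinfty w g : cCinfty U g -> cCinfty U (Xword w g).
Proof.
by move=> gC; elim: w => //= k w IH; exact: (Xfield_Cinfty oU phiC ZjacU k IH).
Qed.

Lemma Xword_swap a k w g x : cCinfty U g -> U x ->
  Xword (a ++ k :: w) g x = Xword (k :: a ++ w) g x.
Proof.
move=> gC; elim: a x => [|j a IH] x Ux //=.
rewrite (Xfield_ext phi oU j IH Ux) /=.
by rewrite (Xfield_comm oU phiC ZjacU)//; exact: Xword_Cinfty.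
Qed.

Lemma Xword_perm w w' g x : cCinfty U g -> perm_eq w w' -> U x ->
  Xword w g x = Xword w' g x.
Proof.
move=> gC; elim: w w' x => [|k w IH] w' x pw Ux.
  by have := perm_size pw; case: w' pw.
have kw' : k \in w' by rewrite -(perm_mem pw) mem_head.
case/splitPr : kw' pw => a b pw; rewrite Xword_swap//=.
apply: (Xfield_ext phi oU) Ux => y Uy; apply: IH => //.
by move: pw; rewrite perm_sym -cat1s perm_catCA /= perm_cons perm_sym.
Qed.

Definition word_of (alpha : 'I_m -> nat) : seq 'I_m :=
  flatten [seq nseq (alpha k) k | k <- enum 'I_m].

Lemma Xpow_word alpha g : Xpow phi alpha g = Xword (word_of alpha) g.
Proof.
rewrite /Xpow /word_of; elim: (enum _) => //= k s ->.
rewrite /Xword foldr_cat; elim: (alpha k) => //= n ->.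
by [].
Qed.

Lemma perm_word_of w : perm_eq w (word_of (fun k => count_mem k w)).
Proof.
apply/allP => k _ /=; rewrite /word_of count_flatten -map_comp.
rewrite sumnE big_map (bigD1_seq k) ?enum_uniq ?mem_enum//= count_nseq /= eqxx mul1n.
rewrite big1 ?addn0// => j jk; by rewrite count_nseq /= (negbTE jk).
Qed.

Lemma mlen_count w : mlen (fun k : 'I_m => count_mem k w) = size w.
Proof.
rewrite /mlen; elim: w => [|j w IH] /=; first by rewrite big1.
rewrite big_split /= IH (bigD1 j)//= eqxx big1 ?addn0// => k.
by rewrite eq_sym => /negbTE ->.
Qed.

(** The hypothesis concerns the ordered products [Xpow]. As the fields commute, a word may be
    sorted, and the bound depends on its length only, so the constant does not change. *)
Lemma CM_word (M : nat -> R) g (K : set 'rV[R]_m) : CM phi M U g ->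
  compact K -> K `<=` U -> exists2 C : R, 0 < C &
    forall w x, K x ->
      ComplexField.Normc.normc (Xword w g x) <= C ^+ (size w).+1 * M (size w).
Proof.
move=> [gC HC] cK KU; have [C C0 H] := HC K cK KU; exists C => // w x Kx.
have := H (fun k => count_mem k w) x Kx.
rewrite mlen_count Xpow_word; congr (_ <= _); congr ComplexField.Normc.normc.
by apply/esym/Xword_perm => //; [exact: perm_word_of|exact: KU].
Qed.

End Words.

(** * The operator dbar and the Taylor terms *)

Lemma half_sumD (A : comNzRingType) (h i a b c d : A) :
  h * (a + b + i * (c + d)) = h * (a + i * c) + h * (b + i * d).
Proof. by ring. Qed.

Lemma half_sumM (A : comNzRingType) (h i a b c d f g : A) :
  h * (a * g + f * b + i * (c * g + f * d)) =
  h * (a + i * c) * g + f * (h * (b + i * d)).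
Proof. by ring. Qed.

Section Dbar.
Variables (R : realType) (m : nat).
Notation CV := (Cspace R m).
Implicit Types (F G : CV -> R[i]) (z : CV) (j : 'I_m).

Lemma near_dbar F G z j : (\forall y \near z, F y = G y) ->
  dbar F z j = dbar G z j.
Proof.
by move=> FG; rewrite /dbar (near_cderive _ FG) (near_cderive (0, _) FG).
Qed.

Lemma dbarD F G z j : cdiff F z -> cdiff G z ->
  dbar (fun y => F y + G y) z j = dbar F z j + dbar G z j.
Proof.
move=> dF dG; have e v := cderiveD v dF dG.
rewrite /dbar (e (delta_mx 0 j, 0)) (e (0, delta_mx 0 j)).
exact: half_sumD.
Qed.

Lemma dbarM F G z j : cdiff F z -> cdiff G z ->
  dbar (fun y => F y * G y) z j = dbar F z j * G z + F z * dbar G z j.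
Proof.
move=> dF dG; have e v := cderiveM v dF dG.
rewrite /dbar (e (delta_mx 0 j, 0)) (e (0, delta_mx 0 j)).
exact: half_sumM.
Qed.

Lemma dbar_cst c z j : dbar (fun _ : CV => c) z j = 0.
Proof. by rewrite /dbar !cderive_cst mulr0 addr0 mulr0. Qed.

Lemma dbar_sum (I : Type) (r : seq I) (F : I -> CV -> R[i]) z j :
  (forall i, cdiff (F i) z) ->
  dbar (fun y => \sum_(i <- r) F i y) z j = \sum_(i <- r) dbar (F i) z j.
Proof.
move=> dF; elim: r => [|i r IH].
  rewrite big_nil -[RHS](dbar_cst 0 z j).
  by apply: near_dbar; near=> y; rewrite big_nil.
rewrite big_cons -IH.
apply: etrans (dbarD j (dF i) (cdiff_sum r dF)).
by apply: near_dbar; near=> y; rewrite big_cons.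
Unshelve. all: by end_near. Qed.

Lemma fst_continuous : continuous (fst : CV -> 'rV[R]_m).
Proof. by move=> z; exact: cvg_fst. Qed.

Lemma snd_continuous : continuous (snd : CV -> 'rV[R]_m).
Proof. by move=> z; exact: cvg_snd. Qed.

Lemma cdiff_fst (g : 'rV[R]_m -> R[i]) z v : cdiff g z.1 ->
  cdiff (fun z => g z.1) z /\ cderive v (fun z => g z.1) z = cderive v.1 g z.1.
Proof.
move=> [g1 g2].
have [a1 b1] := derive_comp_linear v fst_continuous g1.
have [a2 b2] := derive_comp_linear v fst_continuous g2.
by split=> //; apply: complex_eq.
Qed.

Lemma dbar_fst (g : 'rV[R]_m -> R[i]) z j : cdiff g z.1 ->
  dbar (fun z => g z.1) z j = 2^-1 * cderive (delta_mx 0 j) g z.1.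
Proof.
move=> dg; rewrite /dbar (cdiff_fst _ dg).2 (cdiff_fst _ dg).2 /=.
by congr (_ * _); rewrite /cderive !derive0 -[X in _ + X]/('i * 0) mulr0 addr0.
Qed.

Lemma cCk_fst k (U : set 'rV[R]_m) (g : 'rV[R]_m -> R[i]) : open U ->
  cCk k U g -> cCk k [set z : CV | U z.1] (fun z => g z.1).
Proof.
move=> oU [g1 g2]; split.
  exact: (Ck_comp_linear oU fst_continuous g1).
exact: (Ck_comp_linear oU fst_continuous g2).
Qed.

Lemma open_fst (U : set 'rV[R]_m) : open U -> open [set z : CV | U z.1].
Proof. by move=> oU; apply: open_comp => // z _; exact: fst_continuous. Qed.

Lemma cCinfty_ccoord k (D : set CV) : cCinfty D (fun z : CV => ccoord z k).
Proof.
have cc := @coord_fun_continuous R m k.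
suff H : cCinfty setT (fun z : CV => ccoord z k).
  by move=> n; have [h1 h2] := H n; split; [apply: Ck_sub h1|apply: Ck_sub h2].
move=> n; split.
  apply: (Ck_comp_linear openT fst_continuous (f := @coord_fun R m k)).
  by apply: (Ck_linear openT cc (f := id)); exact: Ck_id.
apply: (Ck_comp_linear openT snd_continuous (f := @coord_fun R m k)).
by apply: (Ck_linear openT cc (f := id)); exact: Ck_id.
Qed.

Lemma dbar_ccoord k z j : dbar (fun z : CV => ccoord z k) z j = 0.
Proof.
have E v : cderive v (fun z : CV => ccoord z k) z = ccoord v k.
  have [d1 e1] := derive_coord k z.1 v.1.
  have [d2 e2] := derive_coord k z.2 v.2.
  apply: complex_eq => /=.
    by rewrite -e1 -(derive_comp_linear v fst_continuous d1).2.
  by rewrite -e2 -(derive_comp_linear v snd_continuous d2).2.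
rewrite /dbar !E /ccoord /= !mxE eqxx /=.
apply/eqP; rewrite mulf_eq0; apply/orP; right.
by case: (k == j); apply/eqP; apply: complex_eq; rewrite /=; ring.
Qed.

End Dbar.

(** * The formal Taylor terms and their dbar *)

Section TaylorTerms.
Variables (R : realType) (m : nat) (phi : 'rV[R]_m -> 'rV[R]_m).
Variable U : set 'rV[R]_m.
Hypothesis oU : open U.
Hypothesis phiC : Cinfty U phi.
Hypothesis ZjacU : forall x, U x -> Zjac phi x \in unitmx.
Notation CV := (Cspace R m).
Notation W := [set z : CV | U z.1].
Implicit Types (g h : 'rV[R]_m -> R[i]) (z : CV).

Definition Zdiff (k : 'I_m) z : R[i] := ccoord z k - Zcoord phi k z.1.

(* [\sum_(|alpha| = n) X^alpha g (x) (z - Z x)^alpha / alpha!] for [x = z.1],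
   written as [(\sum_k (z - Z x)_k X_k)^n g / n!] with [z - Z x] frozen. *)
Fixpoint taylor n g z : R[i] :=
  match n with
  | 0%N => g z.1
  | n'.+1 => (n'.+1)%:R^-1 * \sum_k Zdiff k z * taylor n' (Xfield phi k g) z
  end.

Lemma taylor_ext n g h z : (forall x, U x -> g x = h x) -> W z ->
  taylor n g z = taylor n h z.
Proof.
elim: n g h => [|n IH] g h gh Wz /=; first exact: gh.
congr (_ * _); apply: eq_bigr => k _; congr (_ * _); apply: IH => // x Ux.
exact: (Xfield_ext phi oU).
Qed.

Lemma Zdiff_Cinfty k : cCinfty W (Zdiff k).
Proof.
move=> n; have oW := open_fst oU.
have zk := cCk_fst oU (Zcoord_Cinfty oU phiC k n).
apply: (cCk_ext oW _ (cCk_add oW (cCinfty_ccoord k W n)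
  (cCk_mul oW (cCk_cst n W (-1)) zk))) => z _.
by rewrite mulN1r.
Qed.

Lemma taylor_Cinfty n g : cCinfty U g -> cCinfty W (taylor n g).
Proof.
have oW := open_fst oU.
elim: n g => [|n IH] g gC k /=; first exact: cCk_fst oU (gC k).
apply: (cCk_mul oW); first exact: cCk_cst.
apply: (cCk_sum _ oW) => l; apply: (cCk_mul oW); first exact: Zdiff_Cinfty.
by apply: IH; exact: (Xfield_Cinfty oU phiC ZjacU).
Qed.

Lemma taylor_cdiff n g z : cCinfty U g -> W z -> cdiff (taylor n g) z.
Proof. by move=> gC Wz; exact: (cCk_cdiff (D := W) Wz (taylor_Cinfty n gC 1)). Qed.

(** [z_k] is holomorphic, and [Z_k (x)] depends on the real part of [z] only, so only half of its
    [x_j]-derivative survives. *)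
Lemma dbar_Zdiff k z j : W z -> dbar (Zdiff k) z j =
  - (2^-1 * cderive (delta_mx 0 j) (Zcoord phi k) z.1).
Proof.
move=> Wz.
have dz : cdiff (Zcoord phi k) z.1 by exact: (cCk_cdiff (D := U) Wz (Zcoord_Cinfty oU phiC k 1)).
have [dz' _] := @cdiff_fst R m _ z 0 dz.
have dc : cdiff (fun z : CV => ccoord z k) z.
  exact: (cCk_cdiff (D := setT) I (cCinfty_ccoord k setT 1)).
have dm := cdiffM (cdiff_cst (-1) z) dz'.
transitivity (dbar (fun z => ccoord z k + -1 * Zcoord phi k z.1) z j).
  by apply: near_dbar; near=> y; rewrite mulN1r.
apply: etrans (dbarD j dc dm) _; rewrite dbar_ccoord add0r.
apply: etrans (dbarM j (cdiff_cst (-1) z) dz') _.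
by rewrite dbar_cst mul0r add0r mulN1r dbar_fst.
Unshelve. all: by end_near. Qed.

(** This is [H_n]. The coefficient of each Taylor term of [X_k g] is [- dbar (Zdiff k)]. *)
Definition taylor_dbar n g z j : R[i] :=
  \sum_k 2^-1 * cderive (delta_mx 0 j) (Zcoord phi k) z.1
     * taylor n (Xfield phi k g) z.

Definition taylor_dbar_pred n g z j : R[i] :=
  if n is n'.+1 then taylor_dbar n' g z j else 0.

(** Unfolding one level of [taylor n.+1] on the right produces [X_k X_p g], whereas the left
    contains [X_p X_k g]: the commutation of the fields enters here. *)
Lemma Zdiff_taylor_dbar n g z j : cCinfty U g -> W z ->
  \sum_k Zdiff k z * taylor_dbar n (Xfield phi k g) z j =
  n.+1%:R * taylor_dbar n.+1 g z j.
Proof.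
move=> gC Wz; rewrite /taylor_dbar.
under eq_bigr do rewrite mulr_sumr.
rewrite exchange_big mulr_sumr; apply: eq_bigr => p _ /=.
rewrite [RHS]mulrCA [X in _ = _ * X]mulrA mulfV ?pnatr_eq0// mul1r mulr_sumr.
apply: eq_bigr => k _; rewrite mulrCA; congr (_ * (_ * _)).
by apply: taylor_ext => // x Ux; exact: (Xfield_comm oU phiC ZjacU).
Qed.

(** Write [(n+1) P_(n+1)] as [\sum_k Zdiff k * P_n (X_k g)]. Differentiating [P_n] gives
    [(n+1) H_(n+1) - n H_n] by induction, differentiating [Zdiff k] gives [- H_n], and the total is
    divisible by [n + 1]. *)
Lemma dbar_taylor n g z j : cCinfty U g -> W z ->
  dbar (taylor n g) z j = taylor_dbar n g z j - taylor_dbar_pred n g z j.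
Proof.
move=> + Wz; elim: n g => [|n IH] g gC.
  have dg : cdiff g z.1 by exact: (cCk_cdiff (D := U) Wz (gC 1%N)).
  rewrite subr0 [LHS]dbar_fst// (cderive_Xfield oU phiC ZjacU _ Wz dg) mulr_sumr.
  by apply: eq_bigr => k _; rewrite mulrA.
have XC k := Xfield_Cinfty oU phiC ZjacU k gC.
have dZ k : cdiff (Zdiff k) z by exact: (cCk_cdiff (D := W) Wz (Zdiff_Cinfty k 1)).
have dT k : cdiff (taylor n (Xfield phi k g)) z by exact: taylor_cdiff.
have dZT k := cdiffM (dZ k) (dT k).
apply: etrans (dbarM j (cdiff_cst _ z) (cdiff_sum (index_enum _) dZT)) _.
rewrite dbar_cst mul0r add0r.
have -> : dbar (fun y => \sum_k Zdiff k y * taylor n (Xfield phi k g) y) z j =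
    n.+1%:R * taylor_dbar n.+1 g z j - n.+1%:R * taylor_dbar n g z j.
  apply: etrans (dbar_sum (index_enum _) j dZT) _.
  transitivity (\sum_k (Zdiff k z * taylor_dbar n (Xfield phi k g) z j
     - Zdiff k z * taylor_dbar_pred n (Xfield phi k g) z j
     - 2^-1 * cderive (delta_mx 0 j) (Zcoord phi k) z.1
         * taylor n (Xfield phi k g) z)).
    apply: eq_bigr => k _; apply: etrans (dbarM j (dZ k) (dT k)) _.
    by rewrite dbar_Zdiff// IH// mulrBr mulNr addrC.
  rewrite !sumrB Zdiff_taylor_dbar//.
  rewrite -/(taylor_dbar n g z j).
  have -> : \sum_k Zdiff k z * taylor_dbar_pred n (Xfield phi k g) z j =
      n%:R * taylor_dbar n g z j.
    (* For [n = 0] both sides vanish, by the convention [H_(-1) = 0]. *)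
    case: n {IH dT dZT} => [|n]; last exact: Zdiff_taylor_dbar.
    by rewrite mul0r big1// => k _; rewrite mulr0.
  by rewrite -addrA -opprD -[X in _ - (_ + X)]mul1r -mulrDl natr1.
by rewrite -mulrBr mulrA mulVf ?mul1r// pnatr_eq0.
Qed.

End TaylorTerms.

(** * Regular sequences *)

Section RegularSequences.
Variables (R : realType) (M : nat -> R).
Hypothesis regM : regular_sequence M.
Implicit Types (n k j : nat) (A s : R).

Definition mratio n : R := mseq M n.+1 / mseq M n.

Lemma mseq_gt0 n : 0 < mseq M n.
Proof.
have [M0 [m0 m1] mc _ _] := regM.
suff : 0 < mseq M n /\ 0 < mseq M n.+1 by case.
elim: n => [|n [a b]]; first by rewrite m0 m1.
split=> //; have := mc n.+1 isT; rewrite /= => H.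
have : 0 < mseq M n * mseq M n.+2 by apply: lt_le_trans H; rewrite exprn_gt0.
by rewrite pmulr_rgt0.
Qed.

Lemma mseqS n : mseq M n.+1 = mseq M n * mratio n.
Proof. by rewrite /mratio mulrC divfK// gt_eqF// mseq_gt0. Qed.

Lemma mratio_gt0 n : 0 < mratio n.
Proof. by rewrite divr_gt0// mseq_gt0. Qed.

Lemma mratio_nondec n k : (n <= k)%N -> mratio n <= mratio k.
Proof.
move=> /subnK <-; elim: (k - n)%N => // j IH; apply: le_trans IH _.
rewrite addSn; set p := (j + n)%N.
have [_ _ mc _ _] := regM; have := mc p.+1 isT; rewrite /= => H.
by rewrite ler_pdivrMr ?mseq_gt0// mulrAC ler_pdivlMr ?mseq_gt0// -expr2 mulrC.
Qed.

Lemma mratio0 : mratio 0 = 1.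
Proof. by rewrite /mratio; have [_ [-> ->] _ _ _] := regM; rewrite divr1. Qed.

Lemma mratio_ge1 n : 1 <= mratio n.
Proof. by rewrite -mratio0; exact: mratio_nondec. Qed.

(** Condition (c) with the roots removed; at index 0, which (c) does not cover, the quotient is
    1. *)
Lemma mratio_le_expn : exists2 B : R, 1 <= B & forall n, mratio n <= B ^+ n.
Proof.
have [_ _ _ [B0 HB] _] := regM.
exists (Num.max 1 B0); first by rewrite le_max lexx.
case=> [|n]; first by rewrite mratio0 expr0.
have n0 : (0 : R) < mratio n.+1 := mratio_gt0 n.+1.
have := HB (mratio n.+1 `^ (n.+1%:R^-1)); rewrite /= => H.
have {}H : mratio n.+1 `^ (n.+1%:R^-1) <= B0 by apply: H; exists n.+1.
have E : mratio n.+1 = (mratio n.+1 `^ (n.+1%:R^-1)) ^+ n.+1.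
  by rewrite -powR_mulrn ?powR_ge0// -powRrM mulVf ?pnatr_eq0// powRr1// ltW.
rewrite E; apply: lerXn2r; rewrite ?nnegrE ?powR_ge0//.
  by rewrite le_max ler01.
by rewrite le_max H orbT.
Qed.

Lemma seqM_nondec n k : (n <= k)%N -> M n <= M k.
Proof.
have ME j : M j = mseq M j * j`!%:R by rewrite /mseq divfK// pnatr_eq0 -lt0n fact_gt0.
move=> /subnK <-; elim: (k - n)%N => // j IH; apply: le_trans IH _.
rewrite addSn !ME factS mseqS natrM -mulrA; apply: ler_wpM2l; first by rewrite ltW// mseq_gt0.
rewrite mulrA ler_peMl// mulr_ege1 ?mratio_ge1//.
by rewrite ler1n.
Qed.

(** [m_n s^n] arises from [m_k s^k] by multiplication with the factors [mratio j * s], [k <= j < n],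
    and by log-convexity the last factor is the largest. The companion [mseq_expn_ge] uses that the
    first is the smallest. *)
Lemma mseq_expn_le n k s (q : R) : 0 <= s -> (k <= n)%N ->
  mratio n * s <= q -> mseq M n * s ^+ n <= mseq M k * s ^+ k * q ^+ (n - k).
Proof.
move=> s0 kn; rewrite -{1 2 3}(subnK kn); elim: (n - k)%N => [|j IH] H.
  by rewrite add0n expr0 mulr1.
have q0 : 0 <= q by apply: le_trans H; rewrite mulr_ge0// ltW// mratio_gt0.
have H' : mratio (j + k) * s <= q.
  by apply: le_trans H; apply: ler_wpM2r => //; rewrite mratio_nondec// addSn.
rewrite addSn mseqS exprSr [q ^+ j.+1]exprSr [leRHS]mulrA mulrACA.
apply: ler_pM (IH H') H'.
- by rewrite mulr_ge0 ?exprn_ge0// ltW// mseq_gt0.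
- by rewrite mulr_ge0// ltW// mratio_gt0.
Qed.

Lemma mseq_expn_ge n k s (q : R) : 0 <= s -> 0 <= q -> (n <= k)%N ->
  q <= mratio n * s -> mseq M n * s ^+ n * q ^+ (k - n) <= mseq M k * s ^+ k.
Proof.
move=> s0 q0 nk H; rewrite -{2 3}(subnK nk); elim: (k - n)%N => [|j IH].
  by rewrite add0n expr0 mulr1.
have H' : q <= mratio (j + n) * s.
  by apply: (le_trans H); apply: ler_wpM2r => //; rewrite mratio_nondec// leq_addl.
rewrite addSn mseqS exprSr [s ^+ _.+1]exprSr [leLHS]mulrA [leRHS]mulrACA.
apply: ler_pM IH H' => //; apply: mulr_ge0; last exact: exprn_ge0.
by apply: mulr_ge0; [exact: ltW (mseq_gt0 n)|exact: exprn_ge0].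
Qed.

(* The cutoff of the [n]-th term varies only where [s] satisfies these bounds;
   there [m_n s ^ n] is, up to geometric factors, the least of all [m_k s ^ k]. *)
Lemma mseq_expn_min (B A s : R) n k : 1 <= B -> (forall j, mratio j <= B ^+ j) ->
  1 <= A -> 0 <= s -> A * mratio n * s <= 1 -> 1 <= 2 * A * mratio n.+1 * s ->
  A ^+ n * (mseq M n * s ^+ n) <= B ^+ n.+1 * ((2 * A) ^+ k * (mseq M k * s ^+ k)).
Proof.
move=> B1 HB A1 s0 H1 H2.
have A0 : 0 < A by exact: lt_le_trans A1.
have A20 : 0 < 2 * A by rewrite mulr_gt0.
have mk0 : 0 <= mseq M k * s ^+ k by rewrite mulr_ge0 ?exprn_ge0// ltW// mseq_gt0.
have mn0 : 0 <= mseq M n * s ^+ n by rewrite mulr_ge0 ?exprn_ge0// ltW// mseq_gt0.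
have BB : 1 <= B ^+ n.+1 by exact: exprn_ege1.
(* For [k <= n] all factors between [k] and [n] are at most [A^-1], which leaves [A ^+ k], hence at
   most [(2 * A) ^+ k]. *)
have [kn|nk] := leqP k n.
  have q : mratio n * s <= A^-1 by rewrite -[A^-1]mul1r ler_pdivlMr// mulrC mulrA.
  have E := mseq_expn_le s0 kn q.
  apply: (@le_trans _ _ ((2 * A) ^+ k * (mseq M k * s ^+ k))); last first.
    by rewrite ler_peMl// mulr_ge0// exprn_ge0// ltW.
  apply: (@le_trans _ _ (A ^+ n * (mseq M k * s ^+ k * A^-1 ^+ (n - k)))).
    by apply: ler_wpM2l => //; rewrite exprn_ge0// ltW.
  rewrite mulrA mulrAC -[in A ^+ n](subnK kn) exprD exprVn mulrAC.
  rewrite [leLHS]mulrAC [A ^+ (n - k) * _]mulrC mulfK ?expf_neq0 ?gt_eqF//.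
  apply: ler_wpM2r => //; apply: lerXn2r; rewrite ?nnegrE ?ltW//.
  by rewrite ltr_pMl// ltr1n.
have sn : 0 < s.
  rewrite lt_neqAle s0 andbT; apply/eqP => s00; move: H2.
  by rewrite -s00 mulr0 ler10.
have q' : (2 * A)^-1 <= mratio n.+1 * s by rewrite -[_^-1]mul1r ler_pdivrMr// mulrC mulrA.
have q0 : 0 <= (2 * A)^-1 by rewrite invr_ge0 ltW.
have E := mseq_expn_ge s0 q0 nk q'.
(* The factor from [n] to [n + 1] has no direct lower bound. It is compared with the next one, which
   is at least [(2 A)^-1]: as [mratio n >= 1], replacing [mratio n.+1] by [mratio n] loses at most
   [B ^+ n.+1]. *)
have F : mseq M n * s ^+ n <= 2 * A * B ^+ n.+1 * (mseq M n.+1 * s ^+ n.+1).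
  have -> : mseq M n.+1 * s ^+ n.+1 = mseq M n * s ^+ n * (mratio n * s).
    by rewrite mseqS exprSr mulrACA.
  rewrite mulrCA ler_peMr//; apply: (le_trans H2).
  rewrite [leRHS]mulrA; apply: ler_wpM2r => //.
  rewrite -[leLHS]mulr1; apply: ler_pM => //.
  - by rewrite mulr_ge0// ltW// mratio_gt0.
  - by apply: ler_wpM2l; [rewrite ltW|exact: HB].
  - exact: mratio_ge1.
(* From [n + 1] upwards every factor is at least [(2 A)^-1]. *)
have E' : mseq M n.+1 * s ^+ n.+1 <= (2 * A) ^+ (k - n.+1) * (mseq M k * s ^+ k).
  by rewrite -ler_pdivrMl ?exprn_gt0// -exprVn mulrC.
apply: (@le_trans _ _ ((2 * A) ^+ n * (2 * A * B ^+ n.+1 *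
   ((2 * A) ^+ (k - n.+1) * (mseq M k * s ^+ k))))).
  apply: ler_pM => //; first by rewrite exprn_ge0// ltW.
    apply: lerXn2r; rewrite ?nnegrE ?ltW//.
    by rewrite ltr_pMl// ltr1n.
  apply: (le_trans F); apply: ler_wpM2l => //.
  by rewrite !mulr_ge0// ?exprn_ge0// ltW// (lt_le_trans ltr01).
rewrite le_eqVlt; apply/orP; left; apply/eqP.
have -> : (2 * A) ^+ k = (2 * A) ^+ n * (2 * A) * (2 * A) ^+ (k - n.+1).
  by rewrite -exprSr -exprD subnKC.
move: (B ^+ _) ((2 * A) ^+ _) ((2 * A) ^+ _) (mseq _ _ * _) => a b c d; ring.
Qed.

Lemma mseq_addn_le (B : R) n k : 1 <= B -> (forall j, mratio j <= B ^+ j) ->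
  mseq M (n + k) <= mseq M n * B ^+ (k * (n + k)).
Proof.
move=> B1 HB; elim: k => [|k IH]; first by rewrite addn0 mul0n expr0 mulr1.
rewrite addnS mseqS.
apply: (@le_trans _ _ (mseq M n * B ^+ (k * (n + k)) * B ^+ (n + k))).
  apply: ler_pM IH (HB _); first exact: ltW (mseq_gt0 _).
  exact: ltW (mratio_gt0 _).
rewrite -mulrA -exprD; apply: ler_wpM2l; first exact: ltW (mseq_gt0 _).
by apply: ler_weXn2l => //; rewrite -addnS mulSn addnC leq_add ?leq_mul// addnS leqnSn.
Qed.

Lemma seqME n : M n = mseq M n * n`!%:R.
Proof. by rewrite /mseq divfK// pnatr_eq0 -lt0n fact_gt0. Qed.

Lemma fact_addn_le n k : ((n + k)`! <= 2 ^ (n + k) * k`! * n`!)%N.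
Proof.
have H p j : ('C(p, j) <= 2 ^ p)%N.
  elim: p j => [|p IH] [|j] //; first by rewrite bin0 expn_gt0.
  by rewrite binS expnS mul2n -addnn leq_add.
by rewrite -(@bin_fact (n + k) k) ?leq_addl// addnK mulnA !leq_mul.
Qed.

(** The left side is what [k] derivatives of the [n]-th term cost: [M (n + k) / n!] from the longer
    words, [mratio n ^+ k] from the radius. Here the geometric rate [Q = 2 B^(2k)] depends on
    [k]. *)
Lemma finite_growth k : exists2 Q : R, 1 <= Q & exists2 K : R, 0 <= K &
  forall n, M (n + k) / n`!%:R * mratio n ^+ k <= K * Q ^+ n * mseq M n.
Proof.
have [B B1 HB] := mratio_le_expn.
have B0 : 0 <= B by exact: le_trans B1.
exists (2 * B ^+ (2 * k)).
  by apply: mulr_ege1; [rewrite ler1n|exact: exprn_ege1].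
exists (2 ^+ k * k`!%:R * B ^+ (k * k)).
  by rewrite !mulr_ge0 ?exprn_ge0.
move=> n; have n0 : (0 : R) < n`!%:R by rewrite ltr0n fact_gt0.
have E1 : M (n + k) / n`!%:R <= mseq M n * B ^+ (k * (n + k)) * (2 ^+ (n + k) * k`!%:R).
  rewrite ler_pdivrMr// seqME -[leRHS]mulrA; apply: ler_pM => //.
  - exact: ltW (mseq_gt0 _).
  - exact: mseq_addn_le.
  - by rewrite -natrX -!natrM ler_nat; exact: fact_addn_le.
have E2 : mratio n ^+ k <= B ^+ (n * k).
  by rewrite exprM; apply: lerXn2r; rewrite ?nnegrE ?exprn_ge0// ltW// mratio_gt0.
apply: (@le_trans _ _ (mseq M n * B ^+ (k * (n + k)) * (2 ^+ (n + k) * k`!%:R) * B ^+ (n * k))).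
  apply: ler_pM E1 E2; last by rewrite exprn_ge0// ltW// mratio_gt0.
  by rewrite divr_ge0// seqME mulr_ge0// ltW// mseq_gt0.
rewrite le_eqVlt; apply/orP; left; apply/eqP.
have -> : B ^+ (k * (n + k)) = B ^+ (n * k) * B ^+ (k * k).
  by rewrite -exprD mulnDr (mulnC k n).
have -> : (2 * B ^+ (2 * k)) ^+ n = 2 ^+ n * (B ^+ (n * k) * B ^+ (n * k)).
  by rewrite exprMn -exprM -exprD; congr (_ * _ ^+ _); lia.
rewrite (exprD 2 n k).
move: (mseq M n) (B ^+ _) (B ^+ _) (2 ^+ n) (2 ^+ k) (k`!%:R) => a b c d e f; ring.
Qed.

Lemma moderate_growth_le : moderate_growth M -> exists2 H : R, 1 <= H &
  forall n k, M (n + k) <= H ^+ (n + k).+1 * (M n * M k).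
Proof.
have Mp n : 0 < M n by rewrite seqME mulr_gt0 ?mseq_gt0// ltr0n fact_gt0.
move=> [H0 HH]; exists (Num.max 1 H0); first by rewrite le_max lexx.
move=> n k; set p := (n + k)%N.
pose mn := \big[Num.min/M 0%N * M p]_(j < p.+1) (M j * M (p - j)%N).
have mn0 : 0 < mn.
  by apply: lt_bigmin => [|i _]; rewrite mulr_gt0.
have mnle : mn <= M n * M k.
  have np : (n < p.+1)%N by rewrite ltnS leq_addr.
  apply: le_trans (bigmin_le _ (Ordinal np) _) _.
  by rewrite /= /p addKn.
have := HH ((M p / mn) `^ (p.+1%:R^-1)); rewrite /= => H1.
have {}H1 : (M p / mn) `^ (p.+1%:R^-1) <= H0 by apply: H1; exists p.
have q0 : 0 < M p / mn by rewrite divr_gt0.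
have E : M p / mn = ((M p / mn) `^ (p.+1%:R^-1)) ^+ p.+1.
  by rewrite -powR_mulrn ?powR_ge0// -powRrM mulVf ?pnatr_eq0// powRr1// ltW.
have : M p / mn <= Num.max 1 H0 ^+ p.+1.
  rewrite E; apply: lerXn2r; rewrite ?nnegrE ?powR_ge0//.
    by rewrite le_max ler01.
  by rewrite le_max H1 orbT.
rewrite ler_pdivrMr// => E2; apply: (le_trans E2); apply: ler_wpM2l => //.
by rewrite exprn_ge0// le_max ler01.
Qed.

(** Write [u] for [mratio]. Monotonicity and moderate growth give [u_(2p)^(2p) <= m_(4p) / m_(2p) <=
    H^(4p+1) m_(2p)], while [m_(2p) <= u_p^p u_(2p)^p]. Cancelling [u_(2p)^p] and taking [p]-th
    roots leaves [H^5], as [4p + 1 <= 5p] for [p >= 1]. *)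
Lemma moderate_mratio_double : moderate_growth M -> exists2 D : R, 1 <= D &
  forall n, mratio (2 * n) <= D * mratio n.
Proof.
move=> /moderate_growth_le[H H1 HH]; exists (H ^+ 5); first exact: exprn_ege1.
have H0 : 0 <= H by exact: le_trans H1.
have r0 j : 0 <= mratio j := ltW (mratio_gt0 j).
have mp j := mseq_gt0 j.
case=> [|n]; first by rewrite muln0 ler_peMl// exprn_ege1.
set p := n.+1.
have M1 j : mseq M (j + j) <= H ^+ (j + j).+1 * (mseq M j * mseq M j).
  have j0 : (0 : R) < (j + j)`!%:R by rewrite ltr0n fact_gt0.
  rewrite /mseq ler_pdivrMr//; apply: (le_trans (HH j j)).
  rewrite -[leRHS]mulrA; apply: ler_wpM2l; first exact: exprn_ge0.
  rewrite !seqME -![mseq M j * _ / _]mulrA divff ?pnatr_eq0 -?lt0n ?fact_gt0// mulr1.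
  rewrite mulrACA; apply: ler_wpM2l; first by rewrite mulr_ge0// ltW.
  rewrite -natrM ler_nat -(@bin_fact (j + j) j) ?leq_addl// addnK leq_pmull//.
  by rewrite bin_gt0 leq_addl.
have e1 : mratio (2 * p) ^+ (2 * p) <= H ^+ (2 * p + 2 * p).+1 * mseq M (2 * p).
  have q1 : mratio (2 * p) <= mratio (2 * p) * 1 by rewrite mulr1.
  have := mseq_expn_ge ler01 (r0 _) (leq_addr (2 * p) (2 * p)) q1.
  rewrite !expr1n !mulr1 addKn => E.
  rewrite -(ler_pM2l (mp (2 * p)%N)); apply: (le_trans E); apply: (le_trans (M1 _)).
  by rewrite mulrCA.
have e2 : mseq M (2 * p) <= mratio p ^+ p * mratio (2 * p) ^+ p.
  have q1 : mratio (2 * p) * 1 <= mratio (2 * p) by rewrite mulr1.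
  have q2 : mratio p * 1 <= mratio p by rewrite mulr1.
  have pp : (p <= 2 * p)%N by rewrite mul2n -addnn leq_addr.
  have := mseq_expn_le ler01 pp q1.
  have := mseq_expn_le ler01 (leq0n p) q2.
  have [_ [-> _] _ _ _] := regM.
  rewrite !expr1n !mulr1 mul1r subn0 => E3 E4; apply: (le_trans E4).
  have -> : (2 * p - p = p)%N by rewrite mul2n -addnn addnK.
  by apply: ler_wpM2r E3; rewrite exprn_ge0.
have e3 : mratio (2 * p) ^+ p <= (H ^+ 5 * mratio p) ^+ p.
  have x0 : 0 < mratio (2 * p) ^+ p by rewrite exprn_gt0// mratio_gt0.
  rewrite -(ler_pM2r x0) -exprD addnn -mul2n; apply: (le_trans e1).
  rewrite exprMn -[leRHS]mulrA; apply: ler_pM => //; rewrite ?exprn_ge0//.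
    exact: ltW (mp _).
  rewrite -exprM; apply: ler_weXn2l => //.
  by rewrite /p; lia.
by rewrite -(@ler_pXn2r _ p)// nnegrE// mulr_ge0// exprn_ge0.
Qed.

(** Doubling the index costs a constant factor, so growth is polynomial, and any fixed power is
    dominated by [2^n]. *)
Lemma moderate_mratio_subexp k : moderate_growth M -> exists2 C : R, 0 <= C &
  forall n, mratio n ^+ k <= C * 2 ^+ n.
Proof.
move=> /moderate_mratio_double[D D1 HD].
have r0 j : 0 <= mratio j := ltW (mratio_gt0 j).
have D0 : 0 <= D by exact: le_trans D1.
(* [2^N0] absorbs the cost of one doubling for the [k]-th power. [N0 > 0] makes [n > 2 N0] at least
   2, so that halving strictly decreases [n]. *)
have [N0 N00 HN] : exists2 N0 : nat, (0 < N0)%N & D ^+ k <= 2 ^+ N0.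
  exists (Num.bound (D ^+ k)).+1 => //; apply: ltW.
  apply: (lt_le_trans (archi_boundP _)); first exact: exprn_ge0.
  by rewrite -natrX ler_nat; apply: ltnW; apply: ltnW; exact: ltn_expl.
pose w n := mratio n ^+ k.
have wn a b : (a <= b)%N -> w a <= w b.
  by move=> ab; apply: lerXn2r; rewrite ?nnegrE//; exact: mratio_nondec.
have w0 a : 0 <= w a by rewrite exprn_ge0.
have w2 a : w (2 * a)%N <= 2 ^+ N0 * w a.
  apply: (@le_trans _ _ ((D * mratio a) ^+ k)).
    by apply: lerXn2r; rewrite ?nnegrE// mulr_ge0.
  by rewrite exprMn; exact: (ler_wpM2r (w0 a) HN).
exists (w (2 * N0)%N) => // n; elim/ltn_ind: n => n IH.
have [nN|Nn] := leqP n (2 * N0).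
  apply: (le_trans (wn _ _ nN)); rewrite ler_peMr// exprn_ege1// ler1n//.
(* Rounding up gives [n <= 2 p], and [n > 2 N0] gives [N0 + p <= n], which closes the induction. *)
pose p := uphalf n.
have pn : (p < n)%N by rewrite /p; lia.
apply: (le_trans (wn n (2 * p)%N _)); first by rewrite /p; lia.
apply: (le_trans (w2 p)).
apply: (@le_trans _ _ (2 ^+ N0 * (w (2 * N0)%N * 2 ^+ p))).
  by apply: ler_wpM2l; [rewrite exprn_ge0|exact: IH].
rewrite mulrCA -exprD; apply: ler_wpM2l => //.
by apply: ler_weXn2l; [rewrite ler1n|rewrite /p; lia].
Qed.

(** The order of quantifiers is the gain over [finite_growth]: [Q] no longer depends on [k], only
    [K] does, so a single [A] serves all orders. *)
Lemma moderate_growth_bound : moderate_growth M -> exists2 Q : R, 1 <= Q &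
  forall k, exists2 K : R, 0 <= K &
  forall n, M (n + k) / n`!%:R * mratio n ^+ k <= K * Q ^+ n * mseq M n.
Proof.
move=> mg; have [H H1 HH] := moderate_growth_le mg.
have H0 : 0 <= H by exact: le_trans H1.
have Mp n : 0 <= M n by have [] := regM.
exists (2 * H); first by rewrite mulr_ege1// ler1n.
move=> k; have [C C0 HC] := moderate_mratio_subexp k mg.
exists (H ^+ k.+1 * M k * C); first by rewrite !mulr_ge0// exprn_ge0.
move=> n; have n0 : (0 : R) < n`!%:R by rewrite ltr0n fact_gt0.
apply: (@le_trans _ _ (H ^+ (n + k).+1 * (mseq M n * M k) * (C * 2 ^+ n))).
  apply: ler_pM (HC n).
  - by rewrite divr_ge0// ltW.
  - by rewrite exprn_ge0// ltW// mratio_gt0.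
  - rewrite ler_pdivrMr//; apply: (le_trans (HH n k)).
    rewrite -[leRHS]mulrA; apply: ler_wpM2l; first exact: exprn_ge0.
    by rewrite [X in X * _ <= _]seqME mulrAC.
rewrite -addnS exprD exprMn le_eqVlt; apply/orP; left; apply/eqP.
move: (mseq M n) (M k) (H ^+ _) (H ^+ _) (2 ^+ n) => a b c d e; ring.
Qed.

End RegularSequences.

(** * Bounds for the terms of the series *)

Section ComplexBounds.
Variables (R : realType) (V : normedModType R).
Implicit Types (D : set V) (f g : V -> R[i]) (a b r s : R).

Definition cCkbound k D f a r : Prop :=
  Ckbound k D (re_part f) a r /\ Ckbound k D (im_part f) a r.

Lemma Re_le_normc (c : R[i]) : `|complex.Re c| <= ComplexField.Normc.normc c.
Proof.
case: c => x y /=; rewrite -sqrtr_sqr ler_wsqrtr// lerDl; exact: sqr_ge0.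
Qed.

Lemma Im_le_normc (c : R[i]) : `|complex.Im c| <= ComplexField.Normc.normc c.
Proof.
case: c => x y /=; rewrite -sqrtr_sqr ler_wsqrtr// lerDr; exact: sqr_ge0.
Qed.

Lemma normc_ge0 (c : R[i]) : 0 <= ComplexField.Normc.normc c.
Proof. exact: le_trans (normr_ge0 _) (Re_le_normc c). Qed.

Lemma normc_le (c : R[i]) :
  ComplexField.Normc.normc c <= `|complex.Re c| + `|complex.Im c|.
Proof.
case: c => x y /=; rewrite -[leRHS]ger0_norm ?addr_ge0// -sqrtr_sqr ler_wsqrtr//.
rewrite sqrrD !real_normK ?num_real// addrAC lerDl.
by rewrite mulrn_wge0// mulr_ge0.
Qed.

Lemma normc_sum (I : Type) (l : seq I) (F : I -> R[i]) :
  ComplexField.Normc.normc (\sum_(i <- l) F i) <=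
  \sum_(i <- l) ComplexField.Normc.normc (F i).
Proof.
elim: l => [|i l IH]; first by rewrite !big_nil ComplexField.Normc.normc0.
rewrite !big_cons; apply: (le_trans (le_normcD _ _)); exact: lerD.
Qed.

Lemma normc_real (x : R) : ComplexField.Normc.normc x%:C = `|x|.
Proof. by rewrite /= expr0n /= addr0 sqrtr_sqr. Qed.

Lemma cCkbound_normc k D f a r x : cCkbound k D f a r -> D x ->
  ComplexField.Normc.normc (f x) <= 2 * a.
Proof.
move=> [f1 f2] Dx; apply: (le_trans (normc_le _)); rewrite mulr_natl mulr2n.
by apply: lerD; [exact: (Ckbound_ge f1)|exact: (Ckbound_ge f2)].
Qed.

Lemma cCkbound0 D f a r :
  (forall x, D x -> {for x, continuous (re_part f)}) ->
  (forall x, D x -> {for x, continuous (im_part f)}) ->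
  (forall x, D x -> ComplexField.Normc.normc (f x) <= a) -> cCkbound 0 D f a r.
Proof.
move=> c1 c2 fa; split=> x Dx; split; [exact: c1| |exact: c2|];
  apply: le_trans (fa x Dx); [exact: Re_le_normc|exact: Im_le_normc].
Qed.

Lemma cCkboundS k D f a r : (forall x, D x -> cdiff f x) ->
  (forall x, D x -> `|re_part f x| <= a /\ `|im_part f x| <= a) ->
  (forall v, `|v| <= 1 -> cCkbound k D (cderive v f) (a * r) r) ->
  cCkbound k.+1 D f a r.
Proof.
move=> df fa dk; split; split=> [x Dx|v v1].
- by have [? ?] := df x Dx; have [? ?] := fa x Dx.
- exact: (dk v v1).1.
- by have [? ?] := df x Dx; have [? ?] := fa x Dx.
- exact: (dk v v1).2.
Qed.

Lemma cCkbound_derive k D f a r v : cCkbound k.+1 D f a r -> `|v| <= 1 ->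
  cCkbound k D (cderive v f) (a * r) r.
Proof. by move=> [[_ f1] [_ f2]] v1; split; [exact: f1|exact: f2]. Qed.

Lemma cCkbound_ext k D f g a r : open D -> (forall x, D x -> f x = g x) ->
  cCkbound k D f a r -> cCkbound k D g a r.
Proof.
move=> oD fg [f1 f2]; split; [apply: Ckbound_ext f1|apply: Ckbound_ext f2] => // x Dx;
  by rewrite /re_part /im_part fg.
Qed.

Lemma cCkbound_le k D f a r b s : 0 <= r -> 0 <= b -> a <= b -> r <= s ->
  cCkbound k D f a r -> cCkbound k D f b s.
Proof. by move=> r0 b0 ab rs [f1 f2]; split; [apply: Ckbound_le f1|apply: Ckbound_le f2]. Qed.

Lemma cCkbound_sub k D D' f a r : D' `<=` D -> cCkbound k D f a r ->
  cCkbound k D' f a r.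
Proof. by move=> DD [f1 f2]; split; exact: Ckbound_sub DD _. Qed.

Lemma cCkbound_union k D D' f a r : cCkbound k D f a r -> cCkbound k D' f a r ->
  cCkbound k (D `|` D') f a r.
Proof. by move=> [f1 f2] [g1 g2]; split; exact: Ckbound_union. Qed.

Lemma cCkbound_zero k D a r : 0 <= a -> 0 <= r -> cCkbound k D (fun _ => 0) a r.
Proof. by move=> a0 r0; split; apply: Ckbound_cst => //=; rewrite normr0. Qed.

Lemma cCkbound_sum k D (I : finType) (f : I -> V -> R[i]) a r :
  open D -> 0 <= r -> (forall i, cCkbound k D (f i) a r) ->
  cCkbound k D (fun x => \sum_i f i x) (#|I|%:R * a) r.
Proof.
move=> oD r0 fk.
have -> : #|I|%:R * a = \sum_(i : I) a by rewrite sumr_const mulr_natl.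
split.
  apply: (Ckbound_ext oD _ (Ckbound_sum (index_enum I) oD r0 (fun i => (fk i).1))).
  by move=> x _; rewrite /re_part raddf_sum.
apply: (Ckbound_ext oD _ (Ckbound_sum (index_enum I) oD r0 (fun i => (fk i).2))).
by move=> x _; rewrite /im_part raddf_sum.
Qed.

(** The real and the imaginary part of a product are each made of two real products, whence the
    factor 2. *)
Lemma cCkbound_mul k D f g a b r s : open D -> 0 <= r -> 0 <= s -> 0 <= a ->
  0 <= b -> cCkbound k D f a r -> cCkbound k D g b s ->
  cCkbound k D (fun x => f x * g x) (2 * (a * b)) (r + s).
Proof.
move=> oD r0 s0 a0 b0 [f1 f2] [g1 g2].
have neg (h : V -> R) c t : 0 <= t -> 0 <= c -> Ckbound k D h c t ->
    Ckbound k D (fun x => - h x) c t.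
  move=> t0 c0 hk; have n1 : `|-1 : R| <= 1 by rewrite normrN1.
  have := Ckbound_mul oD (lexx 0) t0 ler01 c0 (Ckbound_cst k D (lexx 0) n1) hk.
  by rewrite mul1r add0r; apply: Ckbound_ext => // x _; rewrite mulN1r.
have rs0 : 0 <= r + s by rewrite addr_ge0.
have ab0 : 0 <= a * b by rewrite mulr_ge0.
rewrite mulr_natl mulr2n; split; rewrite ?re_partM ?im_partM; apply: Ckbound_add => //.
- exact: Ckbound_mul.
- by apply: neg => //; exact: Ckbound_mul.
- exact: Ckbound_mul.
- exact: Ckbound_mul.
Qed.

Lemma cCkbound_scale k D (c : R) f a r : open D -> 0 <= r -> 0 <= a ->
  cCkbound k D f a r -> cCkbound k D (fun x => c%:C * f x) (`|c| * a) r.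
Proof.
move=> oD r0 a0 [f1 f2].
have H (h : V -> R) : Ckbound k D h a r -> Ckbound k D (fun x => c * h x) (`|c| * a) r.
  move=> hk; have := Ckbound_mul oD (lexx 0) r0 (normr_ge0 c) a0
    (Ckbound_cst k D (lexx 0) (lexx _)) hk.
  by rewrite add0r.
split; [apply: (Ckbound_ext oD _ (H _ f1))|apply: (Ckbound_ext oD _ (H _ f2))] => x _;
  rewrite /re_part /im_part; case: (f x) => p q /=; ring.
Qed.

Lemma cCkbound_real k D (f : V -> R) a r : 0 <= a -> 0 <= r ->
  Ckbound k D f a r -> cCkbound k D (fun x => (f x)%:C) a r.
Proof. by move=> a0 r0 fk; split=> //; apply: Ckbound_cst; rewrite ?normr0. Qed.

(** On the smaller set only the values become smaller; the bounds on derivatives are retained by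
    trading amplitude against rate, as [a * r <= b * s] allows. *)
Lemma cCkbound_shrink k D D' f a r b s : D' `<=` D -> 0 <= r -> 0 <= b ->
  (forall x, D' x -> `|re_part f x| <= b /\ `|im_part f x| <= b) ->
  a * r <= b * s -> r <= s -> cCkbound k D f a r -> cCkbound k D' f b s.
Proof.
move=> DD r0 b0 fb ab rs; case: k => [|k] [f1 f2].
  split=> x Dx; have [? ?] := fb x Dx; split=> //.
    by have [] := f1 x (DD x Dx).
  by have [] := f2 x (DD x Dx).
have bs0 : 0 <= b * s by rewrite mulr_ge0// (le_trans r0).
split; split=> [x Dx|v v1].
- have [? ?] := fb x Dx; split=> //; by have [] := f1.1 x (DD x Dx).
- by apply: Ckbound_le (Ckbound_sub DD (f1.2 v v1)).
- have [? ?] := fb x Dx; split=> //; by have [] := f2.1 x (DD x Dx).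
- by apply: Ckbound_le (Ckbound_sub DD (f2.2 v v1)).
Qed.

End ComplexBounds.

Section ComplexSpaceFrame.
Variables (R : realType) (m : nat).
Notation CV := (Cspace R m).

Definition cframe (i : 'I_m + 'I_m) : CV :=
  match i with inl j => (delta_mx 0 j, 0) | inr j => (0, delta_mx 0 j) end.

Definition ccoef (i : 'I_m + 'I_m) (v : CV) : R :=
  match i with inl j => v.1 0 j | inr j => v.2 0 j end.

Lemma coord_le_norm (x : 'rV[R]_m) j : `|x 0 j| <= `|x|.
Proof.
rewrite [`|x|]mx_normrE; apply: (le_bigmax _ (fun i : 'I_1 * 'I_m => `|x i.1 i.2|) (0, j)).
Qed.

Lemma ccoef_le i v : `|ccoef i v| <= `|v|.
Proof.
case: i => j /=; apply: (le_trans (coord_le_norm _ _));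
  rewrite prod_normE le_max lexx ?orbT//.
Qed.

Lemma cframeE (v : CV) : v = \sum_i ccoef i v *: cframe i.
Proof.
have E (z w : CV) : z.1 = w.1 -> z.2 = w.2 -> z = w.
  by case: z => a b; case: w => c d /= -> ->.
have z0 (c : 'I_m -> R) : \sum_(i < m) c i *: (0 : 'rV[R]_m) = 0.
  by rewrite big1// => i _; rewrite scaler0.
apply: E; rewrite raddf_sum big_sumType /= z0 ?addr0 ?add0r; exact: row_sum_delta.
Qed.

Lemma cCk_cCkbound k (K O D : set CV) (f : CV -> R[i]) :
  compact K -> K `<=` O -> open O -> open D -> D `<=` K -> cCk k O f ->
  exists a r, [/\ 0 <= a, 0 <= r & cCkbound k D f a r].
Proof.
move=> cK KO oO oD DK [f1 f2].
have [a1 [r1 [a10 r10 H1]]] := Ck_Ckbound cframeE ccoef_le cK KO oO oD DK f1.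
have [a2 [r2 [a20 r20 H2]]] := Ck_Ckbound cframeE ccoef_le cK KO oO oD DK f2.
exists (a1 + a2), (r1 + r2); split; rewrite ?addr_ge0//.
split; [apply: Ckbound_le H1|apply: Ckbound_le H2];
  by rewrite ?addr_ge0// ?lerDl ?lerDr.
Qed.

End ComplexSpaceFrame.

Lemma open_setI_lt (R : realType) (V : normedModType R) (D : set V) (N : V -> R)
    (c : R) : open D -> (forall x, D x -> {for x, continuous N}) ->
  open (D `&` [set x | N x < c]).
Proof.
move=> oD cN; rewrite openE => x [Dx Nx]; apply: filterI.
  exact: open_nbhs_nbhs.
have /cvgr_lt := cN x Dx; exact.
Qed.

Lemma open_setI_gt (R : realType) (V : normedModType R) (D : set V) (N : V -> R)
    (c : R) : open D -> (forall x, D x -> {for x, continuous N}) ->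
  open (D `&` [set x | c < N x]).
Proof.
move=> oD cN; rewrite openE => x [Dx Nx]; apply: filterI.
  exact: open_nbhs_nbhs.
have /cvgr_gt := cN x Dx; exact.
Qed.

Lemma finite_cCkbound (R : realType) (V : normedModType R) (I : finType) k
    (D : set V) (f : I -> V -> R[i]) :
  (forall i, exists a r, [/\ 0 <= a, 0 <= r & cCkbound k D (f i) a r]) ->
  exists a r, [/\ 0 <= a, 0 <= r & forall i, cCkbound k D (f i) a r].
Proof.
move=> H; have /choice[ar Har] i : exists p : R * R,
    [/\ 0 <= p.1, 0 <= p.2 & cCkbound k D (f i) p.1 p.2].
  by have [a [r h]] := H i; exists (a, r).
exists (\sum_i (ar i).1), (\sum_i (ar i).2); split.
- by apply: sumr_ge0 => i _; have [] := Har i.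
- by apply: sumr_ge0 => i _; have [] := Har i.
move=> i; have [a0 r0 h] := Har i; apply: cCkbound_le h => //.
- by apply: sumr_ge0 => j _; have [] := Har j.
- by rewrite (bigD1 i)//= lerDl sumr_ge0// => j _; have [] := Har j.
- by rewrite (bigD1 i)//= lerDl sumr_ge0// => j _; have [] := Har j.
Qed.

(** * Derivatives of words, Taylor terms and cutoffs *)

Section TermBounds.
Variables (R : realType) (m : nat) (phi : 'rV[R]_m -> 'rV[R]_m).
Variables (U : set 'rV[R]_m) (M : nat -> R) (f : 'rV[R]_m -> R[i]).
Notation CV := (Cspace R m).
Notation W := [set z : CV | U z.1].
Variables (D : set CV) (C : R).
Hypothesis oU : open U.
Hypothesis phiC : Cinfty U phi.
Hypothesis ZjacU : forall x, U x -> Zjac phi x \in unitmx.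
Hypothesis regM : regular_sequence M.
Hypothesis fC : cCinfty U f.
Hypothesis oD : open D.
Hypothesis DW : D `<=` W.
(** This stands for the relative compactness of [D] in [W]. *)
Hypothesis D_bound : forall k (g : CV -> R[i]), cCk k W g ->
  exists a r, [/\ 0 <= a, 0 <= r & cCkbound k D g a r].
Hypothesis C1 : 1 <= C.
Hypothesis word_le : forall w z, D z ->
  ComplexField.Normc.normc (Xword phi w f z.1) <= C ^+ (size w).+1 * M (size w).

Let M_ge0 n : 0 <= M n.
Proof. by have [] := regM. Qed.

Definition word_size (n : nat) : R := C ^+ n.+1 * M n.

Let word_size_ge0 n : 0 <= word_size n.
Proof. by rewrite mulr_ge0// exprn_ge0// (le_trans ler01). Qed.

Lemma word_size_nondec n k : (n <= k)%N -> word_size n <= word_size k.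
Proof.
move=> nk; apply: ler_pM => //.
- by rewrite exprn_ge0// (le_trans ler01).
- exact: ler_weXn2l.
- exact: seqM_nondec.
Qed.

(** By [cderive_Xfield] a derivative lengthens the word by one letter, with coefficients bounded on
    [D]. The rate does not depend on the word; only the amplitude does. *)
Lemma word_bound k : exists2 r : R, 0 <= r & forall w,
  cCkbound k D (fun z => Xword phi w f z.1) (word_size (size w + k)) r.
Proof.
have oW := open_fst oU.
elim: k => [|k [r r0 Hr]].
  exists 0 => // w; rewrite addn0.
  have [h1 h2] := cCk_fst oU (Xword_Cinfty oU phiC ZjacU w fC 0).
  by apply: cCkbound0 => [z Dz|z Dz|z Dz]; [apply: h1; exact: DW|
    apply: h2; exact: DW|exact: word_le].
have [a0 [r0' [a00 r00 Ha]]] := @finite_cCkbound R CV 'I_m k.+1 D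
  (fun j z => Zcoord phi j z.1)
  (fun j => D_bound (cCk_fst oU (Zcoord_Cinfty oU phiC j k.+1))).
(* The last summand lets amplitude times rate dominate the sum over the [m] fields; the other two
   are the rates of its factors. *)
exists (r0' + r + m%:R * (2 * (a0 * r0'))).
  by rewrite !addr_ge0// !mulr_ge0.
move=> w.
have wC := Xword_Cinfty oU phiC ZjacU w fC.
have dw z : D z -> cdiff (Xword phi w f) z.1.
  by move=> Dz; exact: (cCk_cdiff (D := U) (DW Dz) (wC 1%N)).
have dZ j z : D z -> cdiff (Zcoord phi j) z.1.
  by move=> Dz; exact: (cCk_cdiff (D := U) (DW Dz) (Zcoord_Cinfty oU phiC j 1)).
apply: cCkboundS => [z Dz|z Dz|v v1].
- exact: (cdiff_fst 0 (dw z Dz)).1.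
- have H := word_le w Dz.
  have H' : word_size (size w) <= word_size (size w + k.+1).
    by apply: word_size_nondec; rewrite leq_addr.
  by split; apply: le_trans H'; apply: le_trans H;
    [exact: Re_le_normc|exact: Im_le_normc].
have ws0 := word_size_ge0 (size w + k.+1).
have S j : cCkbound k D (fun z => cderive v (fun z => Zcoord phi j z.1) z
      * Xword phi (j :: w) f z.1) (2 * (a0 * r0' * word_size (size w + k.+1)))
      (r0' + r).
  apply: cCkbound_mul => //; first exact: mulr_ge0.
    exact: cCkbound_derive (Ha j) v1.
  by have := Hr (j :: w); rewrite /= addSnnS.
have rr0 : 0 <= r0' + r by rewrite addr_ge0.
apply: (@cCkbound_ext _ _ _ _ (fun z => \sum_j cderive v (fun z => Zcoord phi j z.1) z
      * Xword phi (j :: w) f z.1)) => //.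
  move=> z Dz; rewrite (cdiff_fst v (dw z Dz)).2.
  rewrite (cderive_Xfield oU phiC ZjacU v.1 (DW Dz) (dw z Dz)).
  by apply: eq_bigr => j _; rewrite (cdiff_fst v (dZ j z Dz)).2.
apply: cCkbound_le (cCkbound_sum oD rr0 S) => //.
- by rewrite mulr_ge0// !addr_ge0// !mulr_ge0.
- rewrite card_ord [leRHS]mulrDr.
  apply: (@le_trans _ _ (word_size (size w + k.+1) * (m%:R * (2 * (a0 * r0'))))).
    rewrite le_eqVlt; apply/orP; left; apply/eqP; ring.
  by rewrite lerDr mulr_ge0.
- by rewrite lerDl !mulr_ge0.
Qed.

(** The Euclidean [|t|^2] is polynomial in [t = y - phi x], hence smooth in [z], as the cutoffs
    require. *)
Definition tnorm2 (z : CV) : R := \sum_j (im_part (Zdiff phi j) z) ^+ 2.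

Lemma re_Zdiff j z : re_part (Zdiff phi j) z = 0.
Proof. by rewrite /re_part /Zdiff /Zcoord /ccoord /= subrr. Qed.

Lemma tnorm2_ge0 z : 0 <= tnorm2 z.
Proof. by apply: sumr_ge0 => j _; exact: sqr_ge0. Qed.

Lemma im_Zdiff_le j z : (im_part (Zdiff phi j) z) ^+ 2 <= tnorm2 z.
Proof.
by rewrite /tnorm2 (bigD1 j)//= lerDl sumr_ge0// => i _; exact: sqr_ge0.
Qed.

Lemma tnorm2_continuous z : D z -> {for z, continuous tnorm2}.
Proof.
move=> Dz; have oW := open_fst oU.
suff : Ck 0 W tnorm2 by apply; exact: DW.
apply: Ck_sum => // j; have [_ h] := Zdiff_Cinfty oU phiC j 0.
by apply: (Ck_ext oW _ (Ck_mul oW h h)) => y _; rewrite expr2.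
Qed.

(** For [r > 0] the near and far parts are open, overlap and cover [D]; on the far part the cutoff
    of radius [r] vanishes identically. *)
Definition near_part (r : R) : set CV := D `&` [set z | tnorm2 z < 4 * r ^+ 2].
Definition far_part (r : R) : set CV := D `&` [set z | r ^+ 2 < tnorm2 z].

Lemma open_near_part r : open (near_part r).
Proof. exact: open_setI_lt tnorm2_continuous. Qed.

Lemma open_far_part r : open (far_part r).
Proof. exact: open_setI_gt tnorm2_continuous. Qed.

(** Values are at most [2 r] near [Sigma], first derivatives merely bounded: amplitude [2 r] and
    rate [L / r] express both, with [L] independent of [r]. *)
Lemma Zdiff_bound k : exists2 L : R, 0 <= L & forall r : R, 0 < r -> r <= 1 ->
  forall j, cCkbound k (near_part r) (Zdiff phi j) (2 * r) (L / r).
Proof.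
have [a0 [r0 [a00 r00 Ha]]] := @finite_cCkbound R CV 'I_m k D (Zdiff phi)
  (fun j => D_bound (Zdiff_Cinfty oU phiC j k)).
exists (a0 * r0 + r0); first by rewrite addr_ge0// mulr_ge0.
move=> r rp r1 j; have r2 : 0 <= 2 * r by rewrite mulr_ge0// ltW.
apply: (@cCkbound_shrink _ _ k D (near_part r) _ a0 r0) => //.
- by move=> z [].
- move=> z [Dz Nz]; rewrite re_Zdiff normr0; split=> //.
  rewrite -(@ler_pXn2r _ 2)// ?nnegrE// real_normK ?num_real//.
  apply: (le_trans (im_Zdiff_le j z)); apply: ltW; move: Nz => /=.
  by rewrite exprMn -natrX.
- have -> : 2 * r * ((a0 * r0 + r0) / r) = 2 * (a0 * r0 + r0).
    by field; rewrite gt_eqF.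
  have := mulr_ge0 a00 r00; move: (a0 * r0) => p p0; lra.
- rewrite ler_pdivlMr//; apply: (@le_trans _ _ r0); first by rewrite ler_piMr.
  by rewrite lerDr mulr_ge0.
Qed.

(** Each of the [n] levels contributes [m] summands, a factor [2 r] from [Zdiff] and a factor 2 from
    complex multiplication, whence [4 m r]. The [n] rates [L / r] add up. *)
Lemma taylor_bound k : exists r0 L : R, [/\ 0 <= r0, 0 <= L &
  forall r : R, 0 < r -> r <= 1 -> forall n w,
  cCkbound k (near_part r) (taylor phi n (Xword phi w f))
    ((4 * m%:R * r) ^+ n / n`!%:R * word_size (n + size w + k))
    (r0 + n%:R * (L / r))].
Proof.
have [r0 r00 Hw] := word_bound k; have [L L0 HL] := Zdiff_bound k.
exists r0, L; split=> // r rp r1; elim=> [|n IH] w.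
  rewrite expr0 fact0 divr1 mul1r mul0r addr0 add0n.
  by apply: cCkbound_sub (Hw w) => z [].
have oN := @open_near_part r.
pose a := (4 * m%:R * r) ^+ n / n`!%:R * word_size (n.+1 + size w + k).
have Lr : 0 <= L / r by rewrite divr_ge0// ltW.
have a0 : 0 <= a.
  by rewrite mulr_ge0// divr_ge0// exprn_ge0// !mulr_ge0// ltW.
have s0 : 0 <= r0 + n%:R * (L / r) by rewrite addr_ge0// mulr_ge0.
have Hj j : cCkbound k (near_part r) (fun z => Zdiff phi j z *
     taylor phi n (Xword phi (j :: w) f) z) (2 * (2 * r * a))
     (L / r + (r0 + n%:R * (L / r))).
  apply: cCkbound_mul => //; first by rewrite mulr_ge0// ltW.
    exact: HL.
  by have := IH (j :: w); rewrite /= -addSnnS.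
have ss0 : 0 <= L / r + (r0 + n%:R * (L / r)) by rewrite addr_ge0.
have b0 : 0 <= #|'I_m|%:R * (2 * (2 * r * a)).
  do 2 (apply: mulr_ge0; first by []); apply: mulr_ge0 => //.
  by rewrite mulr_ge0// ltW.
have := cCkbound_scale (n.+1%:R^-1) oN ss0 b0 (cCkbound_sum oN ss0 Hj).
have -> : `|n.+1%:R^-1| * (#|'I_m|%:R * (2 * (2 * r * a))) =
    (4 * m%:R * r) ^+ n.+1 / (n.+1)`!%:R * word_size (n.+1 + size w + k).
  rewrite ger0_norm ?invr_ge0// card_ord /a factS natrM invfM exprS.
  move: (word_size _) (n.+1%:R^-1) ((n`!%:R)^-1) ((4 * m%:R * r) ^+ n) => c1 c2 c3 c4.
  ring.
have -> : L / r + (r0 + n%:R * (L / r)) = r0 + n.+1%:R * (L / r).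
  by rewrite addrCA -natr1 mulrDl mul1r [L / r + _]addrC.
apply: cCkbound_ext => // z _ /=; congr (_ * _).
by rewrite /= fmorphV rmorph_nat.
Qed.

Definition chi (r : R) (z : CV) : R := cutoff (tnorm2 z / r ^+ 2).

(** At scale [r], the function [|t|^2 / r^2] has bounded values and rate of order [1 / r].
    Composition preserves this, so [K] and [c] are uniform in [r]. *)
Lemma chi_bound k : exists K c : R, [/\ 0 <= K, 0 <= c &
  forall r : R, 0 < r -> r <= 1 -> Ckbound k (near_part r) (chi r) K (c / r)].
Proof.
have [L L0 HL] := Zdiff_bound k.+1.
have [K [q [K0 q0 HK]]] := cutoff_Ckbound R k.
exists K, (k%:R * (2 * L + q * (m%:R * (4 * (2 * L))))); split=> //.
  by rewrite mulr_ge0// addr_ge0 ?mulr_ge0// !mulr_ge0.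
move=> r rp r1; have oN := @open_near_part r.
pose s := L / r + L / r.
have Lr : 0 <= L / r by rewrite divr_ge0// ltW.
have s0 : 0 <= s by rewrite addr_ge0.
have r20 : 0 <= 2 * r by rewrite mulr_ge0// ltW.
have Hj j : Ckbound k.+1 (near_part r) (fun z => im_part (Zdiff phi j) z
    * im_part (Zdiff phi j) z) (2 * r * (2 * r)) s.
  by apply: Ckbound_mul => //; exact: (HL r rp r1 j).2.
have HS := Ckbound_sum (index_enum 'I_m) oN s0 Hj.
have sum0 : 0 <= \sum_(j < m) (2 * r * (2 * r)).
  by apply: sumr_ge0 => j _; exact: mulr_ge0.
have Hc := Ckbound_mul oN (lexx 0) s0 (normr_ge0 (r ^- 2)) sum0
  (Ckbound_cst k.+1 (near_part r) (lexx 0) (lexx `|r ^- 2|)) HS.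
have bE : `|r ^- 2| * \sum_(j < m) (2 * r * (2 * r)) = 4 * m%:R.
  rewrite sumr_const card_ord -mulr_natl ger0_norm ?invr_ge0 ?sqr_ge0//.
  by field; rewrite gt_eqF.
rewrite bE add0r in Hc.
have HN : Ckbound k.+1 (near_part r) (fun z => tnorm2 z / r ^+ 2) (4 * m%:R) s.
  apply: Ckbound_ext Hc => // z _.
  exact: (mulrC (r ^- 2) (tnorm2 z)).
have -> : k%:R * (2 * L + q * (m%:R * (4 * (2 * L)))) / r =
    k%:R * (s + q * (4 * m%:R * s)).
  by rewrite /s; field; rewrite gt_eqF.
have -> : chi r = @cutoff R \o (fun z => tnorm2 z / r ^+ 2) by [].
apply: (@Ckbound_comp R CV k (near_part r) [set x : R | -1 < x < 5] (@cutoff R)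
  (fun z => tnorm2 z / r ^+ 2) K q (4 * m%:R * s) s) => //.
- by rewrite !mulr_ge0.
- move=> z [Dz /= Nz]; rewrite (lt_le_trans (ltrN10 _)) ?divr_ge0 ?tnorm2_ge0 ?sqr_ge0//=.
  by rewrite ltr_pdivrMr ?exprn_gt0// (lt_trans Nz)// ltr_pM2r ?exprn_gt0// ltr_nat.
- by move=> z Nz; have [] := HN.1 z Nz.
- exact: HN.2.
Qed.

Definition term (r : R) n (z : CV) : R[i] := (chi r z)%:C * taylor phi n f z.

Lemma term_bound k : exists K c : R, [/\ 0 <= K, 1 <= c &
  forall r : R, 0 < r -> r <= 1 -> forall n,
  cCkbound k D (term r n)
    (K * ((4 * m%:R * r) ^+ n / n`!%:R * word_size (n + k))) (c * n.+1%:R / r)].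
Proof.
have [K [c [K0 c0 HK]]] := chi_bound k.
have [r0 [L [r00 L0 HT]]] := taylor_bound k.
(* The summand 1 keeps the rates at least 1, as the series lemmas demand. *)
exists (2 * K), (c + r0 + L + 1); split.
- exact: mulr_ge0.
- by rewrite lerDr !addr_ge0.
move=> r rp r1 n; have rp0 := ltW rp.
pose a := (4 * m%:R * r) ^+ n / n`!%:R * word_size (n + k).
have a0 : 0 <= a by rewrite mulr_ge0// divr_ge0// exprn_ge0// !mulr_ge0.
have s0 : 0 <= (c + r0 + L + 1) * n.+1%:R / r.
  by rewrite divr_ge0// mulr_ge0// !addr_ge0.
have c1 : 0 <= c / r by rewrite divr_ge0.
have s1 : 0 <= r0 + n%:R * (L / r).
  by rewrite addr_ge0// mulr_ge0// divr_ge0.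
have ka0 : 0 <= 2 * K * a by apply: mulr_ge0 => //; exact: mulr_ge0.
have H1 : cCkbound k (near_part r) (term r n) (2 * K * a)
    ((c + r0 + L + 1) * n.+1%:R / r).
  have T := HT r rp r1 n [::]; rewrite addn0 in T.
  have X := cCkbound_real K0 c1 (HK r rp r1).
  have := cCkbound_mul (@open_near_part r) c1 s1 K0 a0 X T.
  rewrite mulrA; apply: cCkbound_le => //; first by rewrite addr_ge0.
  have n1 : (1 : R) <= n.+1%:R by rewrite ler1n.
  have nn : (n%:R : R) <= n.+1%:R by rewrite ler_nat.
  have n0 : (0 : R) <= n.+1%:R by [].
  rewrite !mulrDl mul1r.
  apply: (@le_trans _ _ (c * n.+1%:R / r + r0 * n.+1%:R / r + L * n.+1%:R / r)); last first.
    by rewrite lerDl divr_ge0.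
  rewrite -addrA; apply: lerD; last apply: lerD.
  - by apply: ler_wpM2r; rewrite ?invr_ge0// ler_peMr.
  - rewrite ler_pdivlMr//; apply: (@le_trans _ _ r0); first by rewrite ler_piMr.
    by rewrite ler_peMr.
  - rewrite mulrA; apply: ler_wpM2r; rewrite ?invr_ge0// mulrC.
    exact: ler_wpM2l.
have H2 : cCkbound k (far_part r) (term r n) (2 * K * a)
    ((c + r0 + L + 1) * n.+1%:R / r).
  apply: cCkbound_ext (cCkbound_zero k _ ka0 s0); first exact: open_far_part.
  move=> z [Dz /= Nz]; rewrite /term /chi cutoff_eq0 ?mul0r//.
  by rewrite ler_pdivlMr ?exprn_gt0// mul1r ltW.
apply: cCkbound_sub (cCkbound_union H1 H2) => z Dz.
have [Nz|Nz] := ltP (tnorm2 z) (4 * r ^+ 2); [by left|right; split=> //=].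
apply: lt_le_trans Nz; rewrite ltr_pMl ?exprn_gt0//.
by rewrite ltr1n.
Qed.

End TermBounds.

(** * The extension *)

Section ComplexLimits.
Variable R : realType.
Implicit Types (S T : nat -> R[i]) (l c : R[i]).

Definition ccvg S l : Prop :=
  ((fun n => complex.Re (S n)) @ \oo --> complex.Re l) /\
  ((fun n => complex.Im (S n)) @ \oo --> complex.Im l).

Lemma ccvgD S T l c : ccvg S l -> ccvg T c -> ccvg (fun n => S n + T n) (l + c).
Proof.
have ReD (a b : R[i]) : complex.Re (a + b) = complex.Re a + complex.Re b.
  by case: a; case: b.
have ImD (a b : R[i]) : complex.Im (a + b) = complex.Im a + complex.Im b.
  by case: a; case: b.
move=> [s1 s2] [t1 t2]; split; rewrite ?ReD ?ImD.
  by under eq_fun do rewrite ReD; exact: cvgD.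
by under eq_fun do rewrite ImD; exact: cvgD.
Qed.

Lemma ccvgM S l c : ccvg S l -> ccvg (fun n => c * S n) (c * l).
Proof.
have cM (a : R) (u : nat -> R) (x : R) : u @ \oo --> x ->
    (fun n => a * u n) @ \oo --> a * x.
  by move=> ux; apply: cvgM => //; exact: cvg_cst.
move=> [s1 s2]; split; rewrite ?ReM ?ImM.
  by under eq_fun do rewrite ReM; apply: cvgB; exact: cM.
by under eq_fun do rewrite ImM; apply: cvgD; exact: cM.
Qed.

(** The bound passes to the limit on the real and imaginary parts separately, at the price of the
    factor 2. *)
Lemma ccvg_normc_le S l (b : R) (e : nat -> R) : ccvg S l -> e @ \oo --> (0 : R) ->
  (forall n, ComplexField.Normc.normc (S n) <= b + e n) ->
  ComplexField.Normc.normc l <= 2 * b.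
Proof.
move=> [s1 s2] e0 H.
have L (u : nat -> R) x : u @ \oo --> x ->
    (forall n, `|u n| <= b + e n) -> `|x| <= b.
  move=> ux ub.
  have c : (fun n => `|u n| - e n) @ \oo --> `|x| - 0.
    by apply: cvgB => //; exact: cvg_norm.
  rewrite -[`|x|]subr0; apply: (cvgr_to_le c); near=> n.
  by rewrite lerBlDr; exact: ub.
apply: (le_trans (normc_le _)); rewrite mulr_natl mulr2n; apply: lerD.
  by apply: (L _ _ s1) => n; apply: le_trans (H n); exact: Re_le_normc.
by apply: (L _ _ s2) => n; apply: le_trans (H n); exact: Im_le_normc.
Unshelve. all: by end_near. Qed.

End ComplexLimits.

Lemma sum_half_le (R : realFieldType) N : \sum_(0 <= n < N) (2^-1 : R) ^+ n <= 2.
Proof.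
have -> : \sum_(0 <= n < N) (2^-1 : R) ^+ n = 2 - 2 * 2^-1 ^+ N.
  elim: N => [|N IH]; first by rewrite big_geq// expr0; ring.
  by rewrite big_nat_recr//= IH exprS; field.
by rewrite gerBl mulr_ge0// exprn_ge0// invr_ge0.
Qed.

Lemma cvg_geometric0 (R : realType) (a : R) :
  (fun n : nat => a * 2^-1 ^+ n) @ \oo --> (0 : R).
Proof.
apply: cvg_geometric; rewrite ger0_norm ?invr_ge0//.
by rewrite invf_lt1// ltr1n.
Qed.

Lemma is_cvg_half_series (R : realType) (a : R) :
  cvgn (series (fun n : nat => a * 2^-1 ^+ n)).
Proof.
apply: is_cvg_geometric_series; rewrite ger0_norm ?invr_ge0//.
by rewrite invf_lt1// ltr1n.
Qed.

Lemma abel_summation_step (T : comNzRingType) (s y x x' h p : T) :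
  s + x * p + (y + x * (h - p)) = s + (y + (x - x') * h) + x' * h.
Proof. by ring. Qed.

(** * The truncated series and its summation by parts *)

Section Extension.
Variables (R : realType) (m : nat) (phi : 'rV[R]_m -> 'rV[R]_m).
Variables (U : set 'rV[R]_m) (M : nat -> R) (f : 'rV[R]_m -> R[i]).
Notation CV := (Cspace R m).
Notation W := [set z : CV | U z.1].
Notation normc := ComplexField.Normc.normc.
Variables (D : set CV) (C B A : R).
Hypothesis oU : open U.
Hypothesis phiC : Cinfty U phi.
Hypothesis ZjacU : forall x, U x -> Zjac phi x \in unitmx.
Hypothesis regM : regular_sequence M.
Hypothesis fC : cCinfty U f.
Hypothesis oD : open D.
Hypothesis DW : D `<=` W.
Hypothesis D_bound : forall k (g : CV -> R[i]), cCk k W g ->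
  exists a r, [/\ 0 <= a, 0 <= r & cCkbound k D g a r].
Hypothesis C1 : 1 <= C.
Hypothesis word_le : forall w z, D z ->
  normc (Xword phi w f z.1) <= C ^+ (size w).+1 * M (size w).
Hypothesis B1 : 1 <= B.
Hypothesis mratio_le : forall n, mratio M n <= B ^+ n.
Hypothesis A1 : 1 <= A.
Hypothesis A_large : 4 * m%:R * C * B ^+ 2 <= A.

Let M_ge0 n : 0 <= M n.
Proof. by have [] := regM. Qed.

Let C0 : 0 <= C. Proof. exact: le_trans C1. Qed.
Let B0 : 0 <= B. Proof. exact: le_trans B1. Qed.
Let A0 : 0 < A. Proof. exact: lt_le_trans A1. Qed.

Definition radius n : R := (A * mratio M n)^-1.

Lemma Amratio_ge1 n : 1 <= A * mratio M n.
Proof. by rewrite mulr_ege1// mratio_ge1. Qed.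

Lemma radius_gt0 n : 0 < radius n.
Proof. by rewrite invr_gt0 (lt_le_trans _ (Amratio_ge1 n)). Qed.

Lemma radius_le1 n : radius n <= 1.
Proof. by rewrite invf_le1 ?Amratio_ge1// (lt_le_trans _ (Amratio_ge1 n)). Qed.

Lemma radius_nonincr n : radius n.+1 <= radius n.
Proof.
rewrite lef_pV2 ?posrE ?(lt_le_trans _ (Amratio_ge1 _))//.
by apply: ler_wpM2l; [exact: ltW|exact: mratio_nondec].
Qed.

Lemma mseq_radius_le n s : 0 <= s -> s <= radius n -> mseq M n * s ^+ n <= A^-1 ^+ n.
Proof.
move=> s0 sr.
have q : mratio M n * s <= A^-1.
  rewrite -[A^-1]mul1r ler_pdivlMr// mulrC mulrA -ler_pdivlMl ?mulr1//.
  by rewrite (lt_le_trans _ (Amratio_ge1 n)).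
have := mseq_expn_le regM s0 (leq0n n) q.
by have [_ [-> _] _ _ _] := regM; rewrite expr0 !mul1r subn0.
Qed.

Definition tnorm (z : CV) : R := Num.sqrt (tnorm2 phi z).

Lemma tnorm_ge0 z : 0 <= tnorm z. Proof. exact: sqrtr_ge0. Qed.

Lemma tnorm_sqr z : tnorm z ^+ 2 = tnorm2 phi z.
Proof. by rewrite sqr_sqrtr// tnorm2_ge0. Qed.

Lemma normc_Zdiff j z : normc (Zdiff phi j z) <= tnorm z.
Proof.
rewrite -(@ler_pXn2r _ 2)// ?nnegrE ?normc_ge0 ?tnorm_ge0// tnorm_sqr.
apply: le_trans (im_Zdiff_le phi j z).
rewrite -(@real_normK _ (im_part _ _)) ?num_real//.
apply: lerXn2r; rewrite ?nnegrE ?normc_ge0//.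
apply: (le_trans (normc_le _)).
by rewrite -[complex.Re _]/(re_part (Zdiff phi j) z) re_Zdiff normr0 add0r.
Qed.

Lemma normc_inv_nat n : normc (n%:R^-1 : R[i]) = (n%:R^-1 : R).
Proof.
have -> : (n%:R^-1 : R[i]) = (n%:R^-1)%:C by rewrite fmorphV rmorph_nat.
by rewrite normc_real ger0_norm ?invr_ge0.
Qed.

(** A pointwise bound in terms of [|t|] itself; the decay of [dbar] in the distance cannot be read
    from bounds in terms of the radius. *)
Lemma normc_taylor n w z : D z ->
  normc (taylor phi n (Xword phi w f) z) <=
  (m%:R * tnorm z) ^+ n / n`!%:R * word_size M C (n + size w).
Proof.
move=> Dz; elim: n w => [|n IH] w.
  by rewrite expr0 fact0 divr1 mul1r add0n; exact: word_le.
rewrite /= ComplexField.Normc.normcM normc_inv_nat.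
set b := (m%:R * tnorm z) ^+ n / n`!%:R * word_size M C (n.+1 + size w).
have H : normc (\sum_k Zdiff phi k z * taylor phi n (Xfield phi k (Xword phi w f)) z)
    <= m%:R * (tnorm z * b).
  apply: (le_trans (normc_sum _ _)).
  apply: (@le_trans _ _ (\sum_(k < m) tnorm z * b)).
    apply: ler_sum => k _; rewrite ComplexField.Normc.normcM.
    apply: ler_pM; rewrite ?normc_ge0 ?normc_Zdiff//.
    by have := IH (k :: w); rewrite /= /b addSnnS.
  by rewrite sumr_const card_ord mulr_natl.
have n0 : 0 <= (n.+1%:R^-1 : R) by rewrite invr_ge0.
apply: (le_trans (ler_wpM2l n0 H)).
rewrite /b factS natrM invfM exprS le_eqVlt; apply/orP; left; apply/eqP.
move: (word_size _ _ _) (n.+1%:R^-1) (n`!%:R^-1) (_ ^+ n) => c1 c2 c3 c4; ring.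
Qed.

Lemma normc_taylor_dbar : exists2 L : R, 0 <= L & forall n z j, D z ->
  normc (taylor_dbar phi n f z j) <=
  L * ((m%:R * tnorm z) ^+ n / n`!%:R * word_size M C n.+1).
Proof.
have [a [r [a0 r0 H]]] := @finite_cCkbound R CV ('I_m * 'I_m)%type 0 D
  (fun jk z => 2^-1 * cderive (delta_mx 0 jk.1) (Zcoord phi jk.2) z.1)
  (fun jk => D_bound (cCk_mul (open_fst oU) (cCk_cst 0 W 2^-1)
    (cCk_fst oU (cCk_cderive (delta_mx 0 jk.1) (Zcoord_Cinfty oU phiC jk.2 1))))).
exists (m%:R * (2 * a)); first by rewrite !mulr_ge0.
move=> n z j Dz; set b := _ / _ * _.
apply: (le_trans (normc_sum _ _)).
apply: (@le_trans _ _ (\sum_(k < m) 2 * a * b)).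
  apply: ler_sum => k _; rewrite ComplexField.Normc.normcM.
  apply: ler_pM; rewrite ?normc_ge0//.
    exact: (cCkbound_normc (H (j, k)) Dz).
  by have := normc_taylor n [:: k] Dz; rewrite /= addn1.
by rewrite sumr_const card_ord -[leLHS]mulr_natl mulrA.
Qed.

Definition chic n (z : CV) : R[i] := (chi phi (radius n) z)%:C.

Lemma chi_near_eq1 n z : D z -> tnorm2 phi z < radius n ^+ 2 / 4 ->
  \forall y \near z, chi phi (radius n) y = 1.
Proof.
move=> Dz Nz; have cN := tnorm2_continuous oU phiC DW Dz.
have /cvgr_lt/(_ _ Nz) cNz : {for z, continuous (tnorm2 phi)} := cN.
near=> y; rewrite /chi cutoff_eq1// ler_pdivrMr ?exprn_gt0 ?radius_gt0//.
by rewrite mulrC; apply: ltW; near: y.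
Unshelve. all: by end_near. Qed.

Lemma chi_near_eq0 n z : D z -> radius n ^+ 2 < tnorm2 phi z ->
  \forall y \near z, chi phi (radius n) y = 0.
Proof.
move=> Dz Nz; have cN := tnorm2_continuous oU phiC DW Dz.
have /cvgr_gt/(_ _ Nz) cNz : {for z, continuous (tnorm2 phi)} := cN.
near=> y; rewrite /chi cutoff_eq0// ler_pdivlMr ?exprn_gt0 ?radius_gt0// mul1r.
by apply: ltW; near: y.
Unshelve. all: by end_near. Qed.

(** Off the shell between [radius n / 2] and [radius n] the cutoff is constant near [z]; on the
    shell a first derivative costs [1 / radius n]. *)
Lemma dbar_chic : exists2 K : R, 0 <= K & forall n z j, D z ->
  normc (dbar (chic n) z j) <= K * (A * mratio M n) /\
  (dbar (chic n) z j != 0 ->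
     radius n ^+ 2 / 4 <= tnorm2 phi z <= radius n ^+ 2).
Proof.
have [K [c [K0 c0 H]]] := chi_bound oU phiC oD DW D_bound 1.
exists (2 * (K * c)); first by rewrite !mulr_ge0.
move=> n z j Dz.
have ub0 : 0 <= 2 * (K * c) * (A * mratio M n).
  by apply: mulr_ge0; [rewrite !mulr_ge0|exact: le_trans ler01 (Amratio_ge1 n)].
have [N1|N1] := ltP (tnorm2 phi z) (radius n ^+ 2 / 4).
  have -> : dbar (chic n) z j = 0.
    rewrite -[RHS](dbar_cst 1 z j); apply: near_dbar.
    by apply: filterS (chi_near_eq1 Dz N1) => y; rewrite /chic => ->.
  by rewrite ComplexField.Normc.normc0 eqxx.
have [N2|N2] := ltP (radius n ^+ 2) (tnorm2 phi z).
  have -> : dbar (chic n) z j = 0.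
    rewrite -[RHS](dbar_cst 0 z j); apply: near_dbar.
    by apply: filterS (chi_near_eq0 Dz N2) => y; rewrite /chic => ->.
  by rewrite ComplexField.Normc.normc0 eqxx.
split; last by move=> _; apply/andP.
have nz : near_part phi D (radius n) z.
  split=> //=; apply: le_lt_trans N2 _.
  by rewrite ltr_pMl ?exprn_gt0 ?radius_gt0// ltr1n.
have Hv v : `|v| <= 1 -> normc (cderive v (chic n) z) <= K * c * (A * mratio M n).
  move=> v1; have Hb := ((H _ (radius_gt0 n) (radius_le1 n)).2 v v1 z nz).2.
  apply: (le_trans (normc_le _)) => /=.
  rewrite [X in _ + X](_ : _ = 0).
    by rewrite addr0; move: Hb; rewrite /radius invrK mulrA.
  by rewrite -[LHS]/(`|'D_v (cst 0) z|) derive_cst normr0.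
rewrite /dbar ComplexField.Normc.normcM normc_inv_nat.
set p := cderive _ _ _; set q := cderive _ _ _.
have n1 (x : 'rV[R]_m) : (forall i, `|x 0 i| <= 1) -> `|x| <= 1.
  move=> x1; rewrite [`|x|]mx_normrE; apply/bigmax_leP; split=> // -[i k] _ /=.
  by rewrite ord1.
have d1 : `|delta_mx 0 j : 'rV[R]_m| <= 1.
  by apply: n1 => i; rewrite mxE eqxx /=; case: (i == j); rewrite ?normr1 ?normr0.
have Hp : normc p <= K * c * (A * mratio M n).
  by apply: Hv; rewrite prod_normE ge_max d1 normr0 ler01.
have Hq : normc q <= K * c * (A * mratio M n).
  by apply: Hv; rewrite prod_normE ge_max d1 normr0 ler01.
have Hiq : normc ('i%C * q) <= K * c * (A * mratio M n).
  rewrite ComplexField.Normc.normcM.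
  have -> : normc 'i%C = 1 :> R by rewrite /= expr0n expr1n add0r sqrtr1.
  by rewrite mul1r.
have : normc (p + 'i%C * q) <= 2 * (K * c * (A * mratio M n)).
  by rewrite mulr_natl mulr2n; exact: le_trans (le_normcD _ _) (lerD Hp Hiq).
rewrite mulrA; apply: le_trans; rewrite ler_piMl ?normc_ge0//.
by rewrite invf_le1// ler1n.
Qed.

Lemma chic_cdiff n z : D z -> cdiff (chic n) z.
Proof.
move=> Dz; have oW := open_fst oU; split; last exact: differentiable_cst.
have tC : Ck 1 W (tnorm2 phi).
  apply: Ck_sum => // j; have [_ h] := Zdiff_Cinfty oU phiC j 1.
  by apply: (Ck_ext oW _ (Ck_mul oW h h)) => y _; rewrite expr2.
have := Ck_comp oW (fun y _ => I) (cutoff_Ck 1 setT)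
  (Ck_mul oW tC (Ck_cst 1 W (radius n ^- 2))).
by move=> [h _]; apply: h; exact: DW.
Qed.

Lemma dbar_term n z j : D z -> dbar (term phi f (radius n) n) z j =
  dbar (chic n) z j * taylor phi n f z +
  chic n z * (taylor_dbar phi n f z j - taylor_dbar_pred phi n f z j).
Proof.
move=> Dz; have dT := taylor_cdiff oU phiC ZjacU n fC (DW Dz).
apply: etrans (dbarM j (chic_cdiff n Dz) dT) _.
by rewrite (dbar_taylor oU phiC ZjacU n j fC (DW Dz)).
Qed.

Definition step n z j : R[i] :=
  dbar (chic n) z j * taylor phi n f z +
  (chic n z - chic n.+1 z) * taylor_dbar phi n f z j.

(* Summation by parts: [dbar_taylor] is a telescoping difference. *)
Lemma sum_dbar_term N z j : D z ->
  \sum_(0 <= n < N) dbar (term phi f (radius n) n) z j =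
  \sum_(0 <= n < N) step n z j + chic N z * taylor_dbar_pred phi N f z j.
Proof.
move=> Dz; elim: N => [|N IH]; first by rewrite !big_geq// mulr0 addr0.
rewrite !big_nat_recr//= IH dbar_term//.
exact: abel_summation_step.
Qed.

Lemma taylor_sizeE n s : (m%:R * s) ^+ n / n`!%:R * word_size M C n =
  C * (m%:R * C) ^+ n * (mseq M n * s ^+ n).
Proof.
rewrite /word_size (seqME M n) exprS !exprMn.
have n0 : (n`!%:R : R) != 0 by rewrite pnatr_eq0 -lt0n fact_gt0.
by move: (mseq M n) (C ^+ n) (m%:R ^+ n) (s ^+ n) => a b c d; field.
Qed.

(** Since [M (n+1) / n! = (n+1) mratio n * m_n], the extra derivative in [H_n] costs [n + 1 <= 2^n]
    and [mratio n <= B^n], both geometric. *)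
Lemma taylor_size_le n s : 0 <= s ->
  (m%:R * s) ^+ n / n`!%:R * word_size M C n.+1 <=
  C ^+ 2 * (2 * m%:R * C * B) ^+ n * (mseq M n * s ^+ n).
Proof.
move=> s0; have mn0 := ltW (mseq_gt0 regM n).
have n0 : (n`!%:R : R) != 0 by rewrite pnatr_eq0 -lt0n fact_gt0.
have -> : (m%:R * s) ^+ n / n`!%:R * word_size M C n.+1 =
    C ^+ 2 * (m%:R * C) ^+ n * (mseq M n * s ^+ n) * (n.+1%:R * mratio M n).
  rewrite /word_size (seqME M n.+1) (mseqS regM) factS natrM !exprS expr0 !exprMn.
  by move: (mseq M n) (mratio M n) (C ^+ n) (m%:R ^+ n) (s ^+ n) n.+1%:R => a b c d e g; field.
have -> : C ^+ 2 * (2 * m%:R * C * B) ^+ n * (mseq M n * s ^+ n) =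
    C ^+ 2 * (m%:R * C) ^+ n * (mseq M n * s ^+ n) * (2 ^+ n * B ^+ n).
  rewrite !exprMn; move: (C ^+ n) (m%:R ^+ n) (s ^+ n) => a b c; ring.
apply: ler_wpM2l; first by rewrite !mulr_ge0// ?exprn_ge0// mulr_ge0.
apply: ler_pM => //; first exact: ltW (mratio_gt0 regM n).
by rewrite -natrX ler_nat ltn_expl.
Qed.

Lemma chi_le1 n z : 0 <= chi phi (radius n) z <= 1.
Proof. by rewrite cutoff_ge0 cutoff_le1. Qed.

Lemma radius_div n : radius n ^+ 2 / 4 = (radius n / 2) ^+ 2.
Proof. by field. Qed.

(** Below the window both cutoffs are 1 and above it both are 0. *)
Lemma step_inactive n z j : D z ->
  ~~ ((radius n.+1 / 2 <= tnorm z) && (tnorm z <= radius n)) ->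
  dbar (chic n) z j = 0 /\ chic n z = chic n.+1 z.
Proof.
move=> Dz nact.
have r0 k : 0 <= radius k := ltW (radius_gt0 k).
have sq (a b : R) : 0 <= a -> 0 <= b -> (a ^+ 2 <= b ^+ 2) = (a <= b).
  by move=> a0 b0; rewrite ler_pXn2r.
have t0 := tnorm_ge0 z.
have rr := radius_nonincr n.
have [K _ HK] := dbar_chic; have [_ H] := HK n z j Dz; split.
  apply/eqP; apply: contraNT nact => /H; rewrite radius_div -tnorm_sqr.
  rewrite !sq ?divr_ge0// => /andP[h1 ->]; rewrite andbT.
  by apply: le_trans h1; apply: ler_wpM2r; rewrite ?invr_ge0.
rewrite /chic /chi -tnorm_sqr; congr (_%:C).
have p2 k : 0 < radius k ^+ 2 by rewrite exprn_gt0// radius_gt0.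
move: nact; rewrite negb_and -!ltNge => /orP[h|h].
  rewrite !cutoff_eq1// ler_pdivrMr// mulrC radius_div sq ?divr_ge0// ltW//.
  by apply: (lt_le_trans h); apply: ler_wpM2r; rewrite ?invr_ge0.
rewrite !cutoff_eq0// ler_pdivlMr// mul1r sq// ltW//.
exact: le_lt_trans h.
Qed.

(** In the window a step is at most a constant times [(2 m C B)^n m_n |t|^n], and [mseq_expn_min]
    replaces [m_n |t|^n] by [m_k |t|^k] at the cost of [B^(n+1) A^-n (2 A)^k]. *)
Lemma step_bound : exists2 E : R, 0 <= E & forall n k z j, D z ->
  normc (step n z j) <=
  E * 2^-1 ^+ n * ((2 * A) ^+ k * (mseq M k * tnorm z ^+ k)).
Proof.
have [K K0 HK] := dbar_chic; have [L L0 HL] := normc_taylor_dbar.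
pose E1 := K * C + L * C ^+ 2.
have E10 : 0 <= E1 by rewrite addr_ge0// mulr_ge0// exprn_ge0.
exists (A * E1 * B); first by rewrite !mulr_ge0// ltW.
move=> n k z j Dz; have t0 := tnorm_ge0 z.
have tk0 : 0 <= mseq M k * tnorm z ^+ k.
  by rewrite mulr_ge0 ?exprn_ge0// ltW// mseq_gt0.
have tn0 : 0 <= mseq M n * tnorm z ^+ n.
  by rewrite mulr_ge0 ?exprn_ge0// ltW// mseq_gt0.
have A20 : 0 <= 2 * A by rewrite mulr_ge0// ltW.
case: (boolP ((radius n.+1 / 2 <= tnorm z) && (tnorm z <= radius n))); last first.
  move=> /(step_inactive j Dz)[d0 c0].
  rewrite /step d0 c0 subrr !mul0r addr0 ComplexField.Normc.normc0.
  by rewrite !mulr_ge0 ?exprn_ge0 ?invr_ge0// ?(ltW A0)// ltW// mseq_gt0.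
move=> /andP[h1 h2].
have Ap p : 0 < A * mratio M p by rewrite (lt_le_trans _ (Amratio_ge1 p)).
have a1 : A * mratio M n * tnorm z <= 1.
  by rewrite mulrC -ler_pdivlMr// mul1r.
have a2 : 1 <= 2 * A * mratio M n.+1 * tnorm z.
  move: h1; rewrite /radius -invfM -[(_ * 2)^-1]mul1r ler_pdivrMr;
    last by apply: mulr_gt0.
  have -> : 2 * A * mratio M n.+1 * tnorm z = tnorm z * (A * mratio M n.+1 * 2) by ring.
  by [].
have EM := mseq_expn_min regM k B1 mratio_le A1 t0 a1 a2.
have mC0 : 0 <= m%:R * C by rewrite mulr_ge0.
have q0 : 0 <= 2 * m%:R * C * B by rewrite !mulr_ge0.
have qn0 : 0 <= (2 * m%:R * C * B) ^+ n by rewrite exprn_ge0.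
have S1 : normc (step n z j) <=
    A * E1 * ((2 * m%:R * C * B) ^+ n * (mseq M n * tnorm z ^+ n)).
  apply: (le_trans (le_normcD _ _)).
  rewrite (ComplexField.Normc.normcM (dbar (chic n) z j)).
  rewrite (ComplexField.Normc.normcM (chic n z - chic n.+1 z)).
  rewrite /E1 mulrDr mulrDl; apply: lerD.
    have h3 := normc_taylor n [::] Dz; rewrite addn0 taylor_sizeE in h3.
    have [h4 _] := HK n z j Dz.
    apply: (le_trans (ler_pM (normc_ge0 _) (normc_ge0 _) h4 h3)).
    have -> : K * (A * mratio M n) * (C * (m%:R * C) ^+ n * (mseq M n * tnorm z ^+ n)) =
      A * (K * C) * (mratio M n * (m%:R * C) ^+ n * (mseq M n * tnorm z ^+ n)) by ring.
    apply: ler_wpM2l; first by rewrite !mulr_ge0// ltW.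
    apply: ler_wpM2r => //.
    apply: (@le_trans _ _ (B ^+ n * (m%:R * C) ^+ n)).
      by apply: ler_wpM2r; rewrite ?exprn_ge0.
    rewrite -exprMn; apply: lerXn2r; rewrite ?nnegrE ?mulr_ge0//.
    have -> : 2 * m%:R * C * B = 2 * (B * (m%:R * C)) by ring.
    by rewrite ler_peMl ?mulr_ge0// ler1n.
  have h5 : normc (chic n z - chic n.+1 z) <= 1.
    rewrite /chic -rmorphB normc_real ler_norml.
    have /andP[x0 x1] := chi_le1 n z; have /andP[y0 y1] := chi_le1 n.+1 z.
    by apply/andP; split; lra.
  apply: (le_trans (ler_pM (normc_ge0 _) (normc_ge0 _) h5
    (le_trans (HL n z j Dz) (ler_wpM2l L0 (taylor_size_le n t0))))).
  rewrite mul1r.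
  have -> : L * (C ^+ 2 * (2 * m%:R * C * B) ^+ n * (mseq M n * tnorm z ^+ n)) =
     1 * (L * C ^+ 2 * ((2 * m%:R * C * B) ^+ n * (mseq M n * tnorm z ^+ n))) by ring.
  rewrite -(mulrA A); apply: ler_wpM2r => //.
  apply: mulr_ge0; last exact: mulr_ge0.
  by rewrite mulr_ge0// exprn_ge0.
apply: (le_trans S1).
have An : 0 < A ^+ n by rewrite exprn_gt0.
have S2 : mseq M n * tnorm z ^+ n <=
    A ^- n * (B ^+ n.+1 * ((2 * A) ^+ k * (mseq M k * tnorm z ^+ k))).
  by rewrite ler_pdivlMl.
have AE0 : 0 <= A * E1 by rewrite mulr_ge0// ltW.
apply: (le_trans (ler_wpM2l AE0 (ler_wpM2l qn0 S2))).
have -> : A * E1 * ((2 * m%:R * C * B) ^+ n *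
     (A ^- n * (B ^+ n.+1 * ((2 * A) ^+ k * (mseq M k * tnorm z ^+ k))))) =
   A * E1 * B * (2 * m%:R * C * B * B / A) ^+ n *
     ((2 * A) ^+ k * (mseq M k * tnorm z ^+ k)).
  move: ((2 * A) ^+ k * _) => c1; rewrite exprS !exprMn exprVn.
  move: (2 ^+ n) (m%:R ^+ n) (C ^+ n) (B ^+ n) (A ^- n) => c2 c3 c4 c5 c6.
  ring.
apply: ler_wpM2r; first by rewrite mulr_ge0// exprn_ge0.
apply: ler_wpM2l; first by rewrite !mulr_ge0// ltW.
apply: lerXn2r; rewrite ?nnegrE ?invr_ge0//.
  by rewrite divr_ge0 ?mulr_ge0// ltW.
(* [A_large] is calibrated here: [2 m C B^2 / A <= 1 / 2]. *)
rewrite ler_pdivrMr//; move: A_large; rewrite expr2.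
have -> : 2 * m%:R * C * B * B = 2 * (m%:R * C * (B * B)) by ring.
have -> : 4 * m%:R * C * (B * B) = 4 * (m%:R * C * (B * B)) by ring.
move: (m%:R * C * (B * B)) => p; lra.
Qed.

(** Where the cutoff of index [N] is nonzero, [|t| <= radius N <= radius N.-1], so
    [m_(N-1) |t|^(N-1)] is at most [A^-(N-1)], which beats the geometric growth of the
    coefficients. *)
Lemma remainder_bound : exists2 E : R, 0 <= E & forall N z j, D z ->
  normc (chic N z * taylor_dbar_pred phi N f z j) <= E * 2^-1 ^+ N.
Proof.
have [L L0 HL] := normc_taylor_dbar.
have LC0 : 0 <= L * C ^+ 2 by rewrite mulr_ge0// exprn_ge0.
exists (2 * (L * C ^+ 2)); first by rewrite mulr_ge0.
move=> [|N] z j Dz.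
  by rewrite mulr0 ComplexField.Normc.normc0 !mulr_ge0// ?exprn_ge0// mulr_ge0.
have -> : 2 * (L * C ^+ 2) * 2^-1 ^+ N.+1 = L * C ^+ 2 * 2^-1 ^+ N.
  by rewrite [2^-1 ^+ N.+1]exprS; move: (L * _) (2^-1 ^+ N) => q p; field.
have b0 : 0 <= L * C ^+ 2 * 2^-1 ^+ N by rewrite mulr_ge0// exprn_ge0// invr_ge0.
rewrite (ComplexField.Normc.normcM (chic N.+1 z)) /chic normc_real.
have t0 := tnorm_ge0 z.
have [h|h] := leP (tnorm z) (radius N.+1); last first.
  rewrite /chi cutoff_eq0 ?normr0 ?mul0r//.
  rewrite ler_pdivlMr ?exprn_gt0 ?radius_gt0// mul1r -tnorm_sqr.
  by rewrite ler_pXn2r ?nnegrE//; [exact: ltW|exact: ltW (radius_gt0 _)].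
have /andP[x0 x1] := chi_le1 N.+1 z.
rewrite (ger0_norm x0).
apply: (@le_trans _ _ (1 * (L * (C ^+ 2 * (2 * m%:R * C * B) ^+ N * A^-1 ^+ N)))).
  apply: ler_pM; rewrite ?normc_ge0//.
  apply: (le_trans (HL N z j Dz)); apply: ler_wpM2l => //.
  apply: (le_trans (taylor_size_le N t0)); apply: ler_wpM2l.
    by rewrite !mulr_ge0// exprn_ge0// !mulr_ge0.
  apply: mseq_radius_le => //; exact: le_trans h (radius_nonincr N).
rewrite mul1r mulrA mulrA -mulrA; apply: ler_wpM2l => //.
rewrite -exprMn; apply: lerXn2r; rewrite ?nnegrE ?invr_ge0//.
  by rewrite divr_ge0 ?mulr_ge0// ltW.
rewrite ler_pdivrMr//.
have mCB0 : 0 <= m%:R * C * B by rewrite !mulr_ge0.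
have := ler_wpM2l mCB0 B1; move: A_large; rewrite mulr1 expr2.
have -> : 4 * m%:R * C * (B * B) = 4 * (m%:R * C * B * B) by ring.
have -> : 2 * m%:R * C * B = 2 * (m%:R * C * B) by ring.
move: (m%:R * C * B * B) (m%:R * C * B) => p q; lra.
Qed.

Definition extension (z : CV) : R[i] :=
  fsum (fun n => re_part (term phi f (radius n) n)) z +i*
  fsum (fun n => im_part (term phi f (radius n) n)) z.

(** * Convergence of the derivatives and the estimate of dbar *)

Section Growth.
Variables (k : nat) (K Q : R).
Hypothesis K0 : 0 <= K.
Hypothesis Q1 : 1 <= Q.
Hypothesis growth : forall n,
  M (n + k.+1) / n`!%:R * mratio M n ^+ k.+1 <= K * Q ^+ n * mseq M n.
Hypothesis A_Q : 8 * m%:R * C * Q * expR 1 <= A.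

(** The general term is at most a constant times [(4 m C Q e)^n m_n radius_n^n]; the last two
    factors give [A^-n], so [A_Q] makes the ratio at most [1 / 2]. *)
Lemma term_size_cvg (Kt c : R) : 0 <= Kt -> 0 <= c ->
  cvgn (series (fun n => Kt * ((4 * m%:R * radius n) ^+ n / n`!%:R
     * word_size M C (n + k.+1)) * (c * n.+1%:R / radius n) ^+ k.+1)).
Proof.
move=> Kt0 c0; have Q0 : 0 <= Q by exact: le_trans Q1.
have e0 : 0 <= (expR 1 : R) := expR_ge0 1.
pose cst0 := Kt * c ^+ k.+1 * C ^+ k.+2 * A ^+ k.+1.
have cst00 : 0 <= cst0.
  apply: mulr_ge0; last exact: exprn_ge0 (ltW A0).
  apply: mulr_ge0; last exact: exprn_ge0.
  by apply: mulr_ge0 => //; exact: exprn_ge0.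
pose cst1 := cst0 * (k.+1`!%:R * expR 1 * K).
set u := (fun n => _).
apply: (@series_le_cvg R u (fun n => cst1 * 2^-1 ^+ n)) => [n|n|n|]; rewrite /u;
  last exact: is_cvg_half_series.
- apply: mulr_ge0; last first.
    by rewrite exprn_ge0// divr_ge0 ?mulr_ge0// ltW// radius_gt0.
  rewrite mulr_ge0// mulr_ge0//; last by rewrite mulr_ge0// exprn_ge0.
  by rewrite divr_ge0// exprn_ge0// !mulr_ge0// ltW// radius_gt0.
- by rewrite mulr_ge0 ?exprn_ge0 ?invr_ge0// mulr_ge0// !mulr_ge0.
have r0 := radius_gt0 n; have nu0 := mratio_gt0 regM n.
have n0 : (0 : R) < n`!%:R by rewrite ltr0n fact_gt0.
have mn0 := ltW (mseq_gt0 regM n).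
have -> : Kt * ((4 * m%:R * radius n) ^+ n / n`!%:R * word_size M C (n + k.+1)) *
    (c * n.+1%:R / radius n) ^+ k.+1 =
  cst0 * ((4 * m%:R * C) ^+ n * radius n ^+ n * n.+1%:R ^+ k.+1 *
    (M (n + k.+1) / n`!%:R * mratio M n ^+ k.+1)).
  rewrite /word_size -addnS exprD /cst0.
  have -> : c * n.+1%:R / radius n = c * n.+1%:R * (A * mratio M n).
    by rewrite /radius invrK.
  rewrite (exprMn _ (4 * m%:R) (radius n)) (exprMn _ (4 * m%:R) C).
  rewrite (exprMn _ (c * _) (A * _)) (exprMn _ c) (exprMn _ A).
  move: (radius n ^+ n) (_ ^+ n) (C ^+ n) (M _) (n`!%:R^-1) (c ^+ _) (n.+1%:R ^+ _)
    (A ^+ _) (mratio M n ^+ _) (C ^+ _) => c1 c2 c3 c4 c5 c6 c7 c8 c9 c10; ring.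
rewrite /cst1 -[leRHS]mulrA; apply: ler_wpM2l => //.
(* The polynomial factor becomes [e^(n+1)] times a constant: the geometric rate, hence the condition
   on [A], is free of [k]. *)
have P1 : (n.+1%:R : R) ^+ k.+1 <= k.+1`!%:R * expR 1 ^+ n.+1.
  by rewrite -expRM_natl mulr1; exact: expn_le_expR.
have mC0 : 0 <= 4 * m%:R * C by rewrite !mulr_ge0.
apply: (@le_trans _ _ ((4 * m%:R * C) ^+ n * radius n ^+ n *
   (k.+1`!%:R * expR 1 ^+ n.+1) * (K * Q ^+ n * mseq M n))).
  apply: ler_pM (growth n).
  - by rewrite !mulr_ge0// exprn_ge0// ltW.
  - by rewrite mulr_ge0 ?exprn_ge0 ?divr_ge0// ltW.
  - by apply: ler_wpM2l => //; rewrite mulr_ge0// exprn_ge0// ltW.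
have -> : (4 * m%:R * C) ^+ n * radius n ^+ n *
   (k.+1`!%:R * expR 1 ^+ n.+1) * (K * Q ^+ n * mseq M n) =
   k.+1`!%:R * expR 1 * K * ((4 * m%:R * C * Q * expR 1) ^+ n * (mseq M n * radius n ^+ n)).
  rewrite exprS (exprMn _ (4 * m%:R * C * Q)) (exprMn _ (4 * m%:R * C) Q).
  move: (_ ^+ n) (radius n ^+ n) (k.+1`!%:R) (expR 1) (expR 1 ^+ n) (Q ^+ n) (mseq M n)
    => c1 c2 c3 c4 c5 c6 c7; ring.
apply: ler_wpM2l; first by rewrite !mulr_ge0.
have qq0 : 0 <= 4 * m%:R * C * Q * expR 1 by rewrite !mulr_ge0.
apply: (@le_trans _ _ ((4 * m%:R * C * Q * expR 1) ^+ n * A^-1 ^+ n)).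
  apply: ler_wpM2l; first exact: exprn_ge0.
  by apply: mseq_radius_le => //; exact: ltW.
rewrite -exprMn; apply: lerXn2r; rewrite ?nnegrE ?invr_ge0//.
  by rewrite divr_ge0// ltW.
rewrite ler_pdivrMr//; move: A_Q.
have -> : 8 * m%:R * C * Q * expR 1 = 2 * (4 * m%:R * C * Q * expR 1) by ring.
move: (4 * m%:R * C * Q * expR 1) => p; lra.
Qed.

Lemma term_bounds : exists a r : nat -> R,
  [/\ forall n, 0 <= a n, forall n, 1 <= r n,
      forall n, cCkbound k.+1 D (term phi f (radius n) n) (a n) (r n)
    & cvgn (series (fun n => a n * r n ^+ k.+1))].
Proof.
have [Kt [c [Kt0 c1 H]]] :=
  term_bound oU phiC ZjacU regM fC oD DW D_bound C1 word_le k.+1.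
have c0 : 0 <= c by exact: le_trans c1.
exists (fun n => Kt * ((4 * m%:R * radius n) ^+ n / n`!%:R * word_size M C (n + k.+1))).
exists (fun n => c * n.+1%:R / radius n); split.
- move=> n; rewrite mulr_ge0// mulr_ge0//; last by rewrite mulr_ge0// exprn_ge0.
  by rewrite divr_ge0// exprn_ge0// !mulr_ge0// ltW// radius_gt0.
- move=> n; rewrite ler_pdivlMr ?radius_gt0// mul1r.
  apply: (le_trans (radius_le1 n)); rewrite mulr_ege1// ler1n//.
- by move=> n; apply: H; [exact: radius_gt0|exact: radius_le1].
- exact: term_size_cvg.
Qed.

Lemma extension_Ck : cCk k.+1 D extension.
Proof.
have [a [r [a0 r1 H cv]]] := term_bounds.
split.
  exact: (fsum_Ck oD r1 a0 (fun n => (H n).1) cv).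
exact: (fsum_Ck oD r1 a0 (fun n => (H n).2) cv).
Qed.

Lemma extension_cderive v z : D z ->
  ccvg (fun N => \sum_(0 <= n < N) cderive v (term phi f (radius n) n) z)
    (cderive v extension z).
Proof.
move=> Dz; have [a [r [a0 r1 H cv]]] := term_bounds.
have car : cvgn (series (fun n => a n * r n)).
  apply: (series_le_cvg _ _ _ cv) => n; rewrite /= ?mulr_ge0 ?exprn_ge0//;
    try exact: le_trans (r1 n).
  by apply: ler_wpM2l => //; exact: ler_eXnr.
have H1 n := (H n).1; have H2 n := (H n).2.
have [_ e1] := fsum_derive oD Dz r1 a0 H1 car.
have [_ e2] := fsum_derive oD Dz r1 a0 H2 car.
have cvd (u : nat -> CV -> R) : (forall n, Ckbound k.+1 D (u n) (a n) (r n)) ->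
    cvgn (series (fun n => 'D_v (u n) z)).
  move=> Hu; pose b n := a n * r n * `|v|.
  apply: (@dominated_series_cvg _ _ b) => [n|].
    apply: derive_le_norm; first by have [] := (Hu n).1 z Dz.
    move=> w w1; exact: (Ckbound_ge ((Hu n).2 w w1)).
  rewrite (_ : b = `|v| *: (fun n => a n * r n)); first exact: is_cvg_seriesZ.
  by apply/funext => n; rewrite /b mulrC.
split.
  have -> : (fun N => complex.Re (\sum_(0 <= n < N) cderive v (term phi f (radius n) n) z))
      = series (fun n => 'D_v (re_part (term phi f (radius n) n)) z).
    by apply/funext => N; rewrite raddf_sum.
  rewrite -[complex.Re _]/('D_v (fsum (fun n => re_part (term phi f (radius n) n))) z) e1.
  exact: cvd.
have -> : (fun N => complex.Im (\sum_(0 <= n < N) cderive v (term phi f (radius n) n) z))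
    = series (fun n => 'D_v (im_part (term phi f (radius n) n)) z).
  by apply/funext => N; rewrite raddf_sum.
rewrite -[complex.Im _]/('D_v (fsum (fun n => im_part (term phi f (radius n) n))) z) e2.
exact: cvd.
Qed.

Lemma extension_dbar z j : D z ->
  ccvg (fun N => \sum_(0 <= n < N) dbar (term phi f (radius n) n) z j)
    (dbar extension z j).
Proof.
move=> Dz.
have -> : (fun N => \sum_(0 <= n < N) dbar (term phi f (radius n) n) z j) =
  (fun N => 2^-1 * (\sum_(0 <= n < N) cderive (delta_mx 0 j, 0) (term phi f (radius n) n) z +
    'i%C * \sum_(0 <= n < N) cderive (0, delta_mx 0 j) (term phi f (radius n) n) z)).
  by apply/funext => N; rewrite mulr_sumr -big_split mulr_sumr.
apply: ccvgM; apply: ccvgD; first exact: extension_cderive.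
by apply: ccvgM; exact: extension_cderive.
Qed.

Lemma extension_dbar_le : exists2 E : R, 0 <= E & forall p z j, D z ->
  normc (dbar extension z j) <= E * ((2 * A) ^+ p * (mseq M p * tnorm z ^+ p)).
Proof.
have [E E0 HE] := step_bound; have [E' E'0 HE'] := remainder_bound.
(* One 2 is the sum of the geometric series, the other the passage to the complex limit. *)
exists (2 * (2 * E)); first by rewrite !mulr_ge0.
move=> p z j Dz; set b := (2 * A) ^+ p * _.
have b0 : 0 <= b.
  apply: mulr_ge0; first by apply: exprn_ge0; rewrite mulr_ge0// ltW.
  apply: mulr_ge0; first exact: ltW (mseq_gt0 regM p).
  exact: exprn_ge0 (tnorm_ge0 z).
have -> : 2 * (2 * E) * b = 2 * (2 * E * b) by ring.
apply: ccvg_normc_le (extension_dbar j Dz) (cvg_geometric0 E') _ => N.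
rewrite sum_dbar_term//; apply: (le_trans (le_normcD _ _)); apply: lerD; last exact: HE'.
apply: (le_trans (normc_sum _ _)).
apply: (@le_trans _ _ (\sum_(0 <= n < N) E * b * 2^-1 ^+ n)).
  by apply: ler_sum => n _; rewrite mulrAC; exact: HE.
rewrite -mulr_sumr mulrC -[leRHS]mulrA; apply: ler_wpM2r; first exact: mulr_ge0.
exact: sum_half_le.
Qed.

End Growth.

Lemma extension_eq x : U x -> extension (Zmap phi x) = f x.
Proof.
move=> Ux.
have Z0 j : Zdiff phi j (Zmap phi x) = 0 by exact: subrr.
have t0 : tnorm2 phi (Zmap phi x) = 0.
  by rewrite /tnorm2 big1// => j _; rewrite /im_part Z0 expr0n.
have u0 : term phi f (radius 0) 0 (Zmap phi x) = f x.
  by rewrite /term /chi t0 mul0r cutoff_eq1 ?mul1r// invr_ge0.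
have un n : term phi f (radius n.+1) n.+1 (Zmap phi x) = 0.
  by rewrite /term /= big1 ?mulr0// => j _; rewrite Z0 mul0r.
have lim1 (u : nat -> R) : (forall n, u n.+1 = 0) -> limn (series u) = u 0%N.
  move=> un0; apply: cvg_lim => //; rewrite -cvg_shiftS.
  rewrite (_ : (fun n => _) = (fun _ => u 0%N)); first exact: cvg_cst.
  apply/funext => n; rewrite /series /= big_nat_recl// big1 ?addr0.
    by [].
  by move=> i _; exact: un0.
apply: complex_eq; rewrite /= /fsum lim1; rewrite /re_part /im_part ?u0//.
  by move=> n; rewrite un.
by move=> n; rewrite un.
Qed.

End Extension.

(** * Euclidean norms and the distance to Sigma *)

Section Distances.
Variables (R : realType) (m : nat).
Notation CV := (Cspace R m).
Notation normc := ComplexField.Normc.normc.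
Implicit Types (x y : 'rV[R]_m) (z w : CV).

Lemma sqr_enorm x : enorm x ^+ 2 = \sum_(i < m) x 0 i ^+ 2.
Proof. by rewrite sqr_sqrtr// sumr_ge0// => i _; exact: sqr_ge0. Qed.

Lemma enorm_ge0 x : 0 <= enorm x. Proof. exact: sqrtr_ge0. Qed.

Lemma enormN x : enorm (- x) = enorm x.
Proof.
by rewrite /enorm; congr Num.sqrt; apply: eq_bigr => i _; rewrite mxE sqrrN.
Qed.

(** It follows coordinatewise from [(a + b)^2 <= 2 a^2 + 2 b^2]. *)
Lemma enorm_add_le x y c : 0 <= c -> enorm x <= c -> enorm y <= c ->
  enorm (x + y) <= 2 * c.
Proof.
move=> c0 xc yc; rewrite -(@ler_pXn2r _ 2)// ?nnegrE ?enorm_ge0 ?mulr_ge0//.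
have sq (u : 'rV[R]_m) : enorm u <= c -> enorm u ^+ 2 <= c ^+ 2.
  by move=> uc; apply: lerXn2r; rewrite ?nnegrE ?enorm_ge0.
apply: (@le_trans _ _ (2 * enorm x ^+ 2 + 2 * enorm y ^+ 2)).
  rewrite !sqr_enorm !mulr_sumr -big_split; apply: ler_sum => i _ /=.
  rewrite mxE; have := sqr_ge0 (x 0 i - y 0 i).
  rewrite sqrrB sqrrD; lra.
have := sq x xc; have := sq y yc; rewrite exprMn -natrX.
move: (enorm x ^+ 2) (enorm y ^+ 2) (c ^+ 2) => p q s; lra.
Qed.

Lemma coord_le_enorm x i : `|x 0 i| <= enorm x.
Proof.
rewrite -sqrtr_sqr /enorm ler_wsqrtr// (bigD1 i)//= lerDl sumr_ge0// => j _.
exact: sqr_ge0.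
Qed.

Lemma enorm_le_norm x : enorm x <= m.+1%:R * `|x|.
Proof.
rewrite -(@ler_pXn2r _ 2)// ?nnegrE ?enorm_ge0 ?mulr_ge0//.
rewrite sqr_enorm exprMn.
apply: (@le_trans _ _ (\sum_(i < m) `|x| ^+ 2)).
  apply: ler_sum => i _; rewrite -(@real_normK _ (x 0 i)) ?num_real//.
  by apply: lerXn2r; rewrite ?nnegrE// coord_le_norm.
rewrite sumr_const card_ord -[leLHS]mulr_natl; apply: ler_wpM2r; first exact: sqr_ge0.
rewrite -natrX ler_nat; apply: (@leq_trans m.+1) => //.
by rewrite -mulnn leq_pmulr.
Qed.

Lemma cnorm_ge0 (w : 'I_m -> R[i]) : 0 <= cnorm w.
Proof. exact: sqrtr_ge0. Qed.

Lemma sqr_cnorm z : cnorm (ccoord z) ^+ 2 = enorm z.1 ^+ 2 + enorm z.2 ^+ 2.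
Proof.
rewrite sqr_sqrtr; last by apply: sumr_ge0 => i _; exact: sqr_ge0.
rewrite !sqr_enorm -big_split; apply: eq_bigr => i _ /=.
by rewrite sqr_sqrtr// addr_ge0 ?sqr_ge0.
Qed.

Lemma enorm1_le_cnorm z : enorm z.1 <= cnorm (ccoord z).
Proof.
rewrite -(@ler_pXn2r _ 2)// ?nnegrE ?enorm_ge0 ?cnorm_ge0//.
by rewrite sqr_cnorm lerDl sqr_ge0.
Qed.

Lemma enorm2_le_cnorm z : enorm z.2 <= cnorm (ccoord z).
Proof.
rewrite -(@ler_pXn2r _ 2)// ?nnegrE ?enorm_ge0 ?cnorm_ge0//.
by rewrite sqr_cnorm lerDr sqr_ge0.
Qed.

Lemma norm_le_enorm x : `|x| <= enorm x.
Proof.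
rewrite [`|x|]mx_normrE; apply/bigmax_leP; split; first exact: enorm_ge0.
by move=> [i j] _ /=; rewrite ord1; exact: coord_le_enorm.
Qed.

Lemma norm_le_cnorm z : `|z| <= cnorm (ccoord z).
Proof.
rewrite prod_normE ge_max (le_trans (norm_le_enorm _) (enorm1_le_cnorm z)).
exact: le_trans (norm_le_enorm _) (enorm2_le_cnorm z).
Qed.

Lemma cnorm_le_sum (w : 'I_m -> R[i]) : cnorm w <= \sum_(i < m) normc (w i).
Proof.
have s0 : 0 <= \sum_(i < m) normc (w i) by apply: sumr_ge0 => i _; exact: normc_ge0.
rewrite -(@ler_pXn2r _ 2)// ?nnegrE ?cnorm_ge0//.
rewrite sqr_sqrtr; last by apply: sumr_ge0 => i _; exact: sqr_ge0.
rewrite expr2 mulr_suml; apply: ler_sum => i _; rewrite expr2.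
apply: ler_wpM2l; first exact: normc_ge0.
by rewrite (bigD1 i)//= lerDl sumr_ge0// => j _; exact: normc_ge0.
Qed.

Lemma tnormE (phi : 'rV[R]_m -> 'rV[R]_m) z : tnorm phi z = enorm (z.2 - phi z.1).
Proof.
rewrite /tnorm /enorm; congr Num.sqrt; apply: eq_bigr => i _.
by rewrite !mxE.
Qed.

End Distances.

(** * Choice of the neighbourhood and of the constants *)

Section LocalExtension.
Variables (R : realType) (m : nat) (M : nat -> R).
Variables (Sigma Omega : set (Cspace R m)) (U : set 'rV[R]_m).
Variables (phi : 'rV[R]_m -> 'rV[R]_m) (Cphi : R) (f : 'rV[R]_m -> R[i]).
Notation CV := (Cspace R m).
Notation normc := ComplexField.Normc.normc.
Hypothesis regM : regular_sequence M.
Hypothesis oOmega : open Omega.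
Hypothesis Omega0 : Omega 0.
Hypothesis oU : open U.
Hypothesis U0 : U 0.
Hypothesis phiC : Cinfty U phi.
Hypothesis phi0 : phi 0 = 0.
Hypothesis Cphi1 : Cphi < 1.
Hypothesis lip : forall x x', U x -> U x' ->
  enorm (phi x - phi x') <= Cphi * enorm (x - x').
Hypothesis SO : Sigma `&` Omega = [set z | [/\ Omega z, U z.1 & z.2 = phi z.1]].
Hypothesis fCM : CM phi M U f.

Lemma lip1 x x' : U x -> U x' -> enorm (phi x - phi x') <= enorm (x - x').
Proof.
move=> Ux Ux'; apply: (le_trans (lip Ux Ux')).
by rewrite ler_piMl ?enorm_ge0// ltW.
Qed.

(** For [w] on the graph, [t = (z.2 - w.2) + (phi w.1 - phi z.1)], and both summands are at most
    [|z - w|] by the Lipschitz bound. The distance, however, is taken to all of [Sigma], which is a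
    known graph only inside [Omega]. *)
Lemma tnorm_le_dist (r d : R) z : 0 < d -> (forall w : CV, `|w| < d -> Omega w) ->
  (forall x : 'rV[R]_m, `|x| < r -> U x) ->
  0 < r -> (2 * m.+1%:R + 1) * r <= d ->
  `|z| < r -> tnorm phi z <= 2 * dist_to z Sigma.
Proof.
move=> d0 dO rU r0 rd zr.
have Uz : U z.1.
  by apply: rU; apply: le_lt_trans zr; rewrite prod_normE le_max lexx.
have S0 : Sigma 0.
  have : (Sigma `&` Omega) 0 by rewrite SO; split.
  by case.
rewrite mulrC -ler_pdivrMr//; apply: lb_le_inf.
  by exists (cnorm (ccoord (z - 0))), 0.
move=> _ [w Sw <-]; rewrite ler_pdivrMr// mulrC tnormE.
set c := cnorm _; have c0 : 0 <= c := cnorm_ge0 _.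
have [wd|wd] := ltP `|w| d.
  have Ow := dO w wd.
  have : (Sigma `&` Omega) w by split.
  rewrite SO => -[_ Uw ew].
  rewrite -(subrKA w.2); apply: enorm_add_le => //.
    exact: (enorm2_le_cnorm (z - w)).
  rewrite ew; apply: (le_trans (lip1 Uw Uz)).
  by rewrite -opprB enormN; exact: (enorm1_le_cnorm (z - w)).
(* Remaining points satisfy [|w| >= d], so [|z - w| >= d - r >= 2 (m+1) r], while
   [|t| <= 2 (m+1) r]; the factor [m + 1] compares the Euclidean norm with the sup norm. *)
have z1 : `|z.1| <= r.
  by apply: le_trans (ltW zr); rewrite prod_normE le_max lexx.
have z2 : `|z.2| <= r.
  by apply: le_trans (ltW zr); rewrite prod_normE le_max lexx orbT.
have er (x : 'rV[R]_m) : `|x| <= r -> enorm x <= m.+1%:R * r.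
  by move=> xr; apply: (le_trans (enorm_le_norm x)); exact: ler_wpM2l.
apply: (@le_trans _ _ (2 * (m.+1%:R * r))).
  apply: enorm_add_le; first by rewrite mulr_ge0// ltW.
    exact: er.
  rewrite enormN -[phi z.1]subr0 -phi0; apply: (le_trans (lip1 Uz U0)).
  by rewrite subr0; exact: er.
have cz : d - r <= c.
  apply: le_trans (norm_le_cnorm (z - w)).
  rewrite distrC; apply: le_trans (lerB_normD w (- z)).
  by rewrite normrN; apply: lerB => //; exact: ltW.
move: rd cz c0; rewrite mulrDl mul1r -mulrA; move: (m.+1%:R * r) => p; lra.
Qed.

(** [P] selects the orders of differentiation to be achieved with one common [Q]: a singleton in the
    regular case, everything under moderate growth. The estimate of [dbar] needs one such order,
    whence [exists k, P k]. *)
Lemma local_extension (P : nat -> Prop) (Q : R) : 1 <= Q -> (exists k, P k) ->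
  (forall k, P k -> exists2 K : R, 0 <= K &
     forall n, M (n + k.+1) / n`!%:R * mratio M n ^+ k.+1 <= K * Q ^+ n * mseq M n) ->
  exists (O : set CV) (F : CV -> R[i]) (C : R),
    [/\ open O /\ O 0, O `<=` Omega, (forall k, P k -> cCk k.+1 O F), 0 < C
      & extends_with_estimate M phi U Sigma O f F C].
Proof.
move=> Q1 [k0 Pk0] HP; have [fC _] := fCM.
have ZjacU x : U x -> Zjac phi x \in unitmx.
  by move=> Ux; apply: (Zjac_unit oU Ux _ Cphi1 lip); have [dphi _] := phiC 1; exact: dphi.
have [B B1 HB] := mratio_le_expn regM.
have [d d0 dO] : exists2 d : R, 0 < d & forall w : CV, `|w| < d -> Omega w.
  have /nbhs_ballP[d /= d0 Hd] : nbhs (0 : CV) Omega by exact: open_nbhs_nbhs.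
  by exists d => // w wd; apply: Hd; rewrite -ball_normE /ball_ /= sub0r normrN.
have [e e0 eU] : exists2 e : R, 0 < e & forall x : 'rV[R]_m, `|x| < e -> U x.
  have /nbhs_ballP[d' /= d'0 Hd] : nbhs (0 : 'rV[R]_m) U by exact: open_nbhs_nbhs.
  by exists d' => // w wd; apply: Hd; rewrite -ball_normE /ball_ /= sub0r normrN.
(* The first bound keeps the closed ball inside [U], the second serves the comparison with the
   distance and [D] inside [Omega]. *)
pose r := Num.min (e / 2) (d / (2 * m.+1%:R + 1)).
have md0 : 0 < (2 * m.+1%:R + 1 : R) by rewrite addr_gt0// mulr_gt0.
have r0 : 0 < r by rewrite lt_min !divr_gt0.
have re : r < e.
  by rewrite gt_min; apply/orP; left; rewrite ltr_pdivrMr// ltr_pMr// ltr1n.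
have rd : (2 * m.+1%:R + 1) * r <= d.
  by rewrite mulrC -ler_pdivlMr// ge_min lexx orbT.
have rU x : `|x| < r -> U x by move=> xr; apply: eU; exact: lt_trans re.
pose K := [set x : 'rV[R]_m | `|x| <= r].
have cK : compact K.
  apply: bounded_closed_compact.
    by exists r; split; [exact: num_real|move=> y ry x /= xr; exact: le_trans (ltW ry)].
  have := @closed_comp _ _ (fun x : 'rV[R]_m => `|x|) [set y : R | y <= r]
    (fun x _ => @norm_continuous _ _ x) (@closed_le _ r).
  by [].
have KU : K `<=` U by move=> x xr; apply: eU; exact: le_lt_trans re.
pose D := [set z : CV | `|z| < r].
have oD : open D.
  have := @open_comp _ _ (fun z : CV => `|z|) [set y : R | y < r]
    (fun z _ => @norm_continuous _ _ z) (@open_lt _ r).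
  by [].
have D1 z : D z -> `|z.1| < r.
  by move=> zr; apply: le_lt_trans zr; rewrite prod_normE le_max lexx.
have D2 z : D z -> `|z.2| < r.
  by move=> zr; apply: le_lt_trans zr; rewrite prod_normE le_max lexx orbT.
have DW : D `<=` [set z : CV | U z.1] by move=> z /D1; exact: rU.
have DB k (g : CV -> R[i]) : cCk k [set z : CV | U z.1] g ->
    exists a s, [/\ 0 <= a, 0 <= s & cCkbound k D g a s].
  apply: (cCk_cCkbound (compact_setX cK cK)) => //.
  - by move=> z [/KU].
  - exact: open_fst.
  - by move=> z Dz; split; apply: ltW; [exact: D1|exact: D2].
have [C0 C00 HC] := CM_word oU phiC ZjacU fCM cK KU.
pose C := Num.max 1 C0.
have C1 : 1 <= C by rewrite le_max lexx.
have wl w z : D z -> normc (Xword phi w f z.1) <= C ^+ (size w).+1 * M (size w).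
  move=> Dz; apply: (le_trans (HC w z.1 (ltW (D1 z Dz)))).
  apply: ler_wpM2r; first by have [] := regM.
  by apply: lerXn2r; rewrite ?nnegrE ?le_max ?ler01 ?(ltW C00) ?lexx ?orbT.
(* The sum of the three lower bounds required of [A]. *)
pose A := 1 + 4 * m%:R * C * B ^+ 2 + 8 * m%:R * C * Q * expR 1.
have C0' : 0 <= C by exact: le_trans C1.
have B0 : 0 <= B by exact: le_trans B1.
have Q0 : 0 <= Q by exact: le_trans Q1.
have x1 : 0 <= 4 * m%:R * C * B ^+ 2 by rewrite mulr_ge0 ?sqr_ge0// !mulr_ge0.
have x2 : 0 <= 8 * m%:R * C * Q * expR 1 by rewrite mulr_ge0 ?expR_ge0// !mulr_ge0.
have A1 : 1 <= A by rewrite /A -addrA lerDl addr_ge0.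
have AB : 4 * m%:R * C * B ^+ 2 <= A by rewrite /A; move: x1 x2; lra.
have AQ : 8 * m%:R * C * Q * expR 1 <= A by rewrite /A; move: x1 x2; lra.
have A0 : 0 <= A by exact: le_trans A1.
have [Kk0 Kk00 gk0] := HP k0 Pk0.
have [E E0 HE] := extension_dbar_le oU phiC ZjacU regM fC oD DW DB C1 wl B1 HB A1 AB
  Kk00 Q1 gk0 AQ.
(* [4 A] is [2 A] times the 2 in [|t| <= 2 dist]; [m E], from the sum over components, is absorbed
   by the extra factor in [C ^+ k.+1]. *)
exists D, (extension phi M f A), (m%:R * E + 4 * A).
split.
- by split=> //; rewrite /D /= normr0.
- move=> z zr; apply: dO; apply: (lt_le_trans zr); apply: le_trans rd.
  by rewrite ler_peMl ?(ltW r0)// lerDr mulr_ge0.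
- move=> k Pk; have [Kk Kk0' gk] := HP k Pk.
  exact: (extension_Ck oU phiC ZjacU regM fC oD DW DB C1 wl A1 Kk0' Q1 gk AQ).
- by rewrite ltr_wpDl ?mulr_ge0// mulr_gt0// (lt_le_trans _ A1).
split; first by move=> x Ux _; exact: extension_eq.
move=> k z Dz.
have t0 := tnorm_ge0 phi z.
have td := tnorm_le_dist d0 dO rU r0 rd Dz.
have dist0 : 0 <= dist_to z Sigma.
  by rewrite -(@pmulr_rge0 _ 2)//; exact: le_trans td.
have mk0 := ltW (mseq_gt0 regM k).
apply: (le_trans (cnorm_le_sum _)).
apply: (@le_trans _ _ (\sum_(j < m) E * ((2 * A) ^+ k * (mseq M k * tnorm phi z ^+ k)))).
  by apply: ler_sum => j _; exact: HE.
rewrite sumr_const card_ord -[leLHS]mulr_natl mulrA.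
apply: (@le_trans _ _ (m%:R * E * ((2 * A) ^+ k * (mseq M k * (2 * dist_to z Sigma) ^+ k)))).
  do 3 (apply: ler_wpM2l; first by rewrite ?exprn_ge0// mulr_ge0).
  by apply: lerXn2r; rewrite ?nnegrE ?mulr_ge0.
have -> : m%:R * E * ((2 * A) ^+ k * (mseq M k * (2 * dist_to z Sigma) ^+ k)) =
    m%:R * E * (4 * A) ^+ k * (mseq M k * dist_to z Sigma ^+ k).
  have -> : 4 * A = 2 * A * 2 by ring.
  rewrite (exprMn _ (2 * A) 2) (exprMn _ 2 (dist_to _ _)).
  move: ((2 * A) ^+ k) (2 ^+ k) (dist_to _ _ ^+ k) => a b c; ring.
rewrite -[leRHS]mulrA; apply: ler_wpM2r; first by rewrite mulr_ge0// exprn_ge0.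
have A40 : 0 <= 4 * A by rewrite mulr_ge0.
have mE0 : 0 <= m%:R * E by rewrite mulr_ge0.
rewrite exprS; apply: ler_pM => //; first exact: exprn_ge0.
  by rewrite lerDl.
by apply: lerXn2r; rewrite ?nnegrE ?addr_ge0// lerDr.
Qed.

End LocalExtension.

Theorem theorem4p1 (R : realType) (m : nat) (M : nat -> R)
    (Sigma Omega : set (Cspace R m)) (U : set 'rV[R]_m)
    (phi : 'rV[R]_m -> 'rV[R]_m) (Cphi : R)
    (f : 'rV[R]_m -> R[i]) (kappa : nat) :
  regular_sequence M ->
  maximally_real Sigma ->
  open Omega -> Omega 0 ->
  open U -> U 0 ->
  Cinfty U phi -> phi 0 = 0 -> (forall v : 'rV[R]_m, 'd phi 0 v = 0) ->
  Cphi < 1 ->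
  (forall x x', U x -> U x' ->
     enorm (phi x - phi x') <= Cphi * enorm (x - x')) ->
  Sigma `&` Omega = [set z | [/\ Omega z, U z.1 & z.2 = phi z.1]] ->
  Sigma `&` Omega = Zmap phi @` U ->
  CM phi M U f ->
  (1 <= kappa)%N ->
  (exists (O : set (Cspace R m)) (F : Cspace R m -> R[i]) (C : R),
     [/\ open O /\ O 0, O `<=` Omega, cCk kappa O F, 0 < C
       & extends_with_estimate M phi U Sigma O f F C]) /\
  (moderate_growth M ->
   exists (O : set (Cspace R m)) (F : Cspace R m -> R[i]) (C : R),
     [/\ open O /\ O 0, O `<=` Omega, cCinfty O F, 0 < C
       & extends_with_estimate M phi U Sigma O f F C]).
Proof.
move=> regM _ oOmega Omega0 oU U0 phiC phi0 _ Cphi1 lip SO _ fCM.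
have ext := local_extension regM oOmega Omega0 oU U0 phiC phi0 Cphi1 lip SO fCM.
case: kappa => // k _; split.
  have [Q Q1 HQ] := finite_growth regM k.+1.
  have [||O [F [C [h1 h2 h3 h4 h5]]]] := ext (fun j => j = k) Q Q1.
  - by exists k.
  - by move=> _ ->.
  - by exists O, F, C; split=> //; exact: h3.
(* [Q] is now common to all orders, so the same [F] is of every class. *)
move=> /(moderate_growth_bound regM)[Q Q1 HQ].
have [||O [F [C [h1 h2 h3 h4 h5]]]] := ext (fun _ => True) Q Q1.
- by exists 0%N.
- by move=> j _; exact: HQ.
- exists O, F, C; split=> // j; have [r i] := h3 j I.
  by split; exact: CkW.
Qed.
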